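(* Let $\mathcal C$ be a non-empty class of finite groups closed under taking subgroups, homomorphic images and extensions. Let $(\mathcal G,\Gamma)$ be a reduced (abstract) graph of groups over a (connected, possibly infinite) abstract graph $\Gamma$ and let $G=\pi_1(\mathcal G,\Gamma)$ be its fundamental group. Assume that $G$ is residually $\mathcal C$, and for $m\in\Gamma$ let $\overline{\mathcal G}(m)$ be the closure of $\mathcal G(m)$ in the pro-$\mathcal C$ completion $G_{\widehat{\mathcal C}}$. Then: (a) there exists a profinite graph of pro-$\mathcal C$ groups $(\overline{\mathcal G},\overline\Gamma)$ such that $\Gamma$ is densely embedded in $\overline\Gamma$; (b) for each $m\in\Gamma$ the group of $(\overline{\mathcal G},\overline\Gamma)$ over $m$ is $\overline{\mathcal G}(m)$; (c) the fundamental pro-$\mathcal C$ group $\Pi=\Pi_1^{\mathcal C}(\overline{\mathcal G},\overline\Gamma)$ of $(\overline{\mathcal G},\overline\Gamma)$ is the pro-$\mathcal C$ completion of $G$, so that all the vertex groups of $(\overline{\mathcal G},\overline\Gamma)$ embed in $\Pi_1^{\mathcal C}(\overline{\mathcal G},\overline\Gamma)$ (i.e. $(\overline{\mathcal G},\overline\Gamma)$ is injective); (d) if in addition $\mathcal G(m)$ is closed in the pro-$\mathcal C$ topology of $G$ for every $m\in\Gamma$, then the standard tree $S^{abs}(\mathcal G,\Gamma)$ of $(\mathcal G,\Gamma)$ embeds densely in the standard pro-$\mathcal C$ tree $S^{\mathcal C}(\overline{\mathcal G},\overline\Gamma)$ of $(\overline{\mathcal G},\overline\Gamma)$ in such a way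 that the action of $\Pi_1^{\mathcal C}(\overline{\mathcal G},\overline\Gamma)$ on $S^{\mathcal C}(\overline{\mathcal G},\overline\Gamma)$ extends the natural action of $\pi_1(\mathcal G,\Gamma)$ on $S^{abs}(\mathcal G,\Gamma)$.
   Context: Pro-$\mathcal C$ notions. A pro-$\mathcal C$ group is an inverse limit of groups in $\mathcal C$. The pro-$\mathcal C$ topology of an abstract group $G$ has the normal subgroups $U$ with $G/U\in\mathcal C$ as a fundamental system of neighbourhoods of $1$; $G$ is residually $\mathcal C$ if this topology is Hausdorff. The pro-$\mathcal C$ completion is $G_{\widehat{\mathcal C}}=\varprojlim_U G/U$; if $G$ is residually $\mathcal C$, $G$ is identified with its image in $G_{\widehat{\mathcal C}}$. Graphs. A (profinite) graph is a set (profinite space) $\Gamma$ with a distinguished non-empty (closed) subset $V(\Gamma)$ of vertices, $E(\Gamma)=\Gamma\setminus V(\Gamma)$, and two (continuous) maps $d_0,d_1:\Gamma\to V(\Gamma)$ that are the identity on $V(\Gamma)$. A morphism is a (continuous) map commuting with $d_0,d_1$. A profinite graph is connected if all its finite quotient graphs are connected. Graphs of groups. A sheaf of (profinite) groups over $\Gamma$ is a (continuous) surjection $\pi:\mathcal G\to\Gamma$ of sets (profinite spaces) whose fibres $\mathcal G(m)=\pi^{-1}(m)$ are (profinite) groups, and in the profinite case the map $(g,h)\mapsto gh^{-1}$ on $\{(g,h)\in \mathcal G\times\mathcal G: \pi(g)=\pi(h)\}$ is continuous. A (profinite) graph of (profinite) groups $(\mathcal G,\Gamma)$ over a connected (profinite)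 graph $\Gamma$ is such a sheaf together with (continuous) maps $\partial_i:\mathcal G\to \mathcal G_V=\pi^{-1}(V(\Gamma))$, $i=0,1$, with $\pi\partial_i=d_i\pi$, which are the identity on $\mathcal G_V$ and restrict to injective homomorphisms $\mathcal G(m)\to\mathcal G(d_i(m))$ for all $m\in \Gamma$. It is reduced if for every edge $e$ that is not a loop, $\partial_i(\mathcal G(e))$ is a proper subgroup of $\mathcal G(d_i(e))$, $i=0,1$. Abstract fundamental group and standard tree. For an abstract graph of groups and a maximal subtree $T$ of $\Gamma$, $G=\pi_1(\mathcal G,\Gamma)$ is the group generated by the groups $\mathcal G(v)$ ($v\in V(\Gamma)$) and elements $t_e$ ($e\in E(\Gamma)$) with relations $\partial_0(x)=t_e\partial_1(x)t_e^{-1}$ ($x\in\mathcal G(e)$) and $t_e=1$ for $e\in E(T)$. Each $\mathcal G(e)$ is viewed as a subgroup of $G$ via $\partial_0$. The standard tree $S^{abs}(\mathcal G,\Gamma)$ has vertices $\bigsqcup_{v\in V(\Gamma)}G/\mathcal G(v)$, edges $\bigsqcup_{e\in E(\Gamma)}G/\mathcal G(e)$, $d_0(g\mathcal G(e))=g\mathcal G(d_0(e))$, $d_1(g\mathcal G(e))=gt_e\mathcal G(d_1(e))$; $G$ acts by left multiplication. Pro-$\mathcal C$ fundamental group. A Galois $\mathcal C$-covering of a profinite graph $\Gamma$ is a quotient map $\zeta:\Lambda\to A\backslash\Lambda=\Gamma$, where $A$ is a pro-$\mathcal C$ group acting freely on the profinite graph $\Lambda$. For $\Gamma$ connected, the universal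 $\mathcal C$-covering $\zeta:\widetilde\Gamma\to\Gamma$ is the one with $\widetilde\Gamma$ connected and having no non-trivial connected Galois $\mathcal C$-coverings; its group is $\pi_1^{\mathcal C}(\Gamma)$. A continuous 0-section is a continuous map $j:\Gamma\to\widetilde\Gamma$ with $\zeta j=\mathrm{id}$ and $jd_0=d_0j$; put $J=j(\Gamma)$, and let $\chi(m)\in\pi_1^{\mathcal C}(\Gamma)$ be the unique element with $\chi(m)(jd_1(m))=d_1j(m)$. A $J$-specialisation of a profinite graph of pro-$\mathcal C$ groups $(\mathcal G,\Gamma)$ in a pro-$\mathcal C$ group $H$ is a pair $(\beta,\beta')$, where $\beta:\mathcal G\to H$ is continuous and a homomorphism on each fibre, $\beta':\pi_1^{\mathcal C}(\Gamma)\to H$ is a continuous homomorphism, and $\beta(x)=\beta\partial_0(x)=(\beta'\chi(m))(\beta\partial_1(x))(\beta'\chi(m))^{-1}$ for all $x\in\mathcal G$, $m=\pi(x)$. The pro-$\mathcal C$ fundamental group $\Pi_1^{\mathcal C}(\mathcal G,\Gamma)$ is the pro-$\mathcal C$ group with a universal $J$-specialisation $(\nu,\nu')$: every $J$-specialisation $(\beta,\beta')$ in a pro-$\mathcal C$ group $H$ equals $(\delta\nu,\delta\nu')$ for a unique continuous homomorphism $\delta:\Pi_1^{\mathcal C}(\mathcal G,\Gamma)\to H$. (It is independent of $J$ up to isomorphism.) $(\mathcal G,\Gamma)$ is injective if $\nu$ is injective on every fibre $\mathcal G(m)$. Standard pro-$\mathcal C$ tree. Put $\Pi=\Pi_1^{\mathcal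 C}(\mathcal G,\Gamma)$ and $\Pi(m)=\nu(\mathcal G(m))$. $S^{\mathcal C}(\mathcal G,\Gamma)=\bigsqcup_{m\in\Gamma}\Pi/\Pi(m)$ with the quotient topology from $\Gamma\times\Pi$, vertex set $\bigsqcup_{v\in V(\Gamma)}\Pi/\Pi(v)$, $d_0(h\Pi(m))=h\Pi(d_0(m))$, $d_1(h\Pi(m))=h\,\nu'\chi(m)\,\Pi(d_1(m))$; $\Pi$ acts continuously by left multiplication. *)

(* Defs.v *)
From HB Require Import structures.
From mathcomp Require Import all_boot all_fingroup.
From mathcomp Require Import all_classical.
From mathcomp Require Import topology.

Set Implicit Arguments.
Unset Strict Implicit.
Unset Printing Implicit Defensive.

Local Open Scope classical_set_scope.
Local Open Scope group_scope.
Local Open Scope quotient_scope.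

(* Not the [repr] of finite groups. *)
Local Notation repr := generic_quotient.repr.

(** * Classes of finite groups *)

(* Closure under isomorphism is the injective case of [ext_image]. *)
Record extension_closed_variety (C : finGroupType -> Prop) : Prop := {
  ext_nonempty : exists Q : finGroupType, C Q;
  ext_subgroup : forall (Q : finGroupType) (H : {group Q}),
    C Q -> C (subg_of H);
  ext_image : forall (Q R : finGroupType) (f : {multiplicative Q -> R}),
    (forall y, exists x, f x = y) -> C Q -> C R;
  ext_extension : forall (Q : finGroupType) (N : {group Q}),
    N <| [set: Q]%G -> C (subg_of N) -> C (coset_of N) -> C Q }.

(** * Topological groups and pro-C groups *)

HB.mixin Record isTopGroup G of Topological G & monoid.Group G := {
  mulg_continuous : continuous (fun p : G * G => (p.1 * p.2)%g);
  invg_continuous : continuous (fun x : G => x^-1%g) }.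

#[short(type="topGroupType")]
HB.structure Definition TopGroup :=
  { G of isTopGroup G & Topological G & monoid.Group G }.

(* [q] presents the finite group [Q] as the quotient of [G] by [U]; the sets
   [U] for which such a [q] exists are normal subgroups, as kernels. *)
Definition quotient_map (G : groupType) (U : set G) (Q : finGroupType)
    (q : G -> Q) :=
  [/\ {morph q : x y / x * y}, forall y, exists x, q x = y
    & U = [set x | q x = 1]].

Definition C_normal (C : finGroupType -> Prop) (G : groupType) (U : set G) :=
  exists (Q : finGroupType) (q : G -> Q), C Q /\ quotient_map U q.

Definition inverse_system (I : Type) (le : I -> I -> Prop)
    (Q : I -> finGroupType) (f : forall i j, Q j -> Q i) :=
  [/\ (exists i : I, True) /\ (forall i, le i i),
      forall i j k, le i j -> le j k -> le i k,
      forall i j, exists k, le i k /\ le j k,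
      forall i j, le i j -> {morph f i j : x y / x * y}
    & (forall i x, f i i x = x) /\
      (forall i j k x, le i j -> le j k -> f i k x = f i j (f j k x))].

(* [L] with the projections [p] is the inverse limit of the system [f], that
   is, [p] identifies [L] with the compatible families, and the topology of [L]
   is the one induced from the product of the discrete groups [Q i]; the index
   set being directed, the cosets of the kernels of the [p i] form a basis. *)
Definition inverse_limit (I : Type) (le : I -> I -> Prop)
    (Q : I -> finGroupType) (f : forall i j, Q j -> Q i)
    (L : topGroupType) (p : forall i, L -> Q i) :=
  [/\ inverse_system le f,
      forall i, {morph p i : x y / x * y},
      forall i j x, le i j -> f i j (p j x) = p i x,
      forall y : forall i, Q i, (forall i j, le i j -> f i j (y j) = y i) ->
        exists! x : L, forall i, p i x = y i
    & forall (x : L) (A : set L),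
        nbhs x A <-> exists i, [set y | p i y = p i x] `<=` A].

Definition pro_C (C : finGroupType -> Prop) (L : topGroupType) :=
  exists (I : Type) (le : I -> I -> Prop) (Q : I -> finGroupType)
    (f : forall i j, Q j -> Q i) (p : forall i, L -> Q i),
    (forall i, C (Q i)) /\ inverse_limit le f p.

(* [K] is the inverse limit of the quotients [G / U], with [U] ranging over the
   normal subgroups with [G / U] in [C] ordered by reverse inclusion, and
   [iota] is the canonical map. *)
Definition pro_C_completion (C : finGroupType -> Prop) (G : groupType)
    (K : topGroupType) (iota : G -> K) :=
  exists (Q : {U : set G | C_normal C U} -> finGroupType)
    (q : forall U, G -> Q U) (f : forall U U', Q U' -> Q U)
    (p : forall U, K -> Q U),
    [/\ forall U, quotient_map (sval U) (q U),
        forall U U' g, sval U' `<=` sval U -> f U U' (q U' g) = q U g,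
        inverse_limit (fun U U' => sval U' `<=` sval U) f p
      & forall U g, p U (iota g) = q U g].

Definition left_coset (G : groupType) (g : G) (A : set G) : set G :=
  [set g * a | a in A].

(* [G] with its pro-C topology, which has the cosets of the normal subgroups
   [U] with [G / U] in [C] as a subbasis (in fact a basis when [C] is closed
   under subgroups and extensions). *)
Definition pro_C_top (C : finGroupType -> Prop) (G : groupType) : Type := G.
HB.instance Definition _ C G := monoid.Group.on (@pro_C_top C G).
HB.instance Definition _ C G := @isSubBaseTopological.Build (@pro_C_top C G)
  (set G) [set A | exists g U, C_normal C U /\ A = left_coset g U] id.

Definition residually (C : finGroupType -> Prop) (G : groupType) :=
  hausdorff_space (pro_C_top C G).

Definition pro_C_closed (C : finGroupType -> Prop) (G : groupType)
    (A : set G) := @closed (pro_C_top C G) A.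

(** * Graphs *)

(* [inc false] and [inc true] are the maps d_0 and d_1. *)
Record graph (T : Type) := Graph {
  vert : set T;
  inc : bool -> T -> T;
  vert_nonempty : vert !=set0;
  inc_vert : forall i x, vert (inc i x);
  inc_id : forall i v, vert v -> inc i v = v }.

Definition graph_morphism (T T' : Type) (Γ : graph T) (Γ' : graph T')
    (f : T -> T') :=
  forall i x, f (inc Γ i x) = inc Γ' i (f x).

(* Walks with edges in [S]; the letter [(e, b)] traverses [e] from [inc b e] to
   [inc (~~ b) e]. *)
Fixpoint walk (T : Type) (Γ : graph T) (S : set T) (x : T)
    (p : seq (T * bool)) (y : T) : Prop :=
  if p is (e, b) :: p' then
    [/\ S e, ~ vert Γ e, inc Γ b e = x & walk Γ S (inc Γ (~~ b) e) p' y]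
  else x = y.

Definition reduced_walk (T : Type) (p : seq (T * bool)) :=
  forall p1 e b p2, p <> p1 ++ [:: (e, b), (e, ~~ b) & p2].

Definition connected_graph (T : Type) (Γ : graph T) :=
  forall x y, vert Γ x -> vert Γ y -> exists p, walk Γ setT x p y.

Definition subtree (T : Type) (Γ : graph T) (S : set T) :=
  [/\ S !=set0,
      forall i x, S x -> S (inc Γ i x),
      forall x y, S x -> vert Γ x -> S y -> vert Γ y ->
        exists p, walk Γ S x p y
    & forall x p, walk Γ S x p x -> reduced_walk p -> p = [::]].

Definition maximal_subtree (T : Type) (Γ : graph T) (S : set T) :=
  subtree Γ S /\ forall S', subtree Γ S' -> S `<=` S' -> S' = S.

Definition profinite_space (T : topologicalType) :=
  [/\ compact [set: T], hausdorff_space T & totally_disconnected [set: T]].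

Definition profinite_graph (T : topologicalType) (Γ : graph T) :=
  [/\ profinite_space T, closed (vert Γ) & forall i, continuous (inc Γ i)].

(* The condition on preimages is continuity for the discrete topology. *)
Definition profinite_connected (T : topologicalType) (Γ : graph T) :=
  forall (D : finType) (Δ : graph D) (f : T -> D),
    (forall y, open (f @^-1` [set y])) -> graph_morphism Γ Δ f ->
    (forall y, exists x, f x = y) -> connected_graph Δ.

(** * Graphs of groups *)

(* A sheaf of groups with total space [X]: the operations are only meaningful
   within the fibres of [gproj]; [gproj] is surjective because of [gproj_sone]. *)
Record group_sheaf (T X : Type) := GroupSheaf {
  gproj : X -> T;
  smul : X -> X -> X;
  sone : T -> X;
  sinv : X -> X;
  gproj_smul : forall x y, gproj x = gproj y -> gproj (smul x y) = gproj x;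
  gproj_sone : forall m, gproj (sone m) = m;
  gproj_sinv : forall x, gproj (sinv x) = gproj x;
  smulA : forall x y z, gproj x = gproj y -> gproj y = gproj z ->
    smul x (smul y z) = smul (smul x y) z;
  smul1 : forall x, smul (sone (gproj x)) x = x;
  smulV : forall x, smul (sinv x) x = sone (gproj x) }.

Definition fibre (T X : Type) (F : group_sheaf T X) (m : T) : set X :=
  gproj F @^-1` [set m].

Definition fibrewise_hom (T X : Type) (F : group_sheaf T X) (H : groupType)
    (f : X -> H) :=
  forall x y, gproj F x = gproj F y -> f (smul F x y) = f x * f y.

(* [bd false] and [bd true] are the maps ∂_0 and ∂_1. *)
Record graph_of_groups (T X : Type) (Γ : graph T) := GraphOfGroups {
  gog_sheaf :> group_sheaf T X;
  bd : bool -> X -> X;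
  gproj_bd : forall i x, gproj gog_sheaf (bd i x) = inc Γ i (gproj gog_sheaf x);
  bd_vert : forall i x, vert Γ (gproj gog_sheaf x) -> bd i x = x;
  bdM : forall i x y, gproj gog_sheaf x = gproj gog_sheaf y ->
    bd i (smul gog_sheaf x y) = smul gog_sheaf (bd i x) (bd i y);
  bd_inj : forall i x y, gproj gog_sheaf x = gproj gog_sheaf y ->
    bd i x = bd i y -> x = y }.

Definition reduced_gog (T X : Type) (Γ : graph T) (GG : graph_of_groups X Γ) :=
  forall e i, ~ vert Γ e -> inc Γ false e <> inc Γ true e ->
    exists2 y, fibre GG (inc Γ i e) y & ~ (bd GG i @` fibre GG e) y.

(* The bijection [f] is a homeomorphism onto the fibre, as [H] is compact and
   [X] is Hausdorff. *)
Definition pro_C_fibre (C : finGroupType -> Prop) (T : Type)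
    (X : topologicalType) (F : group_sheaf T X) (m : T) :=
  exists (H : topGroupType) (f : H -> X),
    [/\ pro_C C H, continuous f, set_bij setT (fibre F m) f
      & forall x y, f (x * y) = smul F (f x) (f y)].

Record pro_C_graph_of_groups (C : finGroupType -> Prop) (T X : topologicalType)
    (Γ : graph T) (GG : graph_of_groups X Γ) : Prop := {
  pcg_graph : profinite_graph Γ;
  pcg_connected : profinite_connected Γ;
  pcg_space : profinite_space X;
  pcg_proj : continuous (gproj GG);
  pcg_div : {within [set p : X * X | gproj GG p.1 = gproj GG p.2],
    continuous (fun p => smul GG p.1 (sinv GG p.2))};
  pcg_bd : forall i, continuous (bd GG i);
  pcg_fibre : forall m, pro_C_fibre C GG m }.

(** * The abstract fundamental group *)

Section Pi1.
Variables (T X : choiceType) (Γ : graph T) (GG : graph_of_groups X Γ).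
Variable S : set T.

(* [inl x] stands for the element [x] of a group of the graph of groups, and
   [inr (e, b)] for [t_e] or its inverse, according to whether [b] is [false] or
   [true]. *)
Definition pi1_word := seq (X + T * bool).

(* [pi1_edge_group] views the edge groups as subgroups through ∂_0. There is
   also a superfluous stable letter for each vertex, killed by [pi1_tree]. *)
Inductive pi1_rel : pi1_word -> pi1_word -> Prop :=
| pi1_mul x y : gproj GG x = gproj GG y ->
    pi1_rel [:: inl x; inl y] [:: inl (smul GG x y)]
| pi1_one m : pi1_rel [:: inl (sone GG m)] [::]
| pi1_inv e b : pi1_rel [:: inr (e, b); inr (e, ~~ b)] [::]
| pi1_edge_group x : pi1_rel [:: inl x] [:: inl (bd GG false x)]
| pi1_stable x : ~ vert Γ (gproj GG x) ->
    pi1_rel [:: inl (bd GG false x)]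
      [:: inr (gproj GG x, false); inl (bd GG true x); inr (gproj GG x, true)]
| pi1_tree e : vert Γ e \/ S e -> pi1_rel [:: inr (e, false)] [::].

Inductive pi1_eqv : pi1_word -> pi1_word -> Prop :=
| pi1_step a b u v : pi1_rel u v -> pi1_eqv (a ++ u ++ b) (a ++ v ++ b)
| pi1_refl u : pi1_eqv u u
| pi1_sym u v : pi1_eqv u v -> pi1_eqv v u
| pi1_trans v u w : pi1_eqv u v -> pi1_eqv v w -> pi1_eqv u w.

Definition pi1_eqb : rel pi1_word := fun u v => `[< pi1_eqv u v >].

Lemma pi1_eqb_equiv : equiv_class_of pi1_eqb.
Proof.
split=> [u | u v | v u w]; first exact/asboolP/pi1_refl.
  by apply/asboolP/asboolP; exact: pi1_sym.
by move=> /asboolP uv /asboolP vw; apply/asboolP/(pi1_trans uv vw).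
Qed.

Canonical pi1_equiv := EquivRelPack pi1_eqb_equiv.

Definition pi1 : Type := {eq_quot pi1_eqb}.
HB.instance Definition _ := Choice.on pi1.
HB.instance Definition _ := EqQuotient.on pi1.

Lemma pi1_piE u v : \pi_pi1 u = \pi_pi1 v <-> pi1_eqv u v.
Proof. by split=> [/eqquotP/asboolP | uv]; [|apply/eqquotP/asboolP]. Qed.

Lemma pi1_reprP u : pi1_eqv (repr (\pi_pi1 u)) u.
Proof. by apply/pi1_piE; rewrite reprK. Qed.

Lemma pi1_eqv_cat u u' v v' :
  pi1_eqv u u' -> pi1_eqv v v' -> pi1_eqv (u ++ v) (u' ++ v').
Proof.
move=> uu' vv'; apply: (@pi1_trans (u' ++ v)).
  elim: uu' => [a b w w' ww' | w | w w' _ | w w' w'' _ ? _].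
  - by rewrite -!catA; exact: pi1_step.
  - exact: pi1_refl.
  - exact: pi1_sym.
  - exact: pi1_trans.
elim: vv' => [a b w w' ww' | w | w w' _ | w w' w'' _ ? _].
- by rewrite !(catA u'); exact: pi1_step.
- exact: pi1_refl.
- exact: pi1_sym.
- exact: pi1_trans.
Qed.

Definition pi1_inv_letter (l : X + T * bool) : X + T * bool :=
  match l with
  | inl x => inl (sinv GG x)
  | inr (e, b) => inr (e, ~~ b)
  end.

Definition pi1_inv_word (u : pi1_word) : pi1_word := rev (map pi1_inv_letter u).

Definition pi1_mulg (g h : pi1) : pi1 := \pi_pi1 (repr g ++ repr h).
Definition pi1_oneg : pi1 := \pi_pi1 [::].
Definition pi1_invg (g : pi1) : pi1 := \pi_pi1 (pi1_inv_word (repr g)).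

Lemma pi1_eqv1 u v : pi1_rel u v -> pi1_eqv u v.
Proof. by move=> uv; have := pi1_step [::] [::] uv; rewrite /= !cats0. Qed.

Lemma pi1_letterV l : pi1_eqv [:: pi1_inv_letter l; l] [::].
Proof.
case: l => [x | [e b]] /=.
  apply: (@pi1_trans [:: inl (sone GG (gproj GG x))]); apply: pi1_eqv1.
    by rewrite -smulV; apply: pi1_mul; rewrite gproj_sinv.
  exact: pi1_one.
by apply: pi1_eqv1; rewrite -{2}(negbK b); exact: pi1_inv.
Qed.

Lemma pi1_wordV u : pi1_eqv (pi1_inv_word u ++ u) [::].
Proof.
elim: u => [|l u IHu]; first exact: pi1_refl.
rewrite /pi1_inv_word map_cons rev_cons cat_rcons.
apply: pi1_trans IHu; rewrite -/(pi1_inv_word u).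
apply: (pi1_eqv_cat (pi1_refl _)).
rewrite -[u in pi1_eqv _ u]/([::] ++ u) -[_ :: _]/([:: pi1_inv_letter l; l] ++ u).
exact: pi1_eqv_cat (pi1_letterV l) (pi1_refl u).
Qed.

Lemma pi1_mulgA : associative pi1_mulg.
Proof.
move=> g h k; apply/pi1_piE.
apply: pi1_trans (pi1_eqv_cat (pi1_refl _) (pi1_reprP _)) _.
rewrite catA; apply: pi1_eqv_cat (pi1_refl _).
exact/pi1_sym/pi1_reprP.
Qed.

Lemma pi1_mul1g : left_id pi1_oneg pi1_mulg.
Proof.
move=> g; rewrite -[RHS]reprK; apply/pi1_piE.
exact: (pi1_eqv_cat (pi1_reprP [::]) (pi1_refl (repr g))).
Qed.

Lemma pi1_mulg1 : right_id pi1_oneg pi1_mulg.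
Proof.
move=> g; rewrite -[RHS]reprK; apply/pi1_piE; rewrite -[X in pi1_eqv _ X]cats0.
exact: (pi1_eqv_cat (pi1_refl (repr g)) (pi1_reprP [::])).
Qed.

Lemma pi1_mulVg : left_inverse pi1_oneg pi1_invg pi1_mulg.
Proof.
move=> g; apply/pi1_piE.
exact: pi1_trans (pi1_eqv_cat (pi1_reprP _) (pi1_refl _)) (pi1_wordV _).
Qed.

Lemma pi1_mulgV : right_inverse pi1_oneg pi1_invg pi1_mulg.
Proof.
move=> g; set h := pi1_invg g.
rewrite -[LHS]pi1_mul1g -{1}(pi1_mulVg h) -pi1_mulgA (pi1_mulgA h).
by rewrite [pi1_mulg h g]pi1_mulVg pi1_mul1g pi1_mulVg.
Qed.

HB.instance Definition _ := isGroup.Build pi1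
  pi1_mulgA pi1_mul1g pi1_mulg1 pi1_mulVg pi1_mulgV.

Definition pi1_elt (x : X) : pi1 := \pi_pi1 [:: inl x].
Definition pi1_t (e : T) : pi1 := \pi_pi1 [:: inr (e, false)].

End Pi1.

(** * Coset graphs *)

Section CosetSpace.
Variables (T : Type) (P : groupType) (N : T -> set P).

(* The disjoint union of the P / N(m), for m in T. *)
Record coset_space := CosetSpace {
  coset_base : T;
  coset_set : set P;
  coset_setP : exists g, coset_set = left_coset g (N coset_base) }.

Definition coset_pi (p : T * P) : coset_space :=
  CosetSpace (ex_intro _ p.2 (erefl (left_coset p.2 (N p.1)))).

Definition coset_repr (s : coset_space) : T * P :=
  (coset_base s, sval (cid (coset_setP s))).

Lemma coset_space_reprK : cancel coset_repr coset_pi.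
Proof.
case=> m A AP; rewrite /coset_repr /coset_pi /=.
case: cid => g /= Ag; move: AP; rewrite Ag => AP.
by congr CosetSpace; exact: Prop_irrelevance.
Qed.

(* Provides the quotient topology [quotient_topology coset_space]. *)
HB.instance Definition _ := isQuotient.Build (T * P)%type coset_space
  coset_space_reprK.

Lemma coset_act_subproof (g : P) (s : coset_space) :
  exists h, left_coset g (coset_set s) = left_coset h (N (coset_base s)).
Proof.
case: s => m A AP /=; have [h ->] := AP; exists (g * h).
rewrite /left_coset image_comp; apply: eq_imagel => a _ /=.
by rewrite mulgA.
Qed.

Definition coset_act (g : P) (s : coset_space) : coset_space :=
  CosetSpace (coset_act_subproof g s).

(* The edges g N(m) go from g N(d_0(m)) to g t(m) N(d_1(m)). The value of [inc]
   is computed from a representative; see [coset_graph_incE]. *)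
Variables (Γ : graph T) (t : T -> P).

Definition coset_inc (i : bool) (s : coset_space) : coset_space :=
  if `[< vert Γ (coset_base s) >] then s
  else coset_pi (inc Γ i (coset_base s),
    (coset_repr s).2 * (if i then t (coset_base s) else 1)).

Definition coset_vert : set coset_space := [set s | vert Γ (coset_base s)].

Lemma coset_vert_nonempty : coset_vert !=set0.
Proof. by have [v Γv] := vert_nonempty Γ; exists (coset_pi (v, 1)). Qed.

Lemma coset_inc_vert i s : coset_vert (coset_inc i s).
Proof.
rewrite /coset_vert /coset_inc /=; case: asboolP => //= _.
exact: inc_vert.
Qed.

Lemma coset_inc_id i s : coset_vert s -> coset_inc i s = s.
Proof. by move=> sV; rewrite /coset_inc asboolT. Qed.

Definition coset_graph : graph coset_space :=
  Graph coset_vert_nonempty coset_inc_vert coset_inc_id.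

Lemma coset_graph_incE (i : bool) m g :
    (forall n, [/\ N n 1, forall x y, N n x -> N n y -> N n (x * y)
      & forall x, N n x -> N n x^-1]) ->
    ~ vert Γ m ->
    (forall x, N m x -> N (inc Γ i m)
      (if i then (t m)^-1 * x * t m else x)) ->
  inc coset_graph i (coset_pi (m, g)) =
  coset_pi (inc Γ i m, g * (if i then t m else 1)).
Proof.
move=> Nsub mE Nm; rewrite /= /coset_inc /= asboolF //.
case: cid => h /= gh.
have [x Nx hx] : left_coset g (N m) h.
  by rewrite gh; exists 1; [case: (Nsub m) | rewrite mulg1].
set u := if i then t m else 1.
have Ny : N (inc Γ i m) (u^-1 * x * u).
  by move: (Nm _ Nx); rewrite /u; case: (i); rewrite // invg1 mul1g mulg1.
have [_ NM NV] := Nsub (inc Γ i m).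
have hu : h * u = g * u * (u^-1 * x * u) by rewrite -hx -!mulgA mulKVg.
move: (u^-1 * x * u) Ny hu => y Ny hu.
have E : left_coset (h * u) (N (inc Γ i m)) = left_coset (g * u) (N (inc Γ i m)).
  apply/seteqP; split=> _ [z zN <-].
    by exists (y * z); [exact: NM | rewrite mulgA -hu].
  exists (y^-1 * z); first by apply: NM => //; exact: NV.
  by rewrite hu -mulgA mulKVg.
rewrite /coset_pi /=.
move: (ex_intro _ _ _) (ex_intro _ _ _); rewrite E => a b.
by congr CosetSpace; exact: Prop_irrelevance.
Qed.

End CosetSpace.

(** * The pro-C fundamental group *)

(* As [L] is compact and [T] is Hausdorff, [zeta] is a quotient map of
   topological spaces. *)
Record galois_covering (C : finGroupType -> Prop) (T L : topologicalType)
    (Γ : graph T) (Λ : graph L) (A : topGroupType) (act : A -> L -> L)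
    (zeta : L -> T) : Prop := {
  gc_group : pro_C C A;
  gc_graph : profinite_graph Λ;
  gc_act1 : forall x, act 1 x = x;
  gc_actM : forall a b x, act (a * b) x = act a (act b x);
  gc_act_continuous : continuous (fun p : A * L => act p.1 p.2);
  gc_act_inc : forall i a x, inc Λ i (act a x) = act a (inc Λ i x);
  gc_free : forall a x, act a x = x -> a = 1;
  gc_continuous : continuous zeta;
  gc_morphism : graph_morphism Λ Γ zeta;
  gc_surjective : forall m, exists x, zeta x = m;
  gc_orbits : forall x y, zeta x = zeta y <-> exists a, act a x = y }.

Record universal_covering (C : finGroupType -> Prop) (T : topologicalType)
    (Γ : graph T) := UniversalCovering {
  uc_space : topologicalType;
  uc_graph : graph uc_space;
  uc_group : topGroupType;
  uc_act : uc_group -> uc_space -> uc_space;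
  uc_map : uc_space -> T;
  uc_galois : galois_covering C Γ uc_graph uc_act uc_map;
  uc_connected : profinite_connected uc_graph;
  uc_simply_connected : forall (L : topologicalType) (Λ : graph L)
    (B : topGroupType) (act : B -> L -> L) (zeta : L -> uc_space),
    galois_covering C uc_graph Λ act zeta -> profinite_connected Λ ->
    forall b : B, b = 1 }.

(* [zs_chi] is determined by [zs_j], as the action is free. *)
Record zero_section (C : finGroupType -> Prop) (T : topologicalType)
    (Γ : graph T) (U : universal_covering C Γ) := ZeroSection {
  zs_j : T -> uc_space U;
  zs_chi : T -> uc_group U;
  zs_continuous : continuous zs_j;
  zs_section : forall m, uc_map (zs_j m) = m;
  zs_inc0 : forall m, zs_j (inc Γ false m) = inc (uc_graph U) false (zs_j m);
  zs_chiP : forall m,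
    uc_act (zs_chi m) (zs_j (inc Γ true m)) = inc (uc_graph U) true (zs_j m) }.

Definition specialisation (C : finGroupType -> Prop) (T X : topologicalType)
    (Γ : graph T) (GG : graph_of_groups X Γ) (U : universal_covering C Γ)
    (J : zero_section U) (H : topGroupType) (beta : X -> H)
    (beta' : uc_group U -> H) :=
  [/\ continuous beta, fibrewise_hom GG beta,
      continuous beta', {morph beta' : a b / a * b}
    & forall x, let c := beta' (zs_chi J (gproj GG x)) in
        beta x = beta (bd GG false x) /\
        beta x = c * beta (bd GG true x) * c^-1].

Record fundamental_group (C : finGroupType -> Prop) (T X : topologicalType)
    (Γ : graph T) (GG : graph_of_groups X Γ) (U : universal_covering C Γ)
    (J : zero_section U) := FundamentalGroup {
  fg_group :> topGroupType;
  fg_nu : X -> fg_group;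
  fg_nu' : uc_group U -> fg_group;
  fg_pro_C : pro_C C fg_group;
  fg_specialisation : specialisation GG J fg_nu fg_nu';
  fg_universal : forall (H : topGroupType) (beta : X -> H)
    (beta' : uc_group U -> H),
    pro_C C H -> specialisation GG J beta beta' ->
    exists! delta : fg_group -> H,
      [/\ continuous delta, {morph delta : x y / x * y},
          beta = delta \o fg_nu & beta' = delta \o fg_nu'] }.

(** * Standard trees *)

Definition abs_tree_space (T X : choiceType) (Γ : graph T)
    (GG : graph_of_groups X Γ) (S : set T) : Type :=
  coset_space (fun m => pi1_elt GG S @` fibre GG m).

Definition abs_tree (T X : choiceType) (Γ : graph T)
    (GG : graph_of_groups X Γ) (S : set T) : graph (abs_tree_space GG S) :=
  coset_graph _ Γ (pi1_t GG S).

Section ProCTree.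
Variables (C : finGroupType -> Prop) (T X : topologicalType).
Variables (Γ : graph T) (GG : graph_of_groups X Γ) (U : universal_covering C Γ).
Variables (J : zero_section U) (Pi : fundamental_group GG J).

Definition pro_C_tree_space : topologicalType :=
  quotient_topology (coset_space (fun m => fg_nu Pi @` fibre GG m)).

Definition pro_C_tree : graph pro_C_tree_space :=
  coset_graph _ Γ (fun m => fg_nu' Pi (zs_chi J m)).

End ProCTree.

(* Main.v *)
(* Take for the base graph the Stone-Cech compactification [ultra T] of the discrete
   set [T], with the structure maps extended by continuity. The group
   over an ultrafilter is the limit along it, in [K], of the closures of the groups
   over the points of [T]; edge groups are embedded by d_0, and d_1 is conjugation
   by the continuous extension [tb] of e |-> t_e.
   The closed subgroup F of [K] generated by the stable letters is the free pro-C
   group on the edges outside of the maximal subtree, and [ultra T * F] with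
   voltage [tb] is the universal covering of the base: it is connected, and
   voltages on it with values in Q factor through a finite quotient R of F and are
   killed in the wreath product of Q by R, by freeness. With this covering [K]
   itself is the fundamental group. For an arbitrary covering and 0-section, the
   voltage [tb] splits over the covering, since a disconnected voltage covering
   reduces the structure group and a connected one is trivial; this changes
   specialisations for one covering into specialisations for the other, by
   conjugation with a continuous function on [ultra T]. *)

From HB Require Import structures.
Require Import Defs.
From mathcomp Require Import all_boot all_fingroup.
From mathcomp Require Import all_classical.
From mathcomp Require Import topology finmap.

Set Implicit Arguments.
Unset Strict Implicit.
Unset Printing Implicit Defensive.

Local Open Scope classical_set_scope.
Local Open Scope group_scope.

(** * Locally constant maps and profinite spaces *)

(** A voltage is a function t on a graph with values in a group, considered up to t(m) |-> g(d_0 m)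
    t(m) g(d_1 m)^-1. On a connected graph a voltage is a coboundary in at most one way up to a
    constant; this rigidity makes solutions in finite quotients compatible and turns deck
    translations into homomorphisms. The wreath product is a non-abelian Shapiro lemma: a Q-valued
    voltage on the covering with group R amounts to a voltage on the base with values in the wreath
    product that lifts the R-valued one. The obstacle in (c) is that a given 0-section need not be
    adapted to the maximal subtree: the elements ν'χ(e) need not vanish on it, so the vertex groups
    of Π match those of G only after conjugation by some c(m). A potential of these elements along
    the tree provides c. Any map from [T] to a profinite space extends continuously to [ultra T],
    hence so does c, and identities between continuous maps can be checked on [T]. Finite quotients
    are bare [finGroupType]s, hence [loc_const] in place of continuity. *)

Definition loc_const (Y : topologicalType) (D : Type) (f : Y -> D) :=
  forall x, nbhs x [set y | f y = f x].

Section LocConst.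
Context {Y : topologicalType}.

Lemma loc_const_open (D : Type) (f : Y -> D) (A : set D) :
  loc_const f -> open (f @^-1` A).
Proof. by rewrite openE => lf x Ax; apply: filterS (lf x) => y /= ->. Qed.

Lemma loc_const_clopen (D : Type) (f : Y -> D) (A : set D) :
  loc_const f -> clopen (f @^-1` A).
Proof.
move=> lf; split; first exact: loc_const_open.
by rewrite -openC preimage_setC; exact: loc_const_open.
Qed.

Lemma open_loc_const (D : Type) (f : Y -> D) :
  (forall d, open (f @^-1` [set d])) -> loc_const f.
Proof. by move=> of_ x; apply: open_nbhs_nbhs; split => //; exact: of_. Qed.

Lemma loc_const_comp (Z : topologicalType) (D : Type) (g : Y -> Z) (f : Z -> D) :
  continuous g -> loc_const f -> loc_const (f \o g).
Proof. by move=> cg lf x; exact: cg (lf (g x)). Qed.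

Lemma loc_const_post (D E : Type) (f : Y -> D) (h : D -> E) :
  loc_const f -> loc_const (h \o f).
Proof. by move=> lf x; apply: filterS (lf x) => y /= ->. Qed.

Lemma loc_const_cst (D : Type) (d : D) : loc_const (fun _ : Y => d).
Proof. by move=> x; apply: filterS (filterT). Qed.

Lemma loc_const2 (D E F : Type) (h : D -> E -> F) (f : Y -> D) (g : Y -> E) :
  loc_const f -> loc_const g -> loc_const (fun x => h (f x) (g x)).
Proof.
by move=> lf lg x; apply: filterS2 (lf x) (lg x) => y /= -> ->.
Qed.

Lemma dense_loc_const (D : Type) (f g : Y -> D) (A : set Y) :
  dense A -> loc_const f -> loc_const g -> (forall x, A x -> f x = g x) -> f = g.
Proof.
move=> dA lf lg fg; apply/funext => x; apply: contrapT => fgx.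
have oU : open [set y | f y <> g y].
  have := loc_const_open [set b | b <> true]
    (loc_const2 (fun a b => `[< a = b >]) lf lg).
  congr open; apply/seteqP; split => y /=.
    by move=> h /asboolP.
  by move=> h /asboolP.
have [y [/= fgy Ay]] := dA _ (ex_intro _ x fgx) oU.
exact/fgy/fg.
Qed.

Lemma dense_nbhs (A B : set Y) (x : Y) : dense A -> nbhs x B -> exists y, A y /\ B y.
Proof.
rewrite nbhsE => dA [C [oC Cx] CB].
by have [y [/CB By Ay]] := dA _ (ex_intro _ x Cx) oC; exists y.
Qed.

Lemma dense_hausdorff (Z : topologicalType) (f g : Y -> Z) (A : set Y) :
  hausdorff_space Z -> dense A -> continuous f -> continuous g ->
  (forall x, A x -> f x = g x) -> f = g.
Proof.
move=> hZ dA cf cg fg; apply/funext => x; apply: hZ => B C Bf Cg.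
have Bx : nbhs x (f @^-1` B) by exact: cf.
have Cx : nbhs x (g @^-1` C) by exact: cg.
have [y [Ay [By Cy]]] := dense_nbhs dA (filterI Bx Cx).
by exists (f y); split => //; rewrite fg.
Qed.

Lemma dense_image (Z : topologicalType) (f : Y -> Z) (A : set Y) :
  continuous f -> (forall z, exists y, f y = z) -> dense A -> dense (f @` A).
Proof.
move=> cf sf dA O [z Oz] oO; have [x xz] := sf z.
have : nbhs x (f @^-1` O) by apply: cf; rewrite xz; exact: open_nbhs_nbhs.
by move=> /(dense_nbhs dA)[y [Ay Oy]]; exists (f y); split => //; exists y.
Qed.

End LocConst.

Lemma continuous_pair (Y Z W : topologicalType) (f : Y -> Z) (g : Y -> W) :
  continuous f -> continuous g -> continuous (fun y => (f y, g y)).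
Proof. by move=> cf cg y; exact: cvg_pair (cf y) (cg y). Qed.

Lemma continuous_pairl (Y Z : topologicalType) (z : Z) :
  continuous (fun y : Y => (z, y)).
Proof. by apply: continuous_pair => y; [exact: cvg_cst | exact: cvg_id]. Qed.

Lemma continuous_pairr (Y Z : topologicalType) (z : Z) :
  continuous (fun y : Y => (y, z)).
Proof. by apply: continuous_pair => y; [exact: cvg_id | exact: cvg_cst]. Qed.

Lemma continuous_closed_image (Y Z : topologicalType) (f : Y -> Z) (A : set Y) :
  compact [set: Y] -> hausdorff_space Z -> continuous f -> closed A ->
  closed (f @` A).
Proof.
move=> cY hZ cf cA; apply: compact_closed => //.
apply: continuous_compact; first exact: continuous_subspaceT.
exact: subclosed_compact cA cY _.
Qed.

(** A continuous surjection from a compact space onto a Hausdorff one is closed, so the fibres of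
    [w] are complements of closed images. It serves to push functions down along covering maps. *)
Lemma loc_const_descent (Y Z : topologicalType) (D : Type)
    (th : Y -> Z) (w : Z -> D) :
  compact [set: Y] -> hausdorff_space Z -> continuous th ->
  (forall z, exists y, th y = z) -> loc_const (w \o th) -> loc_const w.
Proof.
move=> cY hZ cth sth lw; apply: open_loc_const => d.
have -> : w @^-1` [set d] = ~` (th @` ((w \o th) @^-1` (~` [set d]))).
  apply/seteqP; split=> [z /= wz [y /= + yz]|z /= nz].
    by rewrite yz wz.
  apply: contrapT => wz; apply: nz; have [y yz] := sth z.
  by exists y => //=; rewrite yz.
rewrite openC; apply: continuous_closed_image => //.
by have [] := loc_const_clopen (~` [set d]) lw.
Qed.

Lemma clopen_loc_const (Y : topologicalType) (A : set Y) :
  clopen A -> loc_const (fun x => `[< A x >]).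
Proof.
move=> [oA cA]; apply: open_loc_const => -[].
  by congr open: oA; apply/seteqP; split=> x /=; [move=> ?; apply/asboolP | move/asboolP].
rewrite -openC in cA.
congr open: cA; apply/seteqP; split=> x /=; first by move=> ?; apply/asboolP.
by move=> h Ax; move/asboolP: h.
Qed.

Lemma zero_dimensional_profinite (Y : topologicalType) :
  compact [set: Y] -> hausdorff_space Y -> zero_dimensional Y ->
  profinite_space Y.
Proof. by move=> cY hY zY; split => //; exact: zero_dimension_totally_disconnected. Qed.

(* The quasi-component [Q] of [x] is connected: if a clopen subset [A] of [Q]
   contained [x] but not all of [Q], normality would separate [A] from its
   complement in [Q], and compactness would yield a clopen set doing so. *)
Lemma profinite_zero_dimensional (Y : topologicalType) :
  profinite_space Y -> zero_dimensional Y.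
Proof.
move=> [cY hY tdY] x y xy; apply: contrapT => nsep.
pose Q := [set z | forall U, clopen U -> U x -> U z].
have Qx : Q x by move=> U.
have Qy : Q y.
  by move=> U cU Ux; apply: contrapT => Uy; apply: nsep; exists U.
have cQ : closed Q.
  have -> : Q = \bigcap_(U in [set U | clopen U /\ U x]) U.
    by apply/seteqP; split=> z h U; [case; exact: h | move=> ? ?; exact: h].
  by apply: closed_bigI => U [[]].
(* Compactness of the complement of [V]: otherwise the traces on it of the clopen sets around [x]
   would cluster at a point lying in all of them, hence in [Q]. *)
have sepQ (V : set Y) : open V -> Q `<=` V ->
    exists2 U, clopen U /\ U x & U `<=` V.
  move=> oV QV; apply: contrapT => nU.
  have cV : compact (~` V) by apply: subclosed_compact cY _ => //; exact: open_closedC.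
  pose F := filter_from [set U | clopen U /\ U x] (fun U => U `\` V).
  have FF : ProperFilter F.
    apply: filter_from_proper.
      apply: filter_from_filter; first by exists setT; split => //; exact: clopenT.
      move=> U W [cU Ux] [cW Wx]; exists (U `&` W).
        by split; [exact: clopenI|].
      by move=> z [[]].
    move=> U [cU Ux]; apply: contrapT => h; apply: nU; exists U => // z Uz.
    by apply: contrapT => nVz; apply: h; exists z.
  have [z [nVz cz]] : ~` V `&` cluster F !=set0.
    by apply: cV; exists setT => [|z []//]; split => //; exact: clopenT.
  apply: nVz; apply: QV => U cU Ux; apply: contrapT => nUz.
  have [_ clU] := cU; have nb : nbhs z (~` U).
    by apply: open_nbhs_nbhs; split => //; exact: closed_openC.
  have FU : F (U `\` V) by exists U.
  by have [w [[]]] := cz _ _ FU nb.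
have conQ : connected Q.
  apply/connectedP => E [E0 QE [sep1 sep2]].
  have clE b : closed (E b).
    move=> z cz; have /cQ : closure Q z.
      by apply: closureS cz => w Ew; rewrite QE; case: b Ew; [right|left].
    rewrite QE => -[] Ez; case: b cz => // cz.
      by have : (E false `&` closure (E true)) z by []; rewrite sep2.
    by have : (closure (E false) `&` E true) z by []; rewrite sep1.
  have [b Ebx] : exists b, E b x.
    by move: Qx; rewrite QE => -[]; [exists false|exists true].
  have dE : E b `&` E (~~ b) = set0.
    apply/disjoints_subset => z Ez Ez'; case: b Ebx Ez Ez' => /= _ Ez Ez'.
      have : (closure (E false) `&` E true) z by split=> //; exact: subset_closure.
      by rewrite sep1.
    have : (closure (E false) `&` E true) z by split=> //; exact: subset_closure.
    by rewrite sep1.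
  have nY := compact_normal hY cY.
  have [V + clV] : exists2 V, set_nbhs (E b) V & closure V `<=` ~` E (~~ b).
    have : set_nbhs (E b) (~` E (~~ b)).
      apply/set_nbhsP; exists (~` E (~~ b)); split=> //.
        exact/closed_openC/clE.
      exact/disjoints_subset.
    by move=> /(nY _ (clE b))[V sV cV]; exists V.
  move=> /set_nbhsP [V' [oV' EV' V'V]].
  (* Inside a clopen [U] contained in this union, [V'] and the closure of [V] have the same trace,
     which is therefore clopen; it contains [x] and misses the other half of [Q]. *)
  have oW : open (V' `|` ~` closure V).
    by apply: openU => //; apply: closed_openC; exact: closed_closure.
  have [|U [cU Ux] UW] := sepQ _ oW.
    move=> z; rewrite QE => Ez; have [Ebz|Ebz] : E b z \/ E (~~ b) z.
    - by case: Ez; case: (b); [right|left|left|right].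
    - by left; exact: EV'.
    - by right => /clV.
  have cUV : clopen (U `&` V').
    split; first by apply: openI => //; case: cU.
    have -> : U `&` V' = U `&` closure V.
      apply/seteqP; split=> z [Uz Vz]; split=> //.
        exact/subset_closure/V'V.
      by case: (UW _ Uz).
    by apply: closedI; [case: cU | exact: closed_closure].
  have [z Ez] := E0 (~~ b).
  have Qz : Q z by rewrite QE; case: b Ez {Ebx dE clV EV'}; [left|right].
  have [_ V'z] := Qz _ cUV (conj Ux (EV' _ Ebx)).
  by apply: clV Ez; exact/subset_closure/V'V.
have := connected_component_max Qx (@subsetT _ Q) conQ Qy.
by rewrite tdY // => /= yx; move: xy; rewrite yx eqxx.
Qed.

Lemma profinite_clopen_nbhs (Y : topologicalType) (x : Y) (A : set Y) :
  profinite_space Y -> nbhs x A -> exists U, [/\ clopen U, U x & U `<=` A].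
Proof.
move=> pY; have [cY hY _] := pY.
have := zero_dimensional_cvg (x := x) hY (profinite_zero_dimensional pY) cY.
by move=> h /h [U [Ux cU] UA]; exists U.
Qed.

Lemma hausdorff_prod (Y Z : topologicalType) :
  hausdorff_space Y -> hausdorff_space Z -> hausdorff_space (Y * Z)%type.
Proof.
move=> hY hZ [y z] [y' z'] h; congr pair.
  apply: hY => A B Ay By.
  have [||[a b] []] := h (A `*` setT) (B `*` setT).
  - by exists (A, setT) => //; split => //; exact: filterT.
  - by exists (B, setT) => //; split => //; exact: filterT.
  by case=> Aa _ [Ba _]; exists a.
apply: hZ => A B Ay By.
have [||[a b] []] := h (setT `*` A) (setT `*` B).
- by exists (setT, A) => //; split => //; exact: filterT.
- by exists (setT, B) => //; split => //; exact: filterT.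
by case=> _ Ab [_ Bb]; exists b.
Qed.

Lemma profinite_prod (Y Z : topologicalType) :
  profinite_space Y -> profinite_space Z -> profinite_space (Y * Z)%type.
Proof.
move=> pY pZ; have [cY hY _] := pY; have [cZ hZ _] := pZ.
apply: zero_dimensional_profinite.
- by rewrite -setXTT; exact: compact_setX.
- exact: hausdorff_prod.
move=> [y z] [y' z'] /eqP ne.
have [yy'|yy'] := eqVneq y y'; last first.
  have [U [cU Uy Uy']] := profinite_zero_dimensional pY yy'.
  exists (fst @^-1` U); split => //; apply: preimage_clopen => //.
  by move=> p; exact: cvg_fst.
have zz' : z != z' by apply/eqP => zz'; apply: ne; rewrite yy' zz'.
have [U [cU Uy Uy']] := profinite_zero_dimensional pZ zz'.
exists (snd @^-1` U); split => //; apply: preimage_clopen => //.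
by move=> p; exact: cvg_snd.
Qed.

Section SetType.
Context {Y : topologicalType} (A : set Y).

Lemma set_type_nbhs (x : A) (B : set A) :
  nbhs x B <-> exists2 C, nbhs (val x) C & forall y : A, C (val y) -> B y.
Proof.
split=> [[_ [[C oC <-] Cx CB]]|[C]].
  by exists C => //; exact: open_nbhs_nbhs.
rewrite nbhsE => -[C' [oC' C'x] C'C] CB; exists (set_val @^-1` C').
by split; [exists C' | | move=> y /C'C /CB].
Qed.

Lemma set_val_continuous : continuous (@set_val Y A).
Proof. by move=> x B Bx; apply/set_type_nbhs; exists B. Qed.

Lemma set_type_continuous (Z : topologicalType) (f : Z -> A) :
  continuous (fun z => val (f z)) -> continuous f.
Proof.
move=> cf z B /set_type_nbhs [C Cz CB].
have : nbhs z ((fun z => val (f z)) @^-1` C) by exact: cf.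
by apply: filterS => w /= /CB.
Qed.

Lemma set_type_profinite : profinite_space Y -> closed A -> profinite_space A.
Proof.
move=> pY cA; have [cY hY _] := pY; apply: zero_dimensional_profinite.
- rewrite compact_ultra => F FU _.
  have FFU : ProperFilter (fmap (@set_val Y A) F) by exact: fmap_proper_filter.
  have [z [_ cz]] := cY _ FFU filterT.
  have Az : A z.
    apply: cA => B Bz.
    have FA : F (@set_val Y A @^-1` A).
      by apply: (filterS _ (filterT : F setT)) => w _; exact: set_valP.
    by have [w ?] := cz _ _ FA Bz; exists w.
  exists (exist _ z (mem_set Az)); split=> //.
  rewrite -ultra_cvg_clusterE.
  move=> B C FB /set_type_nbhs [D Dz DC].
  have FB' : F (@set_val Y A @^-1` (set_val @` B)).
    by apply: (filterS _ FB) => w Bw; exists w.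
  have [_ [[w Bw <-] Dw]] := cz _ _ FB' Dz.
  by exists w; split=> //; exact: DC.
- move=> x y h; apply: val_inj; apply: hY => B C Bx Cy.
  have [w [Bw Cw]] := h _ _ (set_val_continuous Bx) (set_val_continuous Cy).
  by exists (val w).
move=> x y xy.
have [|U [cU Ux Uy]] := profinite_zero_dimensional pY (x := val x) (y := val y).
  by apply: contra_neq xy => /val_inj.
exists (set_val @^-1` U); split=> //; apply: preimage_clopen => //.
exact: set_val_continuous.
Qed.

End SetType.

(** * Graphs *)

Lemma inc_inc (T : Type) (Γ : graph T) i j x : inc Γ i (inc Γ j x) = inc Γ j x.
Proof. by rewrite inc_id //; exact: inc_vert. Qed.

Section Connected.
Variables (Y : topologicalType) (Λ : graph Y).

(** A non-constant [f] would give a morphism onto the graph with two vertices and no edges, which is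
    not connected. *)
Lemma profinite_connected_const (D : Type) (f : Y -> D) :
  profinite_connected Λ -> loc_const f -> (forall i x, f (inc Λ i x) = f x) ->
  forall x y, f x = f y.
Proof.
move=> cΛ lf fi x y; apply: contrapT => fxy.
have V0 : [set: bool] !=set0 by exists true.
pose Δ := @Graph bool setT (fun _ => id) V0 (fun _ _ => I) (fun _ _ _ => erefl).
pose g z := `[< f z = f x >].
have gx : g x by apply/asboolP.
have gy : g y = false by apply/asboolP => ?; apply: fxy.
have [||| p] := cΛ bool Δ g _ _ _ true false I I.
- move=> b; apply: (loc_const_open [set b]).
  exact: (loc_const_post (fun d => `[< d = f x >]) lf).
- by move=> i z; rewrite /g fi.
- by case; [exists x | exists y].
by case: p => //= -[b ?] p [_ []].
Qed.

(** Two-valued functions suffice as tests: the component of a vertex in a finite quotient pulls back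
    to one, an edge being tested at its initial vertex. *)
Lemma profinite_connectedP :
  (forall f : Y -> bool, loc_const f -> (forall i x, f (inc Λ i x) = f x) ->
    forall x y, f x = f y) ->
  profinite_connected Λ.
Proof.
move=> cst D Δ f of_ fm fs x y Vx Vy.
pose conn z := exists p, walk Δ setT x p z.
have walk_rcons p z e b : ~ vert Δ e -> inc Δ b e = z -> walk Δ setT x p z ->
    walk Δ setT x (rcons p (e, b)) (inc Δ (~~ b) e).
  move=> Ve ez; elim: p (x) => [|[e' b'] p IHp] w /=; first by move=> ->.
  by case=> ? ? ? /IHp.
have connE e b b' : conn (inc Δ b e) -> conn (inc Δ b' e).
  have [Ve|Ve] := pselect (vert Δ e); first by rewrite !inc_id.
  have [<-//|bb'] := eqVneq b b'; move=> [p xp]; exists (rcons p (e, b)).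
  have -> : b' = ~~ b by case: b b' bb' {xp} => -[].
  exact: walk_rcons xp.
pose g z := `[< conn (inc Δ false (f z)) >].
have lg : loc_const g.
  exact: (loc_const_post (fun d => `[< conn (inc Δ false d) >])
            (open_loc_const of_)).
have gi i z : g (inc Λ i z) = g z.
  rewrite /g fm inc_inc; apply/asboolP/asboolP; exact: connE.
have [[x' fx] [y' fy]] := (fs x, fs y).
have : g y'.
  rewrite -(cst g lg gi x') /g fx inc_id //; apply/asboolP.
  by exists [::].
by rewrite /g fy inc_id // => /asboolP.
Qed.

End Connected.

(** * Walks, potentials and spanning trees *)

Section Trees.
Variables (T : Type) (Γ : graph T).

Lemma walk_cat (S : set T) x p q z :
  walk Γ S x (p ++ q) z <-> exists2 y, walk Γ S x p y & walk Γ S y q z.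
Proof.
elim: p x => [|[e b] p IHp] x /=.
  by split=> [?|[y -> //]]; exists x.
split=> [[? ? ? /IHp[y xp yq]]|[y [? ? ? xp] yq]]; first by exists y.
by split=> //; apply/IHp; exists y.
Qed.

Lemma walk_sub (S S' : set T) x p y :
  S `<=` S' -> walk Γ S x p y -> walk Γ S' x p y.
Proof.
by move=> SS'; elim: p x => [|[e b] p IHp] x //= [? ? ? /IHp]; split=> //; exact: SS'.
Qed.

Definition walk_rev (p : seq (T * bool)) := rev [seq (l.1, ~~ l.2) | l <- p].

Lemma walk_revP (S : set T) x p y : walk Γ S x p y -> walk Γ S y (walk_rev p) x.
Proof.
elim: p x => [|[e b] p IHp] x /=; first by move=> ->.
move=> [Se Ve <- /IHp py]; rewrite /walk_rev /= rev_cons -cats1.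
apply/walk_cat; exists (inc Γ (~~ b) e) => //=.
by split=> //; rewrite negbK.
Qed.

Lemma reduced_walk_sub (p q r : seq (T * bool)) :
  reduced_walk (p ++ q ++ r) -> reduced_walk q.
Proof.
move=> red p1 e b p2 qE; apply: (red (p ++ p1) e b (p2 ++ r)).
by rewrite qE -!catA.
Qed.

Section WalkProduct.
Variables (H : groupType) (f : T -> H).

Definition walk_prod (p : seq (T * bool)) : H :=
  foldr (fun l h => (if l.2 then (f l.1)^-1 else f l.1) * h) 1 p.

Lemma walk_prod_cat p q : walk_prod (p ++ q) = walk_prod p * walk_prod q.
Proof. by elim: p => [|l p /= ->]; rewrite ?mul1g ?mulgA. Qed.

Lemma walk_prod_rev p : walk_prod (walk_rev p) = (walk_prod p)^-1.
Proof.
elim: p => [|[e b] p IHp]; rewrite /= ?invg1 //.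
rewrite /walk_rev /= rev_cons -cats1 walk_prod_cat IHp /= mulg1 invgM.
by case: b; rewrite //= invgK.
Qed.

(** A non-empty closed walk in a tree backtracks, and deleting the backtracking changes neither the
    endpoints nor the product. *)
Lemma walk_prod_closed (S : set T) x p :
  subtree Γ S -> walk Γ S x p x -> walk_prod p = 1.
Proof.
move=> [_ _ _ acyc]; have [n] := ubnP (size p); elim: n p => // n IHn p pn xp.
have [red|] := pselect (reduced_walk p); first by rewrite (acyc _ _ xp red).
move=> /existsNP[p1 /existsNP[e /existsNP[b /existsNP[p2 /contrapT pE]]]].
rewrite {p}pE in pn xp *.
have pE : walk_prod (p1 ++ [:: (e, b), (e, ~~ b) & p2]) = walk_prod (p1 ++ p2).
  by rewrite !walk_prod_cat /=; case: b {pn xp}; rewrite /= ?mulKg ?mulKVg.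
rewrite pE; apply: IHn.
  by move: pn; rewrite !size_cat /= !addnS ltnS => /ltnW.
case/walk_cat: xp => y xp1 /= [Se Ve ey [_ _ _]]; rewrite negbK ey => yp2.
by apply/walk_cat; exists y.
Qed.

(** On a tree every voltage is a coboundary: [g] is the product along a walk to a base vertex, and
    by [walk_prod_closed] any walk will do. *)
Lemma subtree_potential (S : set T) : subtree Γ S ->
  exists g : T -> H, (forall m, g (inc Γ false m) = g m) /\
  (forall e, S e -> ~ vert Γ e -> g (inc Γ false e) = f e * g (inc Γ true e)).
Proof.
move=> treeS; have [[s0 Ss0] Sinc Sconn _] := treeS.
pose v0 := inc Γ false s0; have Sv0 : S v0 by exact: Sinc.
(* Walks start at the initial vertex of [m], which makes [g] constant along d_0; where there is no
   walk in [S], [g] takes the default value 1. *)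
pose P m : set H := fun h => exists2 p, walk Γ S (inc Γ false m) p v0 & walk_prod p = h.
pose g m := xget 1 (P m).
have gP m p : walk Γ S (inc Γ false m) p v0 -> walk_prod p = g m.
  move=> mp; have Pm : exists h, P m h by exists (walk_prod p), p.
  have [q mq] := xgetPex 1 Pm; rewrite -/(g m) => <-; apply: (mulIg (walk_prod q)^-1).
  rewrite mulgV -walk_prod_rev -walk_prod_cat.
  apply: (walk_prod_closed treeS (x := inc Γ false m)).
  by apply/walk_cat; exists v0 => //; exact: walk_revP.
exists g; split=> [m|e Se Ve]; first by rewrite /g /P inc_inc.
have [p ep] : exists p, walk Γ S (inc Γ true e) p v0.
  by apply: Sconn; [exact: Sinc | exact: inc_vert | | exact: inc_vert].
rewrite -(gP (inc Γ true e) p) ?inc_inc //.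
by rewrite -(gP (inc Γ false e) ((e, false) :: p)) //=; split; rewrite ?inc_inc.
Qed.

End WalkProduct.

Section AddLeaf.
Variables (S : set T) (e : T) (b : bool).
Hypotheses (treeS : subtree Γ S) (Ve : ~ vert Γ e).
Hypotheses (Seb : S (inc Γ b e)) (nSe : ~ S (inc Γ (~~ b) e)).

Let w := inc Γ (~~ b) e.
Let S' := S `|` [set e; w].

Let S_inc i x : S x -> S (inc Γ i x). Proof. by case: treeS => _ h _ _; exact: h. Qed.

Let edge_S' x : S' x -> ~ vert Γ x -> S x \/ x = e.
Proof. by move=> [|[]]; [left|right|move=> -> []; exact: inc_vert]. Qed.

Let leaf_edge x c : S' x -> ~ vert Γ x -> inc Γ c x = w -> x = e /\ c = ~~ b.
Proof.
move=> S'x Vx xw; case: (edge_S' S'x Vx) => [/(S_inc c)|xe]; first by rewrite xw.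
split=> //; apply/eqP; apply: contraT => cb.
have cE : c = b by move: cb; case: (c); case: (b).
by case: nSe; rewrite -/w -xw xe cE.
Qed.

(* A reduced walk leaving [S] along the new edge cannot come back. *)
Let reduced_in_S x p y : S x -> S y -> walk Γ S' x p y -> reduced_walk p ->
  walk Γ S x p y.
Proof.
move=> + Sy; elim: p x => [|[e1 b1] p IHp] x Sx //= [S'e1 Ve1 e1x wp] red.
have redp : reduced_walk p.
  by apply: (@reduced_walk_sub [:: (e1, b1)] p [::]); rewrite cats0.
case: (edge_S' S'e1 Ve1) => [Se1|e1e].
  by split=> //; apply: IHp => //; exact: S_inc.
subst e1; have b1E : b1 = b.
  apply/eqP; apply: contraT => bb1; have b1E : b1 = ~~ b.
    by move: bb1; case: (b1); case: (b).
  by case: nSe; rewrite -b1E e1x.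
subst b1; case: p wp red {IHp redp} => [|[e2 b2] p] /=.
  by move=> we; case: nSe; rewrite we.
move=> [S'e2 Ve2 e2w _] red.
have [e2E b2E] := leaf_edge S'e2 Ve2 e2w.
by case: (red [::] e b p); rewrite e2E b2E.
Qed.

(** A closed reduced walk based in [S] stays in [S]. One based at the leaf starts and ends with the
    new edge; what lies between is a closed reduced walk of [S], hence empty, so that the whole
    backtracks. *)
Lemma subtree_add_leaf : subtree Γ S'.
Proof.
have [_ _ Sconn acyc] := treeS; split.
- by exists e; right; left.
- move=> i x [/(S_inc i)|[->|->]]; first by left.
    by case: (eqVneq i b) => [->|ib]; [left | right; right; congr inc; move: ib; case: (i); case: (b)].
  by right; right; rewrite /w inc_inc.
- have toS x : S' x -> vert Γ x -> exists2 y, S y /\ vert Γ y & exists p, walk Γ S' x p y.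
    move=> [Sx|[->|->]] Vx //.
      by exists x => //; exists [::].
    exists (inc Γ b e); first by split => //; exact: inc_vert.
    by exists [:: (e, ~~ b)]; rewrite /= negbK; split=> //; right; left.
  move=> x y S'x Vx S'y Vy.
  have [x' [Sx' Vx'] [p xp]] := toS _ S'x Vx.
  have [y' [Sy' Vy'] [q yq]] := toS _ S'y Vy.
  have [r xy] := Sconn _ _ Sx' Vx' Sy' Vy'.
  exists (p ++ r ++ walk_rev q); apply/walk_cat; exists x' => //.
  apply/walk_cat; exists y'; last exact: walk_revP.
  by apply: walk_sub xy; left.
move=> x p xp red; have [Sx|nSx] := pselect (S x).
  by apply: acyc (reduced_in_S Sx Sx xp red) red.
case: p xp red => [|[e1 b1] p] //= [S'e1 Ve1 e1x wp] red.
have xw : x = w.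
  case: (edge_S' S'e1 Ve1) => [/(S_inc b1)|e1E]; first by rewrite e1x.
  rewrite -e1x e1E /w; congr inc; apply/eqP; apply: contraT => bb1.
  by case: nSx; rewrite -e1x e1E; have -> : b1 = b by move: bb1; case: (b1); case: (b).
have [e1E b1E] := leaf_edge S'e1 Ve1 (etrans e1x xw); subst e1 b1.
rewrite negbK in wp.
case/lastP: p wp red => [|p [e2 b2]] wp red.
  by case: nSx; rewrite -wp.
move: wp; rewrite -cats1 => /walk_cat[y yp /= [S'e2 Ve2 e2y e2x]].
have [e2E b2E] := leaf_edge S'e2 Ve2 (etrans e2x xw).
have b2b : b2 = b by move: b2E; case: (b2); case: (b).
subst e2 b2; rewrite -e2y in yp.
have redp : reduced_walk p.
  by move: red; rewrite -cats1; exact: (@reduced_walk_sub [:: (e, ~~ b)] p).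
have pE := acyc _ _ (reduced_in_S Seb Seb yp redp) redp.
by case: (red [::] e (~~ b) [::]); rewrite pE /= negbK.
Qed.

End AddLeaf.

(** Along a walk to a vertex outside of [S], the first edge that leaves [S] could be added to it as
    a leaf. *)
Lemma maximal_subtree_spanning (S : set T) :
  connected_graph Γ -> maximal_subtree Γ S -> forall v, vert Γ v -> S v.
Proof.
move=> conn [treeS maxS] v Vv; have [[s0 Ss0] Sinc _ _] := treeS.
have Ss := Sinc false s0 Ss0.
have [p] := conn _ _ (inc_vert Γ false s0) Vv.
elim: p (inc Γ false s0) Ss => [|[e b] p IHp] x Sx /=; first by move=> <-.
move=> [_ Ve ex wp]; apply: IHp wp; apply: contrapT => nSe.
have Seb : S (inc Γ b e) by rewrite ex.
have /maxS S'E := subtree_add_leaf treeS Ve Seb nSe.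
by apply: nSe; rewrite -S'E; [right; right | move=> ? ?; left].
Qed.

End Trees.

(** * Classes of finite groups *)

Section Morph.
Variables (G H : groupType) (f : G -> H).
Hypothesis fM : {morph f : x y / x * y}.

Lemma gmorph1 : f 1 = 1.
Proof. by apply: (mulIg (f 1)); rewrite -fM !mul1g. Qed.

Lemma gmorphV x : f x^-1 = (f x)^-1.
Proof. by apply: (mulIg (f x)); rewrite -fM !mulVg gmorph1. Qed.

End Morph.

Section ClassC.
Variable C : finGroupType -> Prop.
Hypothesis hC : extension_closed_variety C.

Lemma C_image (Q R : finGroupType) (f : Q -> R) :
  {morph f : x y / x * y} -> (forall y, exists x, f x = y) -> C Q -> C R.
Proof.
move=> fM fs; pose F : {multiplicative Q -> R} :=
  HB.pack f (isMultiplicative.Build Q R f fM).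
exact: (@ext_image C hC Q R F fs).
Qed.

Section Image.
Variables (G : groupType) (R : finGroupType) (f : G -> R).
Hypothesis fM : {morph f : x y / x * y}.

Definition gimage_set : {set R} := finset (fun y => `[< exists x, f x = y >]).

Lemma gimageP y : reflect (exists x, f x = y) (y \in gimage_set).
Proof. by rewrite inE; exact: asboolP. Qed.

Lemma gimage_group_set : group_set gimage_set.
Proof.
apply/group_setP; split; first by apply/gimageP; exists 1; exact: gmorph1.
move=> _ _ /gimageP[x <-] /gimageP[y <-]; apply/gimageP.
by exists (x * y); rewrite fM.
Qed.

Definition gimage : {group R} := group gimage_group_set.

Lemma mem_gimage x : f x \in gimage. Proof. by apply/gimageP; exists x. Qed.

Lemma C_gimage : C R -> C (subg_of gimage).
Proof. exact: ext_subgroup. Qed.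

Lemma gimage_quotient :
  quotient_map [set x | f x = 1] (fun x => subg gimage (f x)).
Proof.
split.
- by move=> x y; rewrite fM; apply: val_inj; rewrite /= subgM ?mem_gimage.
- move=> y; have /gimageP[x fx] := subgP y.
  by exists x; rewrite fx sgvalK.
apply/seteqP; split=> x /= fx.
  by apply: val_inj; rewrite /= subgK ?mem_gimage.
by have := congr1 val fx; rewrite /= subgK ?mem_gimage.
Qed.

End Image.

Section Kernel.
Variables (Q R : finGroupType) (f : Q -> R).
Hypothesis fM : {morph f : x y / x * y}.

Lemma gker_group_set : group_set [set x | f x == 1].
Proof.
apply/group_setP; split; first by rewrite inE gmorph1.
by move=> x y; rewrite !inE fM => /eqP -> /eqP ->; rewrite mul1g.
Qed.

Definition gker : {group Q} := group gker_group_set.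

(** Closure under extensions, for a morphism in place of a normal subgroup: the quotient by the
    kernel is a homomorphic image of the image of [f], which is a subgroup of [R]. *)
Lemma C_gker : C R -> C (subg_of gker) -> C Q.
Proof.
move=> CR Cker; have nK : gker <| [set: Q]%G.
  apply/andP; split; first exact: finset.subsetT.
  apply/fintype.subsetP => x _; rewrite inE; apply/fintype.subsetP => y /imsetP[z].
  rewrite !inE => /eqP fz ->; rewrite conjgE !fM fz mul1g -fM mulVg.
  by rewrite gmorph1.
apply: (ext_extension hC nK Cker).
pose r (y : subg_of (gimage fM)) : Q :=
  sval (cid (gimageP f (val y) (subgP y))).
have rP y : f (r y) = val y by rewrite /r; case: cid.
have fE x y : f x = f y -> coset gker x = coset gker y.
  move=> fxy; rewrite -[x](mulgVK y); apply: coset_kerl.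
  by rewrite inE fM gmorphV // fxy mulgV.
have rM : {morph (fun y => coset gker (r y)) : y z / y * z}.
  have Nx x : x \in 'N(gker) by apply: (fintype.subsetP (normal_norm nK)); rewrite inE.
  move=> y z; rewrite -morphM //; apply: fE.
  by rewrite fM !rP.
apply: (C_image rM) (C_gimage fM CR) => xb.
have [x Nx ->] := cosetP xb.
exists (subg (gimage fM) (f x)); apply: fE.
by rewrite rP subgK // mem_gimage.
Qed.

End Kernel.

Lemma C_trivial (Q : finGroupType) : (forall x : Q, x = 1) -> C Q.
Proof.
move=> Q1; have [R CR] := ext_nonempty hC.
apply: (C_image (f := fun _ : R => 1 : Q)) CR => [x y|y]; first by rewrite mul1g.
by exists 1; rewrite (Q1 y).
Qed.

(** Induction on [s]: on the kernel of the first morphism, the remaining ones are still jointly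
    injective. *)
Lemma C_subdirect (I : eqType) (s : seq I) (R : I -> finGroupType)
    (Q : finGroupType) (f : forall i, Q -> R i) :
  (forall i, C (R i)) -> (forall i, {morph f i : x y / x * y}) ->
  (forall x, (forall i, i \in s -> f i x = 1) -> x = 1) -> C Q.
Proof.
move=> CR; elim: s Q f => [|i s IHs] Q f fM f1.
  by apply: C_trivial => x; exact: f1.
apply: (@C_gker Q (R i) (f i) (fM i) (CR i)).
apply: (IHs (subg_of (gker (fM i))) (fun j x => f j (sgval x))) => [j x y|x fx].
  exact: fM.
apply: val_inj; apply: f1 => j; rewrite inE => /predU1P[->|/fx //].
by have := subgP x; rewrite inE => /eqP.
Qed.

Lemma C_normal_ker (G : groupType) (R : finGroupType) (f : G -> R) :
  {morph f : x y / x * y} -> C R -> C_normal C [set x | f x = 1].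
Proof.
move=> fM CR; exists (subg_of (gimage fM)), (fun x => subg (gimage fM) (f x)).
by split; [exact: C_gimage | exact: gimage_quotient].
Qed.

End ClassC.

(** * Pro-C groups *)

Section TopGroup.
Variables (Y : topologicalType) (H : topGroupType).

Lemma continuousM (f g : Y -> H) :
  continuous f -> continuous g -> continuous (fun y => f y * g y).
Proof.
move=> cf cg y; have := @mulg_continuous H (f y, g y).
by apply: (@cvg_comp _ _ _ (fun y => (f y, g y)) _ _ _ _ (cvg_pair (cf y) (cg y))).
Qed.

Lemma continuousV (f : Y -> H) :
  continuous f -> continuous (fun y => (f y)^-1).
Proof.
move=> cf y; have := @invg_continuous H (f y).
exact: (@cvg_comp _ _ _ f _ _ _ _ (cf y)).
Qed.

End TopGroup.

Section InverseLimit.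
Variables (I : Type) (le : I -> I -> Prop) (Q : I -> finGroupType).
Variables (f : forall i j, Q j -> Q i) (L : topGroupType).
Variable p : forall i, L -> Q i.
Hypothesis limL : inverse_limit le f p.

Lemma limM i : {morph p i : x y / x * y}.
Proof. by have [_ h _ _ _] := limL; exact: h. Qed.

Lemma lim_inj x y : (forall i, p i x = p i y) -> x = y.
Proof.
have [_ _ pf lift _] := limL => pxy.
have [|z [_ zu]] := lift (fun i => p i x); first by move=> i j; exact: pf.
by rewrite -(zu x) // -(zu y).
Qed.

Lemma lim_loc_const i : loc_const (p i).
Proof. by have [_ _ _ _ nb] := limL; move=> x; apply/nb; exists i. Qed.

Lemma lim_nbhs x A : nbhs x A -> exists i, [set y | p i y = p i x] `<=` A.
Proof. by have [_ _ _ _ nb] := limL; move/nb. Qed.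

Lemma lim_le_eq i j x y : le i j -> p j x = p j y -> p i x = p i y.
Proof. by have [_ _ pf _ _] := limL; move=> ij e; rewrite -!(pf i j) // e. Qed.

Lemma lim_continuous (Y : topologicalType) (F : Y -> L) :
  (forall i, loc_const (p i \o F)) -> continuous F.
Proof.
by move=> lF y A /lim_nbhs[i iA]; apply: filterS (lF i y) => z /iA.
Qed.

Lemma lim_lift (Y : Type) (y : forall i, Y -> Q i) :
  (forall i j z, le i j -> f i (y j z) = y i z) ->
  exists F : Y -> L, forall i z, p i (F z) = y i z.
Proof.
have [_ _ _ lift _] := limL => yf.
have /choice[F FE] : forall z, exists x, forall i, p i x = y i z.
  move=> z; have [|x [xE _]] := lift (fun i => y i z); last by exists x.
  by move=> i j; exact: yf.
by exists F.
Qed.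

Lemma ultra_finite (Y : Type) (D : finType) (F : set_system Y) (g : Y -> D) :
  UltraFilter F -> exists d, F (g @^-1` [set d]).
Proof.
move=> FU; apply: contrapT => /forallNP nF.
have Fs (s : seq D) : F [set y | g y \notin s].
  elim: s => [|d s Fs]; first by apply: (filterS _ (filterT : F setT)).
  have [/nF //|Fd] := in_ultra_setVsetC (g @^-1` [set d]) FU.
  apply: (filterS _ (filterI Fs Fd)) => y [/= ys yd]; rewrite inE negb_or ys andbT.
  exact/eqP.
by have /filter_ex[y /=] := Fs (enum D); rewrite mem_enum.
Qed.

Lemma lim_profinite : profinite_space L.
Proof.
have [[_ _ dir _ _] _ pf lift nb] := limL.
apply: zero_dimensional_profinite.
- rewrite compact_ultra => F FU _.
  (* The ultrafilter selects one value in each finite quotient; any two of these values are attained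
     at a common point, hence they are compatible. *)
  pose y i := sval (cid (ultra_finite (p i) FU)).
  have Fy i : F (p i @^-1` [set y i]) by rewrite /y; case: cid.
  have [|x [xE _]] := lift y.
    move=> i j ij; have [z [/= <- <-]] := filter_ex (filterI (Fy i) (Fy j)).
    exact: pf.
  exists x; split=> // A /nb[i iA]; apply: filterS (Fy i) => z /= zi.
  by apply: iA => /=; rewrite zi xE.
- move=> x y h; apply: lim_inj => i.
  have [z [/= <- <-]] := h _ _ (lim_loc_const i x) (lim_loc_const i y).
  by [].
move=> x y /eqP xy; have [i xyi] : exists i, p i x <> p i y.
  by apply: contrapT => /forallNP h; apply: xy; apply: lim_inj => i; apply: contrapT; exact: h.
exists (p i @^-1` [set p i x]); split=> //=; last exact/nesym.
exact/loc_const_clopen/lim_loc_const.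
Qed.

Lemma lim_closure (A : set L) x :
  closure A x <-> forall i, exists2 a, A a & p i a = p i x.
Proof.
split=> [cA i|h B /lim_nbhs[i iB]].
  by have [a [Aa /= ai]] := cA _ (lim_loc_const i x); exists a.
by have [a Aa ai] := h i; exists a; split=> //; exact: iB.
Qed.

End InverseLimit.

Lemma pro_C_profinite C (L : topGroupType) : pro_C C L -> profinite_space L.
Proof. by case=> I [le [Q [f [p [_]]]]]; exact: lim_profinite. Qed.

Definition subgroup_set (K : groupType) (A : set K) :=
  [/\ A 1, forall x y, A x -> A y -> A (x * y) & forall x, A x -> A x^-1].

Section ClosedSubgroup.
Variables (K : topGroupType) (A : set K) (hA : subgroup_set A).

(** The proof [hA] is kept as a parameter of the type, so that the group structure built from it can
    be attached to the type. *)
Definition csub : Type := let _ := hA in set_type A.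
HB.instance Definition _ := Topological.copy csub (set_type A).

Definition csub_val (x : csub) : K := set_val x.
Definition csub_mk x (Ax : A x) : csub := exist _ x (mem_set Ax).

Lemma csub_valP x : A (csub_val x). Proof. exact: set_valP. Qed.

Lemma csub_val_inj : injective csub_val. Proof. exact: val_inj. Qed.

Definition csub_one : csub := csub_mk (let: And3 h _ _ := hA in h).
Definition csub_mul (x y : csub) : csub :=
  csub_mk (let: And3 _ h _ := hA in h _ _ (csub_valP x) (csub_valP y)).
Definition csub_inv (x : csub) : csub :=
  csub_mk (let: And3 _ _ h := hA in h _ (csub_valP x)).

Lemma csub_mulA : associative csub_mul.
Proof. by move=> x y z; apply: csub_val_inj; exact: mulgA. Qed.
Lemma csub_mul1 : left_id csub_one csub_mul.
Proof. by move=> x; apply: csub_val_inj; exact: mul1g. Qed.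
Lemma csub_mulr1 : right_id csub_one csub_mul.
Proof. by move=> x; apply: csub_val_inj; exact: mulg1. Qed.
Lemma csub_mulV : left_inverse csub_one csub_inv csub_mul.
Proof. by move=> x; apply: csub_val_inj; exact: mulVg. Qed.
Lemma csub_mulrV : right_inverse csub_one csub_inv csub_mul.
Proof. by move=> x; apply: csub_val_inj; exact: mulgV. Qed.

HB.instance Definition _ := isGroup.Build csub
  csub_mulA csub_mul1 csub_mulr1 csub_mulV csub_mulrV.

Lemma csub_val_continuous : continuous csub_val.
Proof. exact: set_val_continuous. Qed.

Lemma csub_continuous (Z : topologicalType) (f : Z -> csub) :
  continuous (csub_val \o f) -> continuous f.
Proof. exact: set_type_continuous. Qed.

Lemma csub_mul_continuous : continuous (fun p : csub * csub => p.1 * p.2).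
Proof.
apply: csub_continuous => /=; apply: continuousM => p.
  by apply: continuous_comp; [exact: cvg_fst | exact: csub_val_continuous].
by apply: continuous_comp; [exact: cvg_snd | exact: csub_val_continuous].
Qed.

Lemma csub_inv_continuous : continuous (fun x : csub => x^-1).
Proof. by apply: csub_continuous; apply: continuousV; exact: csub_val_continuous. Qed.

HB.instance Definition _ :=
  isTopGroup.Build csub csub_mul_continuous csub_inv_continuous.

Lemma csub_valM : {morph csub_val : x y / x * y}. Proof. by []. Qed.

(** The subgroup is the limit of its images in the [Q i]: a compatible family in these images has a
    limit in [K] that is adherent to [A], hence in [A]. *)
Lemma csub_pro_C C : extension_closed_variety C -> pro_C C K -> closed A ->
  pro_C C csub.
Proof.
move=> hC [I [le [Q [f [p [CQ limK]]]]]] cA.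
have [[Ie tr dir fM [fid fcomp]] pM pf lift nb] := limK.
have qM i : {morph (fun x : csub => p i (csub_val x)) : x y / x * y}.
  by move=> x y; exact: pM.
pose B i := gimage (qM i).
have fB i j y : le i j -> y \in B j -> f i j y \in B i.
  by move=> ij /gimageP[x <-]; rewrite pf //; exact: (mem_gimage (qM i)).
exists I, le, (fun i => subg_of (B i)), (fun i j y => subg (B i) (f i j (val y))),
  (fun i x => subg (B i) (p i (csub_val x))); split.
  by move=> i; exact: C_gimage.
have pB i (x : csub) : p i (csub_val x) \in B i by exact: (mem_gimage (qM i)).
split.
- split=> //.
  + move=> i j ij x y; apply: val_inj.
    by rewrite /= !subgK ?fM ?groupM ?fB ?subgP.
  + split=> [i x|i j k x ij jk]; first by rewrite fid sgvalK.
    by rewrite subgK ?(fcomp i j k) // fB ?subgP.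
- by move=> i x y; rewrite csub_valM pM subgM ?pB.
- by move=> i j x ij; rewrite subgK ?pf.
- move=> y yf; have [|x [xE xu]] := lift (fun i => val (y i)).
    by move=> i j ij; rewrite -(yf i j ij) subgK // fB ?subgP.
  have Ax : A x.
    apply: cA; apply/(lim_closure limK) => i; rewrite xE.
    have /gimageP[a ay] := subgP (y i).
    by exists (csub_val a); [exact: csub_valP | exact: ay].
  exists (csub_mk Ax); split=> [i|z zy].
    by rewrite -[RHS]sgvalK; congr subg; exact: xE.
  apply: csub_val_inj => /=; apply: xu => i; rewrite -(zy i) subgK //.
move=> x D; split=> [/set_type_nbhs[E /nb[i iE] ED]|[i iD]].
  exists i => y yx; apply: ED; apply: iE => /=.
  by have := congr1 val yx; rewrite /= !subgK ?pB.
apply/set_type_nbhs; exists [set y | p i y = p i (val x)].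
  exact: lim_loc_const limK _ _.
by move=> y /= yx; apply: iD => /=; rewrite /csub_val /set_val /= yx.
Qed.

End ClosedSubgroup.

Section Discrete.
Variable Q : finGroupType.

Definition discrete_group : Type := discrete_topology Q.
HB.instance Definition _ := Topological.on discrete_group.
HB.instance Definition _ := isGroup.Build discrete_group
  (@mulgA Q) (@mul1g Q) (@mulg1 Q) (@mulVg Q) (@mulgV Q).

Lemma discrete_loc_const (D : Type) (f : discrete_group -> D) : loc_const f.
Proof.
by apply: open_loc_const => d; exact: (@discrete_open (discrete_topology Q)).
Qed.

Lemma continuous_loc_const (Y : topologicalType) (f : Y -> discrete_group) :
  loc_const f -> continuous f.
Proof.
move=> lf x A Ax; apply: filterS (lf x) => y /= yx; rewrite /preimage /= yx.
exact: (@nbhs_singleton (discrete_topology Q)).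
Qed.

Lemma discrete_mul_continuous :
  continuous (fun p : discrete_group * discrete_group => p.1 * p.2).
Proof.
apply: continuous_loc_const.
apply: (loc_const2 (fun x y : discrete_group => x * y)).
  apply: (loc_const_comp _ (@discrete_loc_const _ id)) => p; exact: cvg_fst.
apply: (loc_const_comp _ (@discrete_loc_const _ id)) => p; exact: cvg_snd.
Qed.

Lemma discrete_inv_continuous : continuous (fun x : discrete_group => x^-1).
Proof. exact/continuous_loc_const/discrete_loc_const. Qed.

HB.instance Definition _ :=
  isTopGroup.Build discrete_group discrete_mul_continuous discrete_inv_continuous.

Lemma discrete_pro_C (C : finGroupType -> Prop) : C Q -> pro_C C discrete_group.
Proof.
move=> CQ; exists unit, (fun _ _ => True), (fun _ => Q), (fun _ _ x => x),
  (fun _ x => x); split=> //; split=> //.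
- by move=> y yE; exists (y tt); split=> [[]//|x xy]; rewrite -(xy tt).
- move=> x A; split=> [Ax|[_ xA]].
  by exists tt => y /= ->; exact: (@nbhs_singleton (discrete_topology Q)).
by rewrite nbhsE; exists [set x]; [split=> //; exact: (@discrete_open (discrete_topology Q)) | ].
Qed.

End Discrete.

(** The pro-C topology of a group is given by a subbasis; this reduces comparing its neighbourhoods
    with those of the completion to the case of subbasic sets. *)
Lemma finI_from_nbhs (I : choiceType) (Z : Type) (Y : topologicalType)
    (D : set I) (b : I -> set Z) (j : Z -> Y) (z : Z) (E : set Z) :
  (forall i, D i -> b i z -> exists2 O, nbhs (j z) O & j @^-1` O `<=` b i) ->
  finI_from D b E -> E z -> exists2 O, nbhs (j z) O & j @^-1` O `<=` E.
Proof.
move=> bO [s sD <-] sz.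
exists (\bigcap_(i in [set` s]) [set y | forall x, j x = y -> b i x]).
  apply: filter_bigI => i si; have [||O Oz Ob] := bO i.
  - by have /set_mem := sD i si.
  - exact: sz.
  by apply: filterS Oz => y Oy x xy; apply: Ob; rewrite /= xy.
by move=> x sx i si; exact: (sx i si).
Qed.

(** * Pro-C completions *)

Section Completion.
Variable C : finGroupType -> Prop.
Hypothesis hC : extension_closed_variety C.
Variables (G : groupType) (K : topGroupType) (iota : G -> K).
Hypothesis hK : pro_C_completion C iota.

(** The groups [Q U] of a completion are known only through the kernels [U]; each is an image of the
    group in [C] that witnesses [C_normal C U], since both have the same kernel. *)
Lemma completion_pro_C : pro_C C K.
Proof.
have [Q [q [f [p [qU _ limK _]]]]] := hK.
exists {U : set G | C_normal C U}, (fun U U' => sval U' `<=` sval U), Q, f, p.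
split=> // -[U CU]; have [R [r [CR [rM rs rU]]]] := CU.
have [qM qs qUE] := qU (exist _ U CU); rewrite /= in qUE.
have rq x y : r x = r y <-> q (exist _ U CU) x = q (exist _ U CU) y.
  have : r (x^-1 * y) = 1 <-> q (exist _ U CU) (x^-1 * y) = 1.
    rewrite -[q _ _ = 1]/([set x | q (exist _ U CU) x = 1] (x^-1 * y)) -qUE.
    by rewrite rU.
  rewrite rM qM !gmorphV //.
  move=> [h1 h2]; split=> e.
    by apply/esym; rewrite -[RHS]mulg1 -h1 ?mulKVg // e mulVg.
  by apply/esym; rewrite -[RHS]mulg1 -h2 ?mulKVg // e mulVg.
have /choice[s sP] := rs.
have sM : {morph (fun y => q (exist _ U CU) (s y)) : x y / x * y}.
  by move=> x y; rewrite -qM; apply/rq; rewrite rM !sP.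
apply: (C_image hC sM) CR => y; have [x <-] := qs y.
by exists (r x); apply/rq; rewrite sP.
Qed.

Lemma completionM : {morph iota : x y / x * y}.
Proof.
have [Q [q [f [p [qU _ limK pq]]]]] := hK.
move=> x y; apply: (lim_inj limK) => U.
by have [qM _ _] := qU U; rewrite (limM limK) !pq qM.
Qed.

Lemma completion_dense : dense (range iota).
Proof.
have [Q [q [f [p [qU _ limK pq]]]]] := hK.
move=> O [x Ox] oO; have [U UO] := lim_nbhs limK (open_nbhs_nbhs (conj oO Ox)).
have [_ qs _] := qU U; have [g gx] := qs (p U x).
by exists (iota g); split; [apply: UO; rewrite /= pq | exists g].
Qed.

Lemma completion_near (D : Type) (h : K -> D) k :
  loc_const h -> exists g, h (iota g) = h k.
Proof.
by move=> lh; have [_ [[g _ <-] <-]] := dense_nbhs completion_dense (lh k); exists g.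
Qed.

(** The image of [phi] is in [C], so its kernel is one of the subgroups of the system, and [phi]
    factors through the coordinate of [K] at that subgroup. *)
Lemma completion_finite (R : finGroupType) (phi : G -> R) :
  C R -> {morph phi : x y / x * y} ->
  exists F : K -> R, [/\ loc_const F, {morph F : x y / x * y}
    & forall g, F (iota g) = phi g].
Proof.
move=> CR phiM; have [Q [q [f [p [qU _ limK pq]]]]] := hK.
pose U : {U : set G | C_normal C U} := exist _ _ (C_normal_ker hC phiM CR).
have [qM qs qE] := qU U; have /choice[s sP] := qs.
have phiE x y : q U x = q U y -> phi x = phi y.
  move=> e; have : sval U (x^-1 * y).
    by rewrite qE /= qM gmorphV // e mulVg.
  by rewrite /= phiM gmorphV // => e'; rewrite -[LHS]mulg1 -e' mulKVg.
have FE g : phi (s (p U (iota g))) = phi g by apply: phiE; rewrite sP pq.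
have lF : loc_const (fun k => phi (s (p U k))).
  exact: (loc_const_post (fun y => phi (s y)) (lim_loc_const limK U)).
exists (fun k => phi (s (p U k))); split=> // x y.
by rewrite -phiM; apply: phiE; rewrite qM !sP (limM limK).
Qed.

Lemma completion_ext (H : topGroupType) (phi : G -> H) :
  pro_C C H -> {morph phi : x y / x * y} ->
  exists F : K -> H, [/\ continuous F, {morph F : x y / x * y}
    & forall g, F (iota g) = phi g].
Proof.
move=> [I [le [Q [f [p [CQ limH]]]]]] phiM.
have hex i : exists F : K -> Q i, [/\ loc_const F,
    {morph F : x y / x * y} & forall g, F (iota g) = p i (phi g)].
  by apply: completion_finite => // x y; rewrite phiM (limM limH).
pose h i := sval (cid (hex i)).
have hP i : [/\ loc_const (h i), {morph h i : x y / x * y}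
    & forall g, h i (iota g) = p i (phi g)] by rewrite /h; case: cid.
have [_ _ pf _ _] := limH.
have [|F FE] := lim_lift limH (y := h).
  move=> i j k ij; have [li _ hi] := hP i; have [lj _ hj] := hP j.
  (* Both coordinates are locally constant, so a single element of [G] realises them at [k], and
     compatibility is inherited from [phi]. *)
  have [g [<- <-]] : exists g, h i (iota g) = h i k /\ h j (iota g) = h j k.
    have [g []] := completion_near k (loc_const2 pair li lj).
    by exists g.
  by rewrite hi hj pf.
exists F; split.
- apply: (lim_continuous limH) => i.
  have -> : p i \o F = h i by apply/funext => k; exact: FE.
  by case: (hP i).
- move=> x y; apply: (lim_inj limH) => i; have [_ hM _] := hP i.
  by rewrite (limM limH) !FE hM.
move=> g; apply: (lim_inj limH) => i; rewrite FE.
by case: (hP i).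
Qed.

Lemma completion_iso (P : topGroupType) (F : K -> P) (F' : P -> K) :
  continuous F -> continuous F' -> {morph F : x y / x * y} ->
  cancel F F' -> cancel F' F -> pro_C_completion C (F \o iota).
Proof.
move=> cF cF' FM FK F'K; have [Q [q [f [p [qU qf limK pq]]]]] := hK.
have F'M : {morph F' : x y / x * y}.
  by move=> x y; apply: (can_inj FK); rewrite FM !F'K.
exists Q, q, f, (fun U x => p U (F' x)); split=> //; last first.
  by move=> U g /=; rewrite FK.
have [sys pM pf lift nb] := limK; split=> //.
- by move=> U x y; rewrite F'M pM.
- by move=> U V x; exact: pf.
- move=> y yf; have [x [xE xu]] := lift y yf.
  exists (F x); split=> [U|z zE]; first by rewrite FK xE.
  by rewrite -[z]F'K (xu (F' z)).
move=> x A; split=> [xA|[U UA]].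
  have : nbhs (F' x) (F @^-1` A) by apply: cF; rewrite F'K.
  by move=> /nb[U UA]; exists U => y /UA /=; rewrite F'K.
apply: filterS UA _.
exact: (loc_const_comp cF' (lim_loc_const limK U)).
Qed.

(** Every neighbourhood in the pro-C topology contains the preimage of a neighbourhood in [K], so
    points of [G] adherent to [A] in [K] are already adherent in [G]. This is how the closedness
    assumption of (d) enters. *)
Lemma completion_closed (A : set G) g :
  pro_C_closed C A -> closure (iota @` A) (iota g) -> A g.
Proof.
move=> cA clg; apply: cA => N.
have [Q [q [f [p [qU qf limK pq]]]]] := hK.
suff: nbhs (g : pro_C_top C G) N -> exists2 O, nbhs (iota g) O & iota @^-1` O `<=` N.
  move=> h /h[O Og ON]; have [_ [[a Aa <-] Oa]] := clg _ Og.
  by exists a; split=> //; exact: ON.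
case=> B [[D' D'sub BE] Bg BN].
move: Bg; rewrite -BE => -[E D'E Eg].
move: (D'sub _ D'E).
move=> EI; have [|O Og OE] := finI_from_nbhs (j := iota) _ EI Eg.
  move=> W [h [V [CV WE]]] /=.
  pose U : {U : set G | C_normal C U} := exist _ V CV.
  have [qM _ VE] := qU U; rewrite /= in VE; rewrite WE VE => -[a qa ga].
  exists [set k | p U k = p U (iota g)]; first exact: lim_loc_const limK U (iota g).
  move=> x /=; rewrite !pq => xg; exists (h^-1 * x); last by rewrite mulKVg.
  by rewrite /= qM gmorphV // xg -ga !qM mulKg.
exists O => // x Ox; apply: BN; rewrite -BE; exists E => //; exact: OE.
Qed.

End Completion.

(** * The space of ultrafilters *)

(* The Stone-Cech compactification of a discrete space. *)
Definition ultra (T : Type) : Type := {p : set_system T | UltraFilter p}.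
HB.instance Definition _ (T : Type) := gen_eqMixin (ultra T).
HB.instance Definition _ (T : Type) := gen_choiceMixin (ultra T).

Section Ultra.
Variable T : Type.
Implicit Types (p q : ultra T) (A B : set T).

Definition uin p A : Prop := sval p A.

#[local] Instance ultra_filter p : UltraFilter (uin p). Proof. exact: svalP. Qed.

Lemma uinP p : UltraFilter (sval p). Proof. exact: svalP. Qed.

Lemma uinT p : uin p setT.
Proof. exact: filterT. Qed.

Lemma uinI p A B : uin p A -> uin p B -> uin p (A `&` B).
Proof. exact: filterI. Qed.

Lemma uinS p A B : A `<=` B -> uin p A -> uin p B.
Proof. exact: filterS. Qed.

Lemma uinC p A : uin p (~` A) <-> ~ uin p A.
Proof.
split=> [pA' pA|pA]; first by have [x []] := filter_ex (filterI pA pA').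
by have [] := in_ultra_setVsetC A (ultra_filter p).
Qed.

Lemma uin_ex p A : uin p A -> exists x, A x.
Proof. exact: filter_ex. Qed.

Lemma ultra_eq p q : (forall A, uin p A -> uin q A) -> p = q.
Proof.
move=> pq; have e : sval p = sval q.
  apply/seteqP; split=> A; first exact: pq.
  by move=> qA; apply: contrapT => /uinC/pq/uinC.
case: p q e {pq} => p pU [q qU] /= e; subst q.
by congr exist; exact: Prop_irrelevance.
Qed.

Lemma max_ultra (F : set_system T) : ProperFilter F ->
  (forall A, F A \/ F (~` A)) -> UltraFilter F.
Proof.
move=> FF FC; split=> // G GF FG; apply/seteqP; split=> A; last exact: FG.
move=> GA; have [//|/FG GA'] := FC A.
by have [x []] := filter_ex (filterI GA GA').
Qed.

Definition ultra_nbhs p : set_system (ultra T) :=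
  [set N | exists2 A, uin p A & [set q | uin q A] `<=` N].

HB.instance Definition _ := hasNbhs.Build (ultra T) ultra_nbhs.

Lemma ultra_nbhs_filter p : ProperFilter (nbhs p).
Proof.
apply: Build_ProperFilter_ex; first by move=> N [A pA AN]; exists p; exact: AN.
split=> [|N M [A pA AN] [B pB BM]|N M NM [A pA AN]].
- by exists setT => //; exact: uinT.
- exists (A `&` B); first exact: uinI.
  by move=> q qAB; split; [apply: AN | apply: BM]; apply: uinS qAB => x [].
- by exists A => // q /AN /NM.
Qed.

Lemma ultra_nbhs_singleton p (N : set (ultra T)) : nbhs p N -> N p.
Proof. by case=> A pA; apply. Qed.

Lemma ultra_nbhs_nbhs p (N : set (ultra T)) : nbhs p N -> nbhs p (nbhs^~ N).
Proof. by case=> A pA AN; exists A => // q qA; exists A. Qed.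

HB.instance Definition _ := Nbhs_isNbhsTopological.Build (ultra T)
  ultra_nbhs_filter ultra_nbhs_singleton ultra_nbhs_nbhs.

Lemma uin_loc_const A : loc_const (fun p => `[< uin p A >]).
Proof.
move=> p; have [pA|/uinC pA] := pselect (uin p A).
  by exists A => // q qA; rewrite /= !asboolT.
by exists (~` A) => // q /uinC qA; rewrite /= !asboolF //; apply/uinC.
Qed.

Lemma uin_clopen A : clopen [set p | uin p A].
Proof.
have -> : [set p | uin p A] = (fun p => `[< uin p A >]) @^-1` [set true].
  by apply/seteqP; split=> p /= /asboolP.
exact/loc_const_clopen/uin_loc_const.
Qed.

Lemma ultra_profinite : profinite_space (ultra T).
Proof.
apply: zero_dimensional_profinite.
- rewrite compact_ultra => F FU _.
  (* The limit of an ultrafilter of ultrafilters: the sets that belong to [F]-almost all of them. *)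
  pose l : set_system T := [set A | F [set p | uin p A]].
  have lU : UltraFilter l.
    apply: max_ultra.
      apply: Build_ProperFilter_ex.
        by move=> A lA; have [p /uin_ex] := filter_ex (lA : F _).
      split=> [|A B lA lB|A B AB lA].
      + by apply: (filterS _ (filterT : F setT)) => p _; exact: uinT.
      + have FAB : F ([set p | uin p A] `&` [set p | uin p B]) by exact: filterI.
        by rewrite /l /=; apply: (filterS _ FAB) => p [pA pB]; exact: uinI.
      + have FA : F [set p | uin p A] by [].
        by rewrite /l /=; apply: (filterS _ FA) => p; exact: uinS.
    move=> A; have [|FA] := in_ultra_setVsetC [set p | uin p A] FU; first by left.
    by right; apply: (filterS _ FA) => p /uinC.
  exists (exist _ l lU); split=> // N [A lA AN].
  exact: (filterS AN lA).
- move=> p q h; apply: ultra_eq => A pA; apply: contrapT => /uinC qA.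
  have [||r [rA /uinC]] := h [set r | uin r A] [set r | uin r (~` A)].
  + by exists A.
  + by exists (~` A).
  + exact.
move=> p q /eqP pq; have [A [pA qA]] : exists A, uin p A /\ ~ uin q A.
  apply: contrapT => /forallNP h; apply: pq; apply: ultra_eq => A pA.
  by apply: contrapT => qA; apply: (h A).
by exists [set r | uin r A]; split=> //; exact: uin_clopen.
Qed.

Definition principal (x : T) : ultra T :=
  exist _ (principal_filter x) (principal_filter_ultra x).

Lemma principalE x A : uin (principal x) A <-> A x.
Proof. exact: principal_filterP. Qed.

Lemma principal_inj : injective principal.
Proof.
move=> x y e; have : uin (principal y) [set x] by rewrite -e; apply/principalE.
by move/principalE.
Qed.

Lemma principal_dense : dense (range principal).
Proof.
move=> O [p Op] oO; have [A pA AO] : nbhs p O by exact: open_nbhs_nbhs.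
have [x Ax] := uin_ex pA; exists (principal x); split; last by exists x.
by apply: AO; apply/principalE.
Qed.

Lemma ultra_ext_finite (D : finType) (f : T -> D) :
  exists F : ultra T -> D, loc_const F /\ forall p, uin p (f @^-1` [set F p]).
Proof.
have /choice[F FP] : forall p, exists d, uin p (f @^-1` [set d]).
  by move=> p; exact: ultra_finite (ultra_filter p).
exists F; split=> // p; exists (f @^-1` [set F p]) => // q /= qp.
by have [x [/= <- <-]] := uin_ex (uinI (FP q) qp).
Qed.

Lemma ultra_ext_principal (D : Type) (f : T -> D) (F : ultra T -> D) x :
  (forall p, uin p (f @^-1` [set F p])) -> F (principal x) = f x.
Proof. by move=> /(_ (principal x))/principalE. Qed.

Section ProCExtension.
Variables (I : Type) (le : I -> I -> Prop) (Q : I -> finGroupType).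
Variables (f : forall i j, Q j -> Q i) (L : topGroupType).
Variable p : forall i, L -> Q i.
Hypothesis limL : inverse_limit le f p.

Lemma ultra_ext_lim (t : T -> L) :
  exists F : ultra T -> L, [/\ continuous F, forall x, F (principal x) = t x
    & forall i u, uin u [set x | p i (t x) = p i (F u)]].
Proof.
pose h i := sval (cid (ultra_ext_finite (p i \o t))).
have hP i : loc_const (h i) /\ forall u, uin u ((p i \o t) @^-1` [set h i u]).
  by rewrite /h; case: cid.
have [_ _ pf _ _] := limL.
have [|F FE] := lim_lift limL (y := h).
  move=> i j u ij; have [_ hi] := hP i; have [_ hj] := hP j.
  by have [x [/= <- <-]] := uin_ex (uinI (hi u) (hj u)); exact: pf.
exists F; split=> [|x|i u].
- apply: (lim_continuous limL) => i.
  by have -> : p i \o F = h i by [apply/funext => u; exact: FE]; case: (hP i).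
- apply: (lim_inj limL) => i; rewrite FE; have [_ hi] := hP i.
  exact: ultra_ext_principal hi.
- by rewrite FE; have [_] := hP i; exact.
Qed.

End ProCExtension.

Lemma ultra_ext_pro_C C (L : topGroupType) (t : T -> L) : pro_C C L ->
  exists F : ultra T -> L, continuous F /\ forall x, F (principal x) = t x.
Proof.
case=> I [le [Q [f [p [_ limL]]]]].
by have [F [cF Ft _]] := ultra_ext_lim limL t; exists F.
Qed.

End Ultra.

Section UltraMap.
Variables (T T' : Type) (f : T -> T').

Lemma ultra_map_subproof (p : ultra T) :
  UltraFilter [set A : set T' | uin p (f @^-1` A)].
Proof.
have pU := uinP p; apply: max_ultra => A.
by have [?|?] := pselect (uin p (f @^-1` A)); [left|right; apply/uinC].
Qed.

Definition ultra_map (p : ultra T) : ultra T' := exist _ _ (ultra_map_subproof p).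

Lemma ultra_mapE p A : uin (ultra_map p) A = uin p (f @^-1` A).
Proof. by []. Qed.

Lemma ultra_map_continuous : continuous ultra_map.
Proof.
by move=> p N [A pA AN]; exists (f @^-1` A) => // q qA; exact: AN.
Qed.

Lemma ultra_map_principal x : ultra_map (principal x) = principal (f x).
Proof. by apply: ultra_eq => A; rewrite ultra_mapE => /principalE fA; apply/principalE. Qed.

End UltraMap.

Section UltraGraph.
Variables (T : Type) (Γ : graph T).

Definition ultra_vert : set (ultra T) := [set p | uin p (vert Γ)].

Lemma ultra_vert_nonempty : ultra_vert !=set0.
Proof. by have [v Vv] := vert_nonempty Γ; exists (principal v); apply/principalE. Qed.

Lemma ultra_inc_vert i p : ultra_vert (ultra_map (inc Γ i) p).
Proof.
have : uin p (inc Γ i @^-1` vert Γ) by apply: uinS (uinT p) => x _; exact: inc_vert.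
by [].
Qed.

Lemma ultra_inc_id i p : ultra_vert p -> ultra_map (inc Γ i) p = p.
Proof.
move=> Vp; apply/esym/ultra_eq => A pA; rewrite ultra_mapE.
by apply: uinS (uinI Vp pA) => x [Vx Ax]; rewrite /preimage /= inc_id.
Qed.

Definition ultra_graph : graph (ultra T) :=
  Graph ultra_vert_nonempty ultra_inc_vert ultra_inc_id.

Lemma ultra_graph_profinite : profinite_graph ultra_graph.
Proof.
split; [exact: ultra_profinite | by case: (uin_clopen (vert Γ)) |].
by move=> i; exact: ultra_map_continuous.
Qed.

Lemma principal_morphism : graph_morphism Γ ultra_graph (@principal T).
Proof. by move=> i x; rewrite /= ultra_map_principal. Qed.

Lemma ultra_graph_connected : connected_graph Γ -> profinite_connected ultra_graph.
Proof.
move=> cΓ; apply: profinite_connectedP => f lf fi.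
have fE i x : f (principal (inc Γ i x)) = f (principal x).
  by rewrite principal_morphism fi.
have fV x y : vert Γ x -> vert Γ y -> f (principal x) = f (principal y).
  move=> Vx Vy; have [p] := cΓ x y Vx Vy.
  elim: p x {Vx} => [|[e b] p IHp] x /=; first by move=> ->.
  by move=> [_ _ <- /IHp <-]; rewrite !fE.
have [v Vv] := vert_nonempty Γ.
suff -> : f = fun=> f (principal v) by [].
apply: (dense_loc_const (@principal_dense T)) => //.
  exact: loc_const_cst.
by move=> _ [x _ <-]; rewrite -(fE false); apply: fV => //; exact: inc_vert.
Qed.

End UltraGraph.

(** * The abstract fundamental group *)

Section Pi1Theory.
Variables (T X : choiceType) (Γ : graph T) (GG : graph_of_groups X Γ).
Variable S : set T.
Local Notation G := (pi1 GG S).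
Local Notation elt := (pi1_elt GG S).
Local Notation t := (pi1_t GG S).
Local Notation cls := (fun w : pi1_word T X => \pi_(pi1 GG S)%qT w).

Lemma pi1_cat (u v : pi1_word T X) : cls (u ++ v) = cls u * cls v :> G.
Proof.
by apply/esym/pi1_piE; apply: pi1_eqv_cat; exact: pi1_reprP.
Qed.

Lemma pi1_nil : cls [::] = 1 :> G. Proof. by []. Qed.

Lemma pi1_letterP u v : pi1_rel GG S u v -> cls u = cls v.
Proof. by move=> uv; apply/pi1_piE/pi1_eqv1. Qed.

Lemma pi1_eltM x y : gproj GG x = gproj GG y ->
  elt (smul GG x y) = elt x * elt y.
Proof. by move=> xy; rewrite /pi1_elt -pi1_cat; apply/esym/pi1_letterP/pi1_mul. Qed.

Lemma pi1_elt_one m : elt (sone GG m) = 1.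
Proof. by rewrite -pi1_nil; apply/pi1_letterP/pi1_one. Qed.

Lemma pi1_elt_inv x : elt (sinv GG x) = (elt x)^-1.
Proof.
apply/esym/mulg1_eq; apply: (mulgI (elt (sinv GG x))).
rewrite mulgA -pi1_eltM ?gproj_sinv // smulV pi1_elt_one mul1g mulg1.
by [].
Qed.

Lemma pi1_t1 e : vert Γ e \/ S e -> t e = 1.
Proof. by move=> eS; rewrite -pi1_nil; apply/pi1_letterP/pi1_tree. Qed.

Lemma pi1_tV e : cls [:: inr (e, true)] = (t e)^-1.
Proof.
apply/esym/mulg1_eq; rewrite /pi1_t -pi1_cat -pi1_nil.
by apply/pi1_letterP; exact: (pi1_inv GG S e false).
Qed.

Lemma pi1_elt_bd0 x : elt (bd GG false x) = elt x.
Proof. exact/esym/pi1_letterP/pi1_edge_group. Qed.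

Lemma pi1_elt_bd1 x :
  elt (bd GG true x) = (t (gproj GG x))^-1 * elt x * t (gproj GG x).
Proof.
have [Vx|Vx] := pselect (vert Γ (gproj GG x)).
  by rewrite bd_vert // pi1_t1; [rewrite invg1 mul1g mulg1 | left].
rewrite -(pi1_elt_bd0 x) [elt (bd GG false x)](pi1_letterP (pi1_stable S Vx)).
rewrite -[_ :: _]/([:: inr (gproj GG x, false)] ++ [:: inl (bd GG true x)] ++ _).
by rewrite !pi1_cat pi1_tV !mulgA mulVg mul1g mulgVK.
Qed.

Definition vertex_subgroup m : set G := elt @` fibre GG m.

Lemma vertex_subgroupP m : subgroup_set (vertex_subgroup m).
Proof.
split.
- by exists (sone GG m); [exact: gproj_sone | exact: pi1_elt_one].
- move=> _ _ [x xm <-] [y ym <-]; exists (smul GG x y).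
    by rewrite /fibre /= gproj_smul // xm ym.
  by rewrite pi1_eltM // xm ym.
- move=> _ [x xm <-]; exists (sinv GG x); last exact: pi1_elt_inv.
  by rewrite /fibre /= gproj_sinv.
Qed.

Lemma pi1_ind (P : G -> Prop) : P 1 ->
  (forall x w, P w -> P (elt x * w)) -> (forall e w, P w -> P (t e * w)) ->
  (forall e w, P w -> P ((t e)^-1 * w)) -> forall w, P w.
Proof.
move=> P1 Pelt Pt PtV w; rewrite -[w]reprK.
elim: (generic_quotient.repr w) => [|[x|[e b]] u IHu]; first by rewrite pi1_nil.
  by rewrite -[_ :: _]/([:: inl x] ++ u) pi1_cat; exact: Pelt.
rewrite -[_ :: _]/([:: inr (e, b)] ++ u) pi1_cat; case: b; last exact: Pt.
by rewrite pi1_tV; exact: PtV.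
Qed.

Lemma pi1_hom_eq (H : groupType) (f g : G -> H) :
  {morph f : x y / x * y} -> {morph g : x y / x * y} ->
  (forall x, f (elt x) = g (elt x)) -> (forall e, f (t e) = g (t e)) -> f = g.
Proof.
move=> fM gM fge fgt; apply/funext; apply: pi1_ind => [|x w|e w|e w].
- by rewrite (gmorph1 fM) (gmorph1 gM).
- by rewrite fM gM fge => ->.
- by rewrite fM gM fgt => ->.
- by rewrite fM gM (gmorphV fM) (gmorphV gM) fgt => ->.
Qed.

Section Hom.
Variables (H : groupType) (a : X -> H) (s : T -> H).
Hypothesis aM : fibrewise_hom GG a.
Hypothesis a0 : forall x, a (bd GG false x) = a x.
Hypothesis a1 : forall x,
  a x = s (gproj GG x) * a (bd GG true x) * (s (gproj GG x))^-1.
Hypothesis s1 : forall e, vert Γ e \/ S e -> s e = 1.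

Let letter (l : X + T * bool) : H :=
  match l with
  | inl x => a x
  | inr (e, b) => if b then (s e)^-1 else s e
  end.

Let eval (w : pi1_word T X) : H := foldr (fun l h => letter l * h) 1 w.

Let eval_cat u v : eval (u ++ v) = eval u * eval v.
Proof. by elim: u => [|l u /= ->]; rewrite ?mul1g ?mulgA. Qed.

Let eval_eqv u v : pi1_eqv GG S u v -> eval u = eval v.
Proof.
elim=> [b c w w' ww'|//|w w' _ -> //|w w' w'' _ -> _ -> //].
rewrite !eval_cat; congr (_ * (_ * _)).
case: ww' => /= [x y xy|m|e i|x|x Vx|e eS]; rewrite ?mulg1.
- by rewrite aM.
- have := smul1 GG (sone GG m); rewrite gproj_sone => mm.
  by apply: (mulgI (a (sone GG m))); rewrite -aM // mm mulg1.
- by case: i; rewrite /= ?mulVg ?mulgV.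
- by rewrite a0.
- by rewrite a0 {1}a1 mulgA.
- exact: s1.
Qed.

Lemma pi1_hom : exists phi : G -> H, [/\ {morph phi : x y / x * y},
  forall x, phi (elt x) = a x & forall e, phi (t e) = s e].
Proof.
have E w : eval (generic_quotient.repr (cls w)) = eval w.
  exact/eval_eqv/pi1_reprP.
exists (fun g => eval (generic_quotient.repr g)); split=> [x y|x|e].
- by rewrite -eval_cat; exact: E.
- by rewrite /pi1_elt E /= mulg1.
- by rewrite /pi1_t E /= mulg1.
Qed.

End Hom.

(* The quotient of [G] by the vertex groups is free on the stable letters, hence
   a retract of [G]. *)
Lemma pi1_retraction : exists r : G -> G, [/\ {morph r : x y / x * y},
  forall x, r (elt x) = 1 & forall e, r (t e) = t e].
Proof.
apply: pi1_hom => [x y _|//|x|e].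
- by rewrite mul1g.
- by rewrite mulg1 mulgV.
- exact: pi1_t1.
Qed.

End Pi1Theory.

Arguments vertex_subgroup {T X Γ} GG S m _.

(** * The completed graph of groups *)

Section CompletedGraph.
Variables (T X : choiceType) (Γ : graph T) (GG : graph_of_groups X Γ).
Variable S : set T.
Local Notation G := (pi1 GG S).
Local Notation elt := (pi1_elt GG S).
Local Notation t := (pi1_t GG S).
Variables (K : topGroupType) (iota : G -> K) (tb : ultra T -> K).
Hypothesis iotaM : {morph iota : x y / x * y}.
Hypothesis profK : profinite_space K.
Hypothesis tb_cont : continuous tb.
Hypothesis tbE : forall e, tb (principal e) = iota (t e).

Definition near_subgroup (N : set K) : set T :=
  [set m | exists2 x, fibre GG m x & N (iota (elt x))].

(* The group over an ultrafilter is the limit of the closed subgroups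
   [closure (iota @` G(m))] along it. *)
Definition limit_group : set (ultra T * K) :=
  [set z | forall N, nbhs z.2 N -> uin z.1 (near_subgroup N)].

Lemma limit_group_principal m k :
  limit_group (principal m, k) <-> closure (iota @` vertex_subgroup GG S m) k.
Proof.
split=> [kW N /kW /principalE[x xm Nx]|kW N /kW[_ [[_ [x xm <-] <-] Nx]]].
  by exists (iota (elt x)); split=> //; exists (elt x) => //; exists x.
by apply/principalE; exists x.
Qed.

Lemma limit_group_elt x : limit_group (principal (gproj GG x), iota (elt x)).
Proof. by move=> N /nbhs_singleton Nx; apply/principalE; exists x. Qed.

Arguments limit_group_elt : clear implicits.

(** If the condition fails at (p, k), it fails through one [N], hence on the product of a basic
    clopen set around p with the interior of [N]. *)
Lemma limit_group_closed : closed limit_group.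
Proof.
rewrite -openC openE => -[p k] nW; apply: contrapT => nint; apply: nW => N kN.
apply: contrapT => /uinC pN; apply: nint.
rewrite /interior; exists ([set q | uin q (~` near_subgroup N)], N°).
  split; last exact: nbhs_interior.
  by exists (~` near_subgroup N).
by move=> [q l] [/= /uinC qN lN] /(_ N lN).
Qed.

Lemma limit_group_mul p k l : limit_group (p, k) -> limit_group (p, l) ->
  limit_group (p, k * l).
Proof.
move=> kW lW N /(@mulg_continuous K (k, l))[[A B] /= [kA lB] ABN].
apply: uinS (uinI (kW _ kA) (lW _ lB)) => m [[x xm Ax] [y ym By]].
exists (smul GG x y); first by rewrite /fibre /= gproj_smul // xm ym.
by rewrite pi1_eltM ?xm ?ym // iotaM; apply: (ABN (_, _)).
Qed.

Arguments limit_group_mul {p k l}.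

Lemma limit_group_one p : limit_group (p, 1).
Proof.
move=> N /nbhs_singleton N1; apply: uinS (uinT p) => m _.
by exists (sone GG m); [exact: gproj_sone | rewrite pi1_elt_one gmorph1].
Qed.

Arguments limit_group_one : clear implicits.

Lemma limit_group_inv p k : limit_group (p, k) -> limit_group (p, k^-1).
Proof.
move=> kW N /(@invg_continuous K k) kN; apply: uinS (kW _ kN) => m [x xm Nx].
exists (sinv GG x); first by rewrite /fibre /= gproj_sinv.
by rewrite pi1_elt_inv gmorphV.
Qed.

Arguments limit_group_inv {p k}.

Lemma limit_subgroup p : subgroup_set [set k | limit_group (p, k)].
Proof.
by split=> /= [|x y|x]; [exact: limit_group_one | apply: limit_group_mul | apply: limit_group_inv].
Qed.

Lemma tb_near p N : nbhs (tb p) N -> uin p [set m | N (iota (t m))].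
Proof.
move=> /tb_cont[A pA AN]; apply: uinS pA => m Am /=; rewrite -tbE.
by apply: AN; apply/principalE.
Qed.

Lemma tb1 p : uin p [set e | vert Γ e \/ S e] -> tb p = 1.
Proof.
have [_ hK _] := profK => pV; apply: hK => A B /tb_near pA /nbhs_singleton B1.
have [e [eV]] := uin_ex (uinI pV pA).
by rewrite /= pi1_t1 // gmorph1 // => A1; exists 1.
Qed.

Lemma tb1_vert p : uin p (vert Γ) -> tb p = 1.
Proof. by move=> pV; apply: tb1; apply: uinS pV => v; left. Qed.

Definition bd_map i p k := if i then (tb p)^-1 * k * tb p else k.

(** In G the map ∂_1 is conjugation by the stable letter; since conjugation is jointly continuous,
    this passes to the limit along p together with t_e, whose limit is [tb p]. *)
Lemma limit_group_bd i p k :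
  limit_group (p, k) -> limit_group (ultra_map (inc Γ i) p, bd_map i p k).
Proof.
case: i => kW N kN; rewrite ultra_mapE.
  have : nbhs (k, tb p) [set z : K * K | N (z.2^-1 * z.1 * z.2)].
    have := @continuousM (K * K)%type K (fun z => z.2^-1 * z.1) snd.
    move=> /(_ _ _ (k, tb p)); apply; last exact: kN; last by move=> z; exact: cvg_snd.
    apply: continuousM; last by move=> z; exact: cvg_fst.
    by apply: continuousV => z; exact: cvg_snd.
  move=> [[A B] /= [kA tB] ABN].
  apply: uinS (uinI (kW _ kA) (tb_near tB)) => m [[x xm Ax] Bm].
  exists (bd GG true x); first by rewrite /fibre /= gproj_bd xm.
  rewrite pi1_elt_bd1 xm !iotaM gmorphV //.
  by apply: (ABN (_, _)).
apply: uinS (kW _ kN) => m [x xm Nx].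
exists (bd GG false x); first by rewrite /fibre /= gproj_bd xm.
by rewrite pi1_elt_bd0.
Qed.

Arguments limit_group_bd i {p k}.

Definition cspace : Type := set_type limit_group.
HB.instance Definition _ := Topological.on cspace.

Definition cspace_mk p k (pk : limit_group (p, k)) : cspace :=
  exist _ (p, k) (mem_set pk).
Definition cbase (x : cspace) : ultra T := (set_val x).1.
Definition ceta (x : cspace) : K := (set_val x).2.

Lemma cspaceP x : limit_group (cbase x, ceta x).
Proof. by rewrite -surjective_pairing; exact: set_valP. Qed.

Arguments cspaceP : clear implicits.

Lemma cspace_eq x y : cbase x = cbase y -> ceta x = ceta y -> x = y.
Proof.
move=> xy1 xy2; apply: val_inj; rewrite [LHS]surjective_pairing.
by rewrite [RHS]surjective_pairing; congr pair.
Qed.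

Lemma cbase_continuous : continuous cbase.
Proof. by move=> x; apply: continuous_comp; [exact: set_val_continuous | exact: cvg_fst]. Qed.

Lemma ceta_continuous : continuous ceta.
Proof. by move=> x; apply: continuous_comp; [exact: set_val_continuous | exact: cvg_snd]. Qed.

Lemma cspace_continuous (Y : topologicalType) (f : Y -> cspace) :
  continuous (cbase \o f) -> continuous (ceta \o f) -> continuous f.
Proof.
move=> c1 c2; apply: set_type_continuous => y.
have -> : (fun z => val (f z)) = (fun z => (cbase (f z), ceta (f z))).
  by apply/funext => z; rewrite [LHS]surjective_pairing.
exact: cvg_pair (c1 y) (c2 y).
Qed.

Lemma cspace_profinite : profinite_space cspace.
Proof.
apply: set_type_profinite limit_group_closed.
by apply: profinite_prod => //; exact: ultra_profinite.
Qed.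

(** A sheaf requires a total operation. Off the fibred product the value [x] is chosen, so that
    [cbase_mul] holds unconditionally. *)
Definition cmul (x y : cspace) : cspace :=
  match pselect (cbase y = cbase x) with
  | left e => cspace_mk (limit_group_mul (cspaceP x)
      (eq_ind _ (fun p => limit_group (p, ceta y)) (cspaceP y) _ e))
  | right _ => x
  end.
Definition cone p : cspace := cspace_mk (limit_group_one p).
Definition cinv x : cspace := cspace_mk (limit_group_inv (cspaceP x)).
Definition cbd i x : cspace := cspace_mk (limit_group_bd i (cspaceP x)).

Lemma cbase_mul x y : cbase (cmul x y) = cbase x.
Proof. by rewrite /cmul; case: pselect. Qed.

Lemma ceta_mul x y : cbase x = cbase y -> ceta (cmul x y) = ceta x * ceta y.
Proof. by move=> xy; rewrite /cmul; case: pselect => // /(_ (esym xy)). Qed.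

Lemma cmulA x y z : cbase x = cbase y -> cbase y = cbase z ->
  cmul x (cmul y z) = cmul (cmul x y) z.
Proof.
move=> xy yz; apply: cspace_eq; first by rewrite !cbase_mul.
by rewrite !ceta_mul ?cbase_mul ?mulgA ?xy.
Qed.

Lemma cmul1 x : cmul (cone (cbase x)) x = x.
Proof.
apply: cspace_eq; first by rewrite cbase_mul.
by rewrite ceta_mul //= mul1g.
Qed.

Lemma cmulV x : cmul (cinv x) x = cone (cbase x).
Proof.
apply: cspace_eq; first by rewrite cbase_mul.
by rewrite ceta_mul //= mulVg.
Qed.

Definition csheaf : group_sheaf (ultra T) cspace :=
  GroupSheaf (fun x y _ => cbase_mul x y) (fun p => erefl : cbase (cone p) = p)
    (fun x => erefl : cbase (cinv x) = cbase x) cmulA cmul1 cmulV.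

Lemma cbd_vert i x : vert (ultra_graph Γ) (cbase x) -> cbd i x = x.
Proof.
move=> Vx; apply: cspace_eq; first exact: (ultra_inc_id i Vx).
rewrite /ceta /= /bd_map; case: i => //.
by rewrite tb1_vert // invg1 mul1g mulg1.
Qed.

Lemma bd_mapM i p : {morph bd_map i p : x y / x * y}.
Proof. by case: i => x y //=; rewrite !mulgA mulgK. Qed.

Lemma bd_map_inj i p : injective (bd_map i p).
Proof. by case: i => x y //= /mulIg/mulgI. Qed.

Lemma cbdM i x y : cbase x = cbase y -> cbd i (cmul x y) = cmul (cbd i x) (cbd i y).
Proof.
move=> xy; have b : cbase (cbd i x) = cbase (cbd i y).
  by rewrite /cbase /= -/(cbase x) xy.
apply: cspace_eq; first by rewrite cbase_mul /cbase /= -!/(cbase _) cbase_mul.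
rewrite ceta_mul // /ceta /= -!/(cbase _) -!/(ceta _) cbase_mul ceta_mul //.
by rewrite bd_mapM xy.
Qed.

Lemma cbd_inj i x y : cbase x = cbase y -> cbd i x = cbd i y -> x = y.
Proof.
move=> xy e; apply: cspace_eq => //.
have := congr1 ceta e; rewrite /ceta /= -!/(cbase _) -!/(ceta _) xy.
exact: bd_map_inj.
Qed.

Definition cgog : graph_of_groups cspace (ultra_graph Γ) :=
  GraphOfGroups (gog_sheaf := csheaf)
    (fun i x => erefl : cbase (cbd i x) = inc (ultra_graph Γ) i (cbase x))
    cbd_vert cbdM cbd_inj.

Lemma cgog_pro_C C : extension_closed_variety C -> connected_graph Γ ->
  pro_C C K -> pro_C_graph_of_groups C cgog.
Proof.
move=> hC cΓ pK; split.
- exact: ultra_graph_profinite.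
- exact: ultra_graph_connected.
- exact: cspace_profinite.
- exact: cbase_continuous.
- apply/subspace_continuousP => z zA N /set_type_nbhs[D Dz DN].
  (* Unlike the division itself, [g] is continuous on the whole product, and the two agree on the
     fibred product. *)
  pose g (z : cspace * cspace) := (cbase z.1, ceta z.1 * (ceta z.2)^-1).
  have gE w : cbase w.1 = cbase w.2 -> val (cmul w.1 (cinv w.2)) = g w.
    by move=> e; rewrite [LHS]surjective_pairing -/(ceta _) ceta_mul // -/(cbase _) cbase_mul.
  have cg : continuous g.
    have c1 : continuous (fun w : cspace * cspace => ceta w.1).
      by move=> w; apply: continuous_comp; [exact: cvg_fst | exact: ceta_continuous].
    have c2 : continuous (fun w : cspace * cspace => ceta w.2).
      by move=> w; apply: continuous_comp; [exact: cvg_snd | exact: ceta_continuous].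
    have c3 : continuous (fun w : cspace * cspace => cbase w.1).
      by move=> w; apply: continuous_comp; [exact: cvg_fst | exact: cbase_continuous].
    exact: continuous_pair c3 (continuousM c1 (continuousV c2)).
  have : nbhs z (g @^-1` D) by apply: cg; rewrite -gE.
  by apply: filterS => w Dw wA; apply: DN; rewrite gE.
- move=> i; apply: cspace_continuous.
    move=> x; apply: (@continuous_comp _ _ _ cbase (ultra_map (inc Γ i))).
      exact: cbase_continuous.
    exact: ultra_map_continuous.
  case: i => /=; last exact: ceta_continuous.
  have ctb : continuous (tb \o cbase).
    by move=> x; apply: continuous_comp; [exact: cbase_continuous | exact: tb_cont].
  apply: continuousM => //; apply: continuousM; last exact: ceta_continuous.
  exact: continuousV.
move=> p; have closed_p : closed [set k | limit_group (p, k)].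
  have cp := @continuous_pairl K _ p.
  exact: (iffLR (continuous_closedP _) cp) _ limit_group_closed.
exists (csub (limit_subgroup p)), (fun k => cspace_mk (csub_valP k)); split.
- exact: csub_pro_C.
- apply: cspace_continuous; first exact: cst_continuous.
  exact: csub_val_continuous.
- split=> [k _ //|k l _ _ /(congr1 ceta) e|x px].
    exact: csub_val_inj.
  have xW : [set k | limit_group (p, k)] (ceta x) by rewrite /= -px; exact: cspaceP.
  by exists (csub_mk (limit_subgroup p) xW) => //; apply: cspace_eq.
by move=> k l; apply: cspace_eq; rewrite ?cbase_mul ?ceta_mul.
Qed.

Definition cembed x : cspace := cspace_mk (limit_group_elt x).

(** The definition of [limit_group] says exactly that near a point over p there are elements of G(m)
    for p-almost all m. *)
Lemma cembed_dense : dense (range cembed).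
Proof.
move=> O [x Ox] oO; have : nbhs x O by exact: open_nbhs_nbhs.
move=> /set_type_nbhs[D [[A B] /= [[A' xA' A'A] xB] ABD] DO].
have [m [A'm [y ym By]]] := uin_ex (uinI xA' (cspaceP x _ xB)).
exists (cembed y); split; last by exists y.
apply: DO; apply: ABD; split=> //=; apply: A'A; apply/principalE.
by rewrite ym.
Qed.

Lemma cembedM : forall x y, gproj GG x = gproj GG y ->
  cembed (smul GG x y) = cmul (cembed x) (cembed y).
Proof.
move=> x y xy; have b : cbase (cembed x) = cbase (cembed y) by rewrite /cbase /= xy.
apply: cspace_eq; first by rewrite cbase_mul /cbase /= gproj_smul.
by rewrite ceta_mul // /ceta /= pi1_eltM // iotaM.
Qed.

Lemma cembed_bd i x : cembed (bd GG i x) = cbd i (cembed x).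
Proof.
apply: cspace_eq; rewrite /cbase /ceta /= ?ultra_map_principal ?gproj_bd //.
case: i => /=; last by rewrite pi1_elt_bd0.
by rewrite tbE pi1_elt_bd1 !iotaM gmorphV.
Qed.

Lemma cembed_eq x y : fibre csheaf (principal (gproj GG x)) y ->
  ceta y = iota (elt x) -> y = cembed x.
Proof. by move=> xy e; apply: cspace_eq. Qed.

Lemma ceta_bij m : set_bij (fibre csheaf (principal m))
  (closure (iota @` vertex_subgroup GG S m)) ceta.
Proof.
split=> [x xm|x y /set_mem xm /set_mem ym|k /limit_group_principal km].
- by apply/limit_group_principal; rewrite -xm; exact: cspaceP.
- by apply: cspace_eq; rewrite [LHS]xm [RHS]ym.
- by exists (cspace_mk km).
Qed.

End CompletedGraph.

(** * Voltage coverings *)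

Section VoltageCovering.
Variables (C : finGroupType -> Prop) (T : topologicalType) (H : topGroupType).
Variables (Γ : graph T) (t : T -> H).
Hypothesis t1 : forall v, vert Γ v -> t v = 1.

(** The derived graph of the voltage [t]: voltages multiply on the right, so that they commute with
    the left action of [H]. *)
Definition voltage_inc i (z : T * H) : T * H :=
  (inc Γ i z.1, if i then z.2 * t z.1 else z.2).

Definition voltage_vert : set (T * H) := [set z | vert Γ z.1].

Lemma voltage_vert_nonempty : voltage_vert !=set0.
Proof. by have [v Vv] := vert_nonempty Γ; exists (v, 1). Qed.

Lemma voltage_inc_vert i z : voltage_vert (voltage_inc i z).
Proof. exact: inc_vert. Qed.

Lemma voltage_inc_id i z : voltage_vert z -> voltage_inc i z = z.
Proof.
case: z => v h Vv; rewrite /voltage_inc /= inc_id //.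
by case: i; rewrite // t1 // mulg1.
Qed.

Definition voltage_graph : graph (T * H)%type :=
  Graph voltage_vert_nonempty voltage_inc_vert voltage_inc_id.

Definition voltage_act (h : H) (z : T * H) : T * H := (z.1, h * z.2).

Lemma voltage_galois : profinite_graph Γ -> pro_C C H -> continuous t ->
  galois_covering C Γ voltage_graph voltage_act fst.
Proof.
move=> [pT cV cinc] pH ct.
have c1 : continuous (fst : T * H -> T) by move=> z; exact: cvg_fst.
have c2 : continuous (snd : T * H -> H) by move=> z; exact: cvg_snd.
split=> //.
- split.
  + exact: profinite_prod (pro_C_profinite pH).
  + exact: (iffLR (continuous_closedP _) c1).
  + move=> i; apply: continuous_pair.
      by move=> z; apply: continuous_comp; [exact: c1 | exact: cinc].
    case: i => //; apply: continuousM => // z.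
    by apply: continuous_comp; [exact: c1 | exact: ct].
- by move=> [m h]; rewrite /voltage_act /= mul1g.
- by move=> a b [m h]; rewrite /voltage_act /= mulgA.
- apply: continuous_pair.
    by move=> z; apply: continuous_comp; [exact: cvg_snd | exact: c1].
  apply: continuousM => z; first exact: cvg_fst.
  by apply: continuous_comp; [exact: cvg_snd | exact: c2].
- by move=> [] a [m h]; rewrite /= /voltage_inc /voltage_act /= ?mulgA.
- by move=> a [m h] [] /(congr1 (fun x => x * h^-1)); rewrite mulgK mulgV.
- by move=> m; exists (m, 1).
- move=> [m h] [m' h']; split=> [/= <-|[a [<- _]] //].
  by exists (h' * h^-1); rewrite /voltage_act /= mulgVK.
Qed.

End VoltageCovering.

Lemma loc_const_finfun (Y : topologicalType) (I : finType) (D : Type)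
    (f : Y -> I -> D) :
  (forall i, loc_const (f^~ i)) -> loc_const (fun y => finfun (f y)).
Proof.
move=> lf x; have fs (s : seq I) : nbhs x [set y | forall i, i \in s -> f y i = f x i].
  elim: s => [|i s IHs]; first by apply: filterS filterT.
  apply: filterS2 IHs (lf i x) => y ys yi j; rewrite inE => /predU1P[->//|].
  exact: ys.
apply: filterS (fs (enum I)) => y yx; apply/ffunP => i.
by rewrite !ffunE yx // mem_enum.
Qed.

(** * Splitting voltages over simply connected graphs *)

(** Equivalently, x |-> (x, u x) is a morphism to the voltage covering, that is, a section of it. *)
Definition splitting (L : Type) (Λ : graph L) (H : groupType) (t u : L -> H) :=
  forall i x, u (inc Λ i x) = u x * (if i then t x else 1).

Section Splitting.
Variable C : finGroupType -> Prop.
Hypothesis hC : extension_closed_variety C.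
Variables (L : topologicalType) (Λ : graph L).
Hypothesis profΛ : profinite_graph Λ.
Hypothesis connΛ : profinite_connected Λ.
Hypothesis simplyΛ : forall (L' : topologicalType) (Λ' : graph L')
    (B : topGroupType) (act : B -> L' -> L') (zeta : L' -> L),
  galois_covering C Λ Λ' act zeta -> profinite_connected Λ' ->
  forall b : B, b = 1.

(** The ratio of two splittings is invariant under d_0 and d_1. Composing with [g] allows to argue
    in one finite quotient of [H] at a time. *)
Lemma splitting_const (H : groupType) (D : Type) (g : H -> D) (t u v : L -> H) :
  splitting Λ t u -> splitting Λ t v ->
  loc_const (fun x => g (u x * (v x)^-1)) ->
  forall x y, g (u x * (v x)^-1) = g (u y * (v y)^-1).
Proof.
move=> su sv lg; apply: profinite_connected_const connΛ lg _ => i x.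
by rewrite su sv invgM mulgA mulgK.
Qed.

Section Reduction.
Variables (Q : finGroupType) (t : L -> Q).
Hypothesis lt : loc_const t.
Hypothesis t1 : forall v, vert Λ v -> t v = 1.

(* A disconnected voltage covering reduces the voltage to the stabiliser, under
   right translation, of a fibre [Y] of one piece of the covering. *)
Lemma voltage_reduction :
  ~ (forall f : L * discrete_group Q -> bool, loc_const f ->
      (forall i z, f (voltage_inc Λ (t : L -> discrete_group Q) i z) = f z) ->
      forall x y, f x = f y) ->
  exists (St : {group Q}) (w : L -> Q), [/\ (#|St| < #|Q|)%N, loc_const w,
    forall x, w (inc Λ false x) = w x
    & forall x, w x * t x * (w (inc Λ true x))^-1 \in St].
Proof.
move=> /existsNP[f /not_implyP[lf /not_implyP[fi nf]]].
pose Z x : {set Q} := finset (fun h : Q => f (x, h)).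
have lZ : loc_const Z.
  have lF : loc_const (fun x => finfun (fun h : Q => f (x, h))).
    apply: loc_const_finfun => h; apply: loc_const_comp lf.
    exact: continuous_pairr.
  have -> : Z = (fun F : {ffun Q -> bool} => finset F) \o
      (fun x => finfun (fun h : Q => f (x, h))).
    by apply/funext => x; apply/setP => h; rewrite !inE ffunE.
  exact: loc_const_post.
have Z0 x : Z (inc Λ false x) = Z x.
  by apply/setP => h; rewrite !inE -(fi false (x, h)).
have Z1 x : Z (inc Λ true x) = Z x :* t x.
  apply/setP => h; rewrite mem_rcoset !inE -(fi true (x, h * (t x)^-1)).
  by rewrite /voltage_inc /= mulgVK.
have [[x1 h1] [[x2 h2] [fx1 fx2]]] : exists x y, f x /\ ~~ f y.
  apply: contrapT => h; apply: nf => x y.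
  case fx: (f x); case fy: (f y) => //; exfalso; apply: h.
    by exists x, y; rewrite fx fy.
  by exists y, x; rewrite fx fy.
pose Y := Z x1.
(* Being a right translate of [Y] is a locally constant property of the fibre that d_0 and d_1
   preserve in both directions, so it holds everywhere. *)
have ZY x : exists w, Z x == Y :* w.
  pose P (A : {set Q}) := [exists w, A == Y :* w].
  apply/existsP; rewrite -[X in is_true X]/(P (Z x)).
  rewrite (profinite_connected_const connΛ (f := fun x => P (Z x)) _ _ x x1).
  - by apply/existsP; exists 1; rewrite rcoset1.
  - exact: loc_const_post lZ.
  - case=> y; last by rewrite Z0.
    rewrite Z1; apply/existsP/existsP => -[w /eqP e].
      by exists (w * (t y)^-1); rewrite rcosetM -e rcosetK.
    by exists (w * t y); rewrite e rcosetM.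
(* The translating element is chosen as a function of the set alone, hence it is locally constant
   and agrees at x and d_0(x). *)
pose pw (A : {set Q}) := odflt 1 [pick w | A == Y :* w].
pose w x := pw (Z x).
have wP x : Z x = Y :* w x.
  rewrite /w /pw; case: pickP => [y /eqP //|h].
  by have [v] := ZY x; rewrite h.
have St_group : group_set [set s | Y :* s == Y].
  apply/group_setP; split; first by rewrite inE rcoset1.
  by move=> x y; rewrite !inE rcosetM => /eqP -> /eqP ->.
exists (group St_group), w; split=> //.
(* If all of [Q] stabilised the non-empty [Y], then [Y] and its translate [Z x2] would be all of
   [Q], but [h2] is not in [Z x2]. *)
- rewrite -cardsT; apply: proper_card; apply/andP; split; first exact: finset.subsetT.
  apply/negP => /fintype.subsetP sub.
  have Yall y s : y \in Y -> s \in Y.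
    move=> yY; have := sub (y^-1 * s) (finset.in_setT _); rewrite inE => /eqP <-.
    by rewrite mem_rcoset invgM invgK mulKVg.
  have h1Y : h1 \in Y by rewrite inE.
  have : h2 \in Z x2 by rewrite wP mem_rcoset; exact: Yall h1Y.
  by rewrite inE; apply/negP.
- exact: (loc_const_post pw lZ).
- by move=> x; rewrite /w Z0.
move=> x; rewrite inE; apply/eqP; rewrite !rcosetM -wP -Z1 wP.
exact: rcosetK.
Qed.

End Reduction.

(** Induction on the order of [Q]: twisting by [w] moves the voltage into the smaller group [St],
    and a splitting there, multiplied by [w], splits [t]. *)
Lemma finite_splitting (Q : finGroupType) (t : L -> Q) :
  C Q -> loc_const t -> (forall v, vert Λ v -> t v = 1) ->
  exists u : L -> Q, loc_const u /\ splitting Λ t u.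
Proof.
have [n] := ubnP #|Q|; elim: n Q t => // n IHn Q t Qn CQ lt t1.
have [conn|disc] := pselect (forall f : L * discrete_group Q -> bool,
    loc_const f ->
    (forall i z, f (voltage_inc Λ (t : L -> discrete_group Q) i z) = f z) ->
    forall x y, f x = f y).
  have Q1 (q : Q) : q = 1.
    have ct : continuous (t : L -> discrete_group Q) by exact: continuous_loc_const.
    have gal := @voltage_galois C L (discrete_group Q) Λ t t1 profΛ
      (discrete_pro_C CQ) ct.
    have conn' := @profinite_connectedP _ (voltage_graph t1 (H := discrete_group Q)) conn.
    have h := simplyΛ gal conn'.
    exact: h.
  exists (fun _ => 1); split; first exact: loc_const_cst.
  by move=> i x; rewrite mul1g; case: i; rewrite // (Q1 (t x)).
have [St [w [Stn lw w0 w1]]] := voltage_reduction disc.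
pose t' x := subg St (w x * t x * (w (inc Λ true x))^-1).
have lw1 : loc_const (w \o inc Λ true).
  by apply: loc_const_comp lw; have [_ _] := profΛ; apply.
have [||||u [lu su]] := IHn (subg_of St) t'.
- by rewrite card_sub; exact: leq_trans Stn _.
- exact: ext_subgroup.
- apply: (loc_const_post (subg St)).
  apply: (loc_const2 (fun a b => a * b^-1) _ lw1).
  exact: (loc_const2 (fun a b => a * b)).
- by move=> v Vv; rewrite /t' t1 // inc_id // mulg1 mulgV; apply: val_inj; rewrite /= subgK.
exists (fun x => sgval (u x) * w x); split.
  by apply: (loc_const2 (fun a b => sgval a * b)).
move=> i x; rewrite su; case: i; last by rewrite !mulg1 w0.
by rewrite /= subgK // -!mulgA mulVg mulg1.
Qed.

(** Splittings in the finite quotients become unique, hence compatible, once they are normalised to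
    be 1 at [x0]. *)
Lemma pro_C_splitting (H : topGroupType) (t : L -> H) :
  pro_C C H -> continuous t -> (forall v, vert Λ v -> t v = 1) ->
  exists u : L -> H, continuous u /\ splitting Λ t u.
Proof.
move=> [I [le [Q [f [p [CQ limH]]]]]] ct t1; have [x0 _] := vert_nonempty Λ.
have uex i : exists u : L -> Q i, [/\ loc_const u, splitting Λ (p i \o t) u & u x0 = 1].
  have [|||u [lu su]] := @finite_splitting (Q i) (p i \o t).
  - exact: CQ.
  - by apply: loc_const_comp ct _; exact: lim_loc_const limH i.
  - by move=> v Vv; rewrite /= t1 // gmorph1 //; exact: limM limH i.
  exists (fun x => (u x0)^-1 * u x); split; last by rewrite mulVg.
    exact: (loc_const_post (fun a => (u x0)^-1 * a)).
  by move=> i' x; rewrite su mulgA.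
pose u i := sval (cid (uex i)).
have uP i : [/\ loc_const (u i), splitting Λ (p i \o t) (u i) & u i x0 = 1].
  by rewrite /u; case: cid.
have [[_ _ _ fM _] _ pf _ _] := limH.
have [|F FE] := lim_lift limH (y := u).
  move=> i j x ij; have [li si ui] := uP i; have [lj sj uj] := uP j.
  have sf : splitting Λ (p i \o t) (f i j \o u j).
    move=> b y; rewrite /= sj fM //; congr (_ * _).
    by case: b; rewrite /= ?pf // gmorph1 //; exact: fM.
  have := splitting_const (g := id) sf si _ x x0.
  rewrite /= ui uj invg1 mulg1 (gmorph1 (fM _ _ ij)) => h.
  apply/divg1_eq/h.
  apply: (loc_const2 (fun a b => a * b^-1)) => //.
  exact: (loc_const_post (f i j)).
exists F; split.
  apply: (lim_continuous limH) => i.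
  by have -> : p i \o F = u i by [apply/funext => x; exact: FE]; case: (uP i).
move=> b x; apply: (lim_inj limH) => i; rewrite (limM limH) !FE.
have [_ -> _] := uP i; congr (_ * _).
by case: b => //=; rewrite gmorph1 //; exact: limM limH i.
Qed.

Lemma splitting_unique (H : topGroupType) (t u v : L -> H) :
  pro_C C H -> continuous u -> continuous v ->
  splitting Λ t u -> splitting Λ t v ->
  forall x y, u x * (v x)^-1 = u y * (v y)^-1.
Proof.
move=> [I [le [Q [f [p [_ limH]]]]]] cu cv su sv x y.
apply: (lim_inj limH) => i; apply: splitting_const su sv _ x y.
apply: (@loc_const_comp _ _ _ (fun x => u x * (v x)^-1) (p i)).
  by apply: continuousM => //; exact: continuousV.
exact: lim_loc_const limH i.
Qed.

End Splitting.

(** * Universal coverings *)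

Section UniversalCovering.
Variable C : finGroupType -> Prop.
Hypothesis hC : extension_closed_variety C.
Variables (T : topologicalType) (Γ : graph T) (profΓ : profinite_graph Γ).
Variables (U : universal_covering C Γ) (J : zero_section U).
Local Notation A := (uc_group U).
Local Notation L := (uc_space U).
Local Notation Λ := (uc_graph U).
Local Notation act := (@uc_act C T Γ U).
Local Notation zeta := (@uc_map C T Γ U).
Local Notation j := (@zs_j C T Γ U J).
Local Notation chi := (@zs_chi C T Γ U J).
Let gal := uc_galois U.

Lemma uc_act_inj a b x : act a x = act b x -> a = b.
Proof.
move=> e; have h : b^-1 * a = 1.
  apply: (gc_free gal (x := x)); rewrite (gc_actM gal) e -(gc_actM gal) mulVg.
  exact: gc_act1 gal x.
by rewrite -[a](mulKVg b) h mulg1.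
Qed.

(** The section trivialises the covering space: (b, m) |-> b j(m) is a continuous bijection from a
    compact space, and [a] is the first coordinate of its inverse. *)
Lemma uc_coordinate : exists a : L -> A,
  continuous a /\ forall x, act (a x) (j (zeta x)) = x.
Proof.
have /choice[a aP] : forall x, exists b, act b (j (zeta x)) = x.
  by move=> x; apply/(gc_orbits gal); rewrite zs_section.
exists a; split=> //; have pA := gc_group gal.
have [I [le [Q [f [p [_ limA]]]]]] := pA.
apply: (lim_continuous limA) => i.
have [[cT _ _] _ _] := profΓ.
have [[cA _ _] [[_ hL _] _ _]] := (pro_C_profinite pA, gc_graph gal).
apply: (@loc_const_descent (A * T)%type L _ (fun z => act z.1 (j z.2))).
- by rewrite -setXTT; exact: compact_setX.
- exact: hL.
- have c : continuous (fun z : A * T => (z.1, j z.2)).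
    apply: continuous_pair => z; first exact: cvg_fst.
    by apply: continuous_comp; [exact: cvg_snd | exact: zs_continuous].
  move=> z; exact: (continuous_comp (c z) (@gc_act_continuous _ _ _ _ _ _ _ _ gal _)).
- by move=> x; exists (a x, zeta x); exact: aP.
have -> : (p i \o a) \o (fun z : A * T => act z.1 (j z.2)) = p i \o fst.
  apply/funext => -[b m] /=; congr (p i _); apply: (@uc_act_inj _ _ (j m)).
  rewrite -[RHS]aP; congr (act _ (j _)).
  have <- : zeta (j m) = zeta (act b (j m)) by apply/(gc_orbits gal); exists b.
  by rewrite zs_section.
apply: loc_const_comp; last exact: lim_loc_const limA i.
by move=> z; exact: cvg_fst.
Qed.

(** In these coordinates the covering is the voltage covering of χ, and [a] splits the pullback of χ
    to it. *)
Lemma uc_coordinate_inc (a : L -> A) :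
  (forall x, act (a x) (j (zeta x)) = x) ->
  forall i x, a (inc Λ i x) = a x * (if i then chi (zeta x) else 1).
Proof.
move=> aP i x; apply: (@uc_act_inj _ _ (j (zeta (inc Λ i x)))).
rewrite aP (gc_morphism gal) -{1}(aP x) (gc_act_inc gal); case: i.
  by rewrite (gc_actM gal) zs_chiP.
by rewrite mulg1 -zs_inc0.
Qed.

Lemma uc_coordinate_j (a : L -> A) :
  (forall x, act (a x) (j (zeta x)) = x) ->
  forall b m, a (act b (j m)) = b.
Proof.
move=> aP b m; apply: (@uc_act_inj _ _ (j m)).
have zE : zeta (act b (j m)) = m.
  rewrite -[RHS](zs_section J); apply/esym/(gc_orbits gal); by exists b.
by rewrite -{2}(aP (act b (j m))) zE.
Qed.

Lemma chi_continuous : continuous chi.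
Proof.
have [a [ca aP]] := uc_coordinate.
have -> : chi = a \o inc Λ true \o j.
  apply/funext => m /=; rewrite -zs_chiP.
  by rewrite (uc_coordinate_j aP).
have [_ _ cinc] := gc_graph gal.
move=> m; apply: continuous_comp; first exact: zs_continuous.
by apply: continuous_comp; [exact: cinc | exact: ca].
Qed.

Lemma chi1 v : vert Γ v -> chi v = 1.
Proof.
move=> Vv; apply: (gc_free gal (x := j v)).
have Vj : vert Λ (j v) by rewrite -(inc_id false Vv) zs_inc0; exact: inc_vert.
by have := zs_chiP J v; rewrite (inc_id true Vv) (inc_id true Vj).
Qed.

Section Lift.
Variables (H : topGroupType) (pH : pro_C C H).

(** Every voltage on the base is cohomologous to one induced from χ by a homomorphism. If [u] splits
    the pullback of [t], then so does its translate by b, which differs from [u] by a constant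
    [phi b]; [gamma] is [u] along the section. *)
Lemma uc_lift (t : T -> H) :
  continuous t -> (forall v, vert Γ v -> t v = 1) ->
  exists (gamma : T -> H) (phi : A -> H), [/\ continuous gamma,
    forall m, gamma (inc Γ false m) = gamma m,
    continuous phi, {morph phi : x y / x * y}
  & forall m, phi (chi m) = gamma m * t m * (gamma (inc Γ true m))^-1].
Proof.
move=> ct t1.
have [||u [cu su]] := pro_C_splitting hC (gc_graph gal) (@uc_connected _ _ _ U)
  (@uc_simply_connected _ _ _ U) pH (t := t \o zeta).
- by move=> x; apply: continuous_comp; [exact: gc_continuous gal x | exact: ct].
- move=> v Vv; apply: t1; rewrite -(inc_id false Vv) (gc_morphism gal).
  exact: inc_vert.
have cact b : continuous (act b).
  have c := @continuous_pairl L A b.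
  move=> x; exact: (@continuous_comp _ _ _ (pair b) (fun z : A * L => act z.1 z.2)
    x (c x) (@gc_act_continuous _ _ _ _ _ _ _ _ gal (b, x))).
have cacti x : continuous (act^~ x).
  have c := @continuous_pairr A L x.
  move=> b; exact: (@continuous_comp _ _ _ (pair^~ x) (fun z : A * L => act z.1 z.2)
    b (c b) (@gc_act_continuous _ _ _ _ _ _ _ _ gal (b, x))).
have zact b x : zeta (act b x) = zeta x.
  by apply/esym/(gc_orbits gal); exists b.
have [x0 _] := vert_nonempty Λ.
pose phi b := u (act b x0) * (u x0)^-1.
have phiP b x : u (act b x) = phi b * u x.
  have sb : splitting Λ (t \o zeta) (u \o act b).
    by move=> i y; rewrite /= -(gc_act_inc gal) su /= zact.
  have cub : continuous (u \o act b).
    by move=> y; apply: continuous_comp; [exact: cact | exact: cu].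
  rewrite /phi -(splitting_unique (@uc_connected _ _ _ U) pH cub cu sb su x x0) /=.
  by rewrite mulgVK.
exists (u \o j), phi; split.
- by move=> m; apply: continuous_comp; [exact: zs_continuous | exact: cu].
- by move=> m; rewrite /= zs_inc0 su mulg1.
- apply: continuousM; last exact: cst_continuous.
  by move=> b; apply: continuous_comp; [exact: cacti | exact: cu].
- by move=> b c; rewrite /phi (gc_actM gal) !phiP -mulgA mulgK mulgK.
move=> m; apply: (mulIg (u (j (inc Γ true m)))).
by rewrite -phiP zs_chiP su /= zs_section mulgVK.
Qed.

(** The homomorphism of [uc_lift] is unique up to conjugation: x |-> phi(a x) and x |-> psi(a x) g(ζ
    x) split the same voltage, so their ratio is a constant h. *)
Lemma uc_unique (phi psi : A -> H) (g : T -> H) :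
  continuous phi -> continuous psi -> continuous g ->
  {morph phi : x y / x * y} -> {morph psi : x y / x * y} ->
  (forall m, g (inc Γ false m) = g m) ->
  (forall m, psi (chi m) * g (inc Γ true m) = g m * phi (chi m)) ->
  exists h, (forall m, g m = h) /\ (forall b, psi b = h * phi b * h^-1).
Proof.
move=> cphi cpsi cg phiM psiM g0 g1.
have [a [ca aP]] := uc_coordinate; have aI := uc_coordinate_inc aP.
have zI i x : zeta (inc Λ i x) = inc Γ i (zeta x) by rewrite (gc_morphism gal).
pose u x := psi (a x) * g (zeta x); pose v x := phi (a x).
have sv : splitting Λ (phi \o chi \o zeta) v.
  by move=> i x; rewrite /v aI phiM; case: i; rewrite //= (gmorph1 phiM).
have su : splitting Λ (phi \o chi \o zeta) u.
  move=> i x; rewrite /u aI zI psiM; case: i; rewrite -!mulgA; congr (_ * _).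
    exact: g1.
  by rewrite (gmorph1 psiM) g0 mul1g mulg1.
have cv : continuous v by move=> x; apply: continuous_comp; [exact: ca | exact: cphi].
have cu : continuous u.
  apply: continuousM; first by move=> x; apply: continuous_comp; [exact: ca | exact: cpsi].
  by move=> x; apply: continuous_comp; [exact: gc_continuous gal x | exact: cg].
have uv := splitting_unique (@uc_connected _ _ _ U) pH cu cv su sv.
have [m0 _] := vert_nonempty Γ.
have uvE b m : psi b * g m * (phi b)^-1 = g m0.
  have := uv (act b (j m)) (j m0).
  have aj m' : a (j m') = 1 by rewrite -(gc_act1 gal (j m')) uc_coordinate_j.
  have zE : zeta (act b (j m)) = m.
    by rewrite -[RHS](zs_section J); apply/esym/(gc_orbits gal); exists b.
  rewrite /u /v uc_coordinate_j // zE aj zs_section.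
  by rewrite (gmorph1 psiM) (gmorph1 phiM) mul1g invg1 mulg1.
have gE m : g m = g m0.
  by rewrite -(uvE 1 m) (gmorph1 psiM) (gmorph1 phiM) mul1g invg1 mulg1.
exists (g m0); split=> // b.
by rewrite -{1}(uvE b m0) mulgVK mulgK.
Qed.

End Lift.

End UniversalCovering.

(** * Equivariant maps to finite groups *)

Section EquivariantMap.
Variables (B : topGroupType) (L : topologicalType) (act : B -> L -> L).
Hypothesis profB : profinite_space B.
Hypothesis profL : profinite_space L.
Hypothesis act1 : forall x, act 1 x = x.
Hypothesis actM : forall a b x, act (a * b) x = act a (act b x).
Hypothesis act_cont : continuous (fun z : B * L => act z.1 z.2).
Hypothesis free : forall a x, act a x = x -> a = 1.
Variables (Q : finGroupType) (q : B -> Q).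
Hypothesis lq : loc_const q.
Hypothesis qM : {morph q : x y / x * y}.

Lemma act_continuous b : continuous (act b).
Proof.
move=> x A Ax; have Az : nbhs (b, x) ((fun z : B * L => act z.1 z.2) @^-1` A).
  exact: act_cont.
exact: (@continuous_pairl L B b x _ Az).
Qed.

Lemma actK b x : act b^-1 (act b x) = x.
Proof. by rewrite -actM mulVg act1. Qed.

Lemma actKV b x : act b (act b^-1 x) = x.
Proof. by rewrite -actM mulgV act1. Qed.

(** The b with [q b <> 1] form a compact set and, by freeness, none of them fixes x; hence one
    neighbourhood of x is moved off itself by all of them. *)
Lemma wandering_clopen x : exists O : set L, [/\ clopen O, O x
  & forall b y, O y -> O (act b y) -> q b = 1].
Proof.
have [cB _ _] := profB; pose M := [set b | q b <> 1].
have cM : compact M.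
  apply: subclosed_compact cB _ => //.
  by have [] := loc_const_clopen (~` [set 1]) lq.
have : \forall z \near nbhs (x, x), M `<=` (fun b => act b z.1 <> z.2).
  apply: (iffLR (compact_near_coveringP M) cM _ _ (fun z b => act b z.1 <> z.2)).
  move=> b Mb; have bx : act b x != x.
    apply/eqP => /free b1; apply: Mb; rewrite b1; exact: gmorph1.
  have [U [cU Ubx Ux]] := profinite_zero_dimensional profL bx.
  have [oU clU] := cU.
  have nU : nbhs (b, x) ((fun z : B * L => act z.1 z.2) @^-1` U).
    by apply: act_cont; apply: open_nbhs_nbhs.
  have nUC : nbhs x (~` U) by apply: open_nbhs_nbhs; split=> //; exact: closed_openC.
  have [[V W] /= [bV xW] VW] := nU.
  exists (V, W `*` ~` U); first by split=> //; exists (W, ~` U).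
  move=> [b' [y y']] /= [Vb [Wy nUy']] e; apply: nUy'; rewrite -e.
  exact: (VW (b', y)).
move=> [[V W] /= [xV xW] VW].
have [O [cO Ox OVW]] := profinite_clopen_nbhs profL (filterI xV xW).
exists O; split=> // b y Oy Oby; apply: contrapT => qb.
by apply: (VW (y, act b y) _ b qb) => //; split; [case: (OVW _ Oy) | case: (OVW _ Oby)].
Qed.

Let good (Z : set L) := [/\ clopen Z, forall b x, Z x -> Z (act b x)
  & exists tau : L -> Q, loc_const tau /\
      forall b x, Z x -> tau (act b x) = q b * tau x].

(** On the union of the translates of a wandering set, a point of the translate by b receives the
    value q(b); two translates that meet differ by an element of the kernel of [q], so this is
    consistent. *)
Let good_nbhs x : exists Z, good Z /\ Z x.
Proof.
have [O [cO Ox Oq]] := wandering_clopen x.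
pose Z := [set y | exists b, O (act b^-1 y)].
have Zx : Z x by exists 1; rewrite invg1 act1.
have [cB _ _] := profB; have [cL hL _] := profL.
have cZ : clopen Z.
  split.
    rewrite openE => y [b Ob]; have [oO _] := cO.
    have : nbhs y (act b^-1 @^-1` O) by apply: act_continuous; exact: open_nbhs_nbhs.
    by apply: filterS => z; exists b.
  have -> : Z = (fun z : B * L => act z.1 z.2) @` (snd @^-1` O).
    apply/seteqP; split=> [y [b Ob]|_ [[b y] /= Oy <-]].
      by exists (b, act b^-1 y) => //=; rewrite actKV.
    by exists b; rewrite actK.
  apply: continuous_closed_image => //; first by rewrite -setXTT; exact: compact_setX.
  apply: (iffLR (continuous_closedP _)); last by case: cO.
  by move=> z; exact: cvg_snd.
pose P y : set Q := [set r | exists2 b, q b = r & O (act b^-1 y)].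
pose tau y := xget 1 (P y).
have tauE b y : O (act b^-1 y) -> tau y = q b.
  move=> Ob; have Py : exists r, P y r by exists (q b), b.
  have [c cE Oc] := xgetPex 1 Py; rewrite -[tau y]/(xget 1 (P y)) -cE.
  have : q (c^-1 * b) = 1.
    by apply: (Oq _ (act b^-1 y)) => //; rewrite -actM mulgK.
  by rewrite qM (gmorphV qM) => /(congr1 (fun r => q c * r)); rewrite mulKVg mulg1.
exists Z; split=> //; split=> //.
  by move=> b y [c Oc]; exists (b * c); rewrite invMg actM actK.
exists tau; split=> [y|b y [c Oc]]; last first.
  by rewrite (tauE c y) // (tauE (b * c)) ?qM // invMg actM actK.
have [[b Ob]|nZ] := pselect (Z y).
  have [oO _] := cO.
  have : nbhs y (act b^-1 @^-1` O) by apply: act_continuous; exact: open_nbhs_nbhs.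
  by apply: filterS => z Oz /=; rewrite (tauE b y) // (tauE b z).
have tau1 z : ~ Z z -> tau z = 1.
  by move=> nz; apply: xgetPN => r [b _ Ob]; apply: nz; exists b.
have [_ clZ] := cZ; have : nbhs y (~` Z).
  by apply: open_nbhs_nbhs; split=> //; exact: closed_openC.
by apply: filterS => z nz /=; rewrite !tau1.
Qed.

Let goodU Z Z' : good Z -> good Z' -> good (Z `|` Z').
Proof.
move=> [cZ iZ [s [ls sE]]] [cZ' iZ' [s' [ls' sE']]]; split.
- exact: clopenU.
- by move=> b x [/iZ|/iZ'] h; [left|right]; exact: h.
exists (fun x => if `[< Z x >] then s x else s' x); split.
  have lss := loc_const2 pair ls ls'.
  exact: (loc_const2 (fun (b : bool) (z : Q * Q) => if b then z.1 else z.2)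
    (clopen_loc_const cZ) lss).
move=> b x ZZ'; have Zb : Z (act b x) <-> Z x.
  by split=> [/(iZ b^-1)|/(iZ b)//]; rewrite actK.
case: asboolP => [/Zb Zx|nZ]; first by rewrite asboolT // sE.
have nZx : ~ Z x by move/Zb.
by rewrite asboolF // sE' //; case: ZZ'.
Qed.

(** The good sets are open, cover [L] and are stable under finite unions, so by compactness [L] is
    good. The map identifies the quotient of [L] by the kernel of [q] with part of a product with
    [Q], which turns a covering into a voltage. *)
Lemma equivariant_map : exists tau : L -> Q,
  loc_const tau /\ forall b x, tau (act b x) = q b * tau x.
Proof.
suff [Z [_ _ [tau [ltau tauE]]] ZT] : exists2 Z, good Z & forall x, Z x.
  by exists tau; split=> // b x; exact: tauE.
apply: contrapT => nT; have [cL _ _] := profL.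
pose F := filter_from good (fun Z => ~` Z).
have FF : ProperFilter F.
  apply: filter_from_proper.
    apply: filter_from_filter.
      exists set0; split=> //; first exact: clopen0.
      by exists (fun _ => 1); split=> //; exact: loc_const_cst.
    move=> Z Z' gZ gZ'; exists (Z `|` Z'); first exact: goodU.
    by move=> x nZ; split=> Zx; apply: nZ; [left|right].
  move=> Z gZ; apply: contrapT => h; apply: nT; exists Z => // x.
  by apply: contrapT => nZ; apply: h; exists x.
have [x [_ cx]] := cL F FF filterT.
have [Z [gZ Zx]] := good_nbhs x; have [[oZ _] _ _] := gZ.
have [||y []] := cx (~` Z) Z => //; first by exists Z.
exact: open_nbhs_nbhs.
Qed.

End EquivariantMap.

(** * Wreath products *)

Section Wreath.
Variables (Q R : finGroupType).

Definition wreath : Type := ({ffun R -> Q} * R)%type.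
HB.instance Definition _ := Finite.on wreath.

(** The regular wreath product: R shifts the functions by right translation, in agreement with
    voltages acting on the sheets from the right. *)
Definition wreath_mul (x y : wreath) : wreath :=
  ([ffun r => x.1 r * y.1 (r * x.2)], x.2 * y.2).
Definition wreath_one : wreath := ([ffun=> 1], 1).
Definition wreath_inv (x : wreath) : wreath :=
  ([ffun r => (x.1 (r * x.2^-1))^-1], x.2^-1).

Lemma wreath_mulA : associative wreath_mul.
Proof.
move=> x y z; congr pair; last exact: mulgA.
by apply/ffunP => r; rewrite !ffunE /= !mulgA.
Qed.

Lemma wreath_mul1 : left_id wreath_one wreath_mul.
Proof.
move=> [x r]; congr pair; last exact: mul1g.
by apply/ffunP => s; rewrite !ffunE /= mulg1 mul1g.
Qed.

Lemma wreath_mulV : left_inverse wreath_one wreath_inv wreath_mul.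
Proof.
move=> [x r]; congr pair; last exact: mulVg.
by apply/ffunP => s; rewrite !ffunE /= mulVg.
Qed.

HB.instance Definition _ := Finite_isGroup.Build wreath
  wreath_mulA wreath_mul1 wreath_mulV.

Lemma C_wreath (C : finGroupType -> Prop) : extension_closed_variety C ->
  C Q -> C R -> C wreath.
Proof.
move=> hC CQ CR; have sM : {morph (fun x : wreath => x.2) : x y / x * y} by [].
apply: (@C_gker C hC wreath R _ sM CR).
have ker (x : subg_of (gker sM)) : (sgval x).2 = 1.
  by have := subgP x; rewrite inE => /eqP.
apply: (@C_subdirect C hC R (enum R) (fun _ => Q) (subg_of (gker sM))
  (fun r x => (sgval x).1 r)) => // [r x y|x x1].
  by rewrite /= ffunE ker mulg1.
apply: val_inj; rewrite -[LHS]/(sgval x).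
rewrite [LHS]surjective_pairing ker; congr pair.
by apply/ffunP => r; rewrite ffunE x1 ?mem_enum.
Qed.

End Wreath.

(** * The universal covering of a graph of ultrafilters *)

(** Near each point [g] depends on k only through some coordinate; by compactness and directedness
    of the index set one coordinate serves everywhere. *)
Lemma loc_const_uniform (Y : topologicalType) (D I : Type) (le : I -> I -> Prop)
    (Q : I -> finGroupType) (f : forall i j, Q j -> Q i) (K : topGroupType)
    (p : forall i, K -> Q i) (g : Y * K -> D) :
  inverse_limit le f p -> compact [set: Y] -> loc_const g ->
  exists i, forall y k k', p i k = p i k' -> g (y, k) = g (y, k').
Proof.
move=> limK cY lg; have [cK _ _] := lim_profinite limK.
have [[[[i0 _] rle] tr dir _ _] _ _ _ _] := limK.
have cYK : compact [set: Y * K] by rewrite -setXTT; exact: compact_setX.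
pose F := filter_from [set: I] (fun i => [set j | le i j]).
have FF : ProperFilter F.
  apply: filter_from_proper; last by move=> i _; exists i; exact: rle.
  apply: filter_from_filter; first by exists i0.
  move=> i j _ _; have [k [ik jk]] := dir i j; exists k => // l kl.
  by split; exact: tr kl.
pose P (j : I) (z : Y * K) := forall k, p j k = p j z.2 -> g (z.1, k) = g z.
have : \near F, [set: Y * K] `<=` P F.
  apply: (iffLR (compact_near_coveringP _) cYK _ _ P) => -[y k] _.
  have [[V W] /= [yV kW] VW] := lg (y, k).
  have [i iW] := lim_nbhs limK kW.
  exists (V `*` [set l | p i l = p i k], [set j | le i j]).
    split; last by exists i.
    exists (V, [set l | p i l = p i k]) => //; split=> //.
    exact: lim_loc_const limK i k.
  move=> [[y' l] j] /= [[Vy' lk] ij] k' /(lim_le_eq limK ij) k'l.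
  rewrite (VW (y', k')) ?(VW (y', l)) //; split=> //; apply: iW => //=.
  by rewrite -lk.
move=> h; have [i iP] : exists i, [set: Y * K] `<=` P i := filter_ex h.
by exists i => y k k' kk'; exact: (iP (y, k') Logic.I k kk').
Qed.

Section UltraCovering.
Variable C : finGroupType -> Prop.
Hypothesis hC : extension_closed_variety C.
Variables (T : Type) (Γ : graph T) (S : set T).
Hypotheses (connΓ : connected_graph Γ) (maxS : maximal_subtree Γ S).
Variables (K : topGroupType) (chi : ultra T -> K).
Hypothesis pK : pro_C C K.
Hypothesis chi_cont : continuous chi.
Hypothesis chi_vert : forall p, vert (ultra_graph Γ) p -> chi p = 1.
Hypothesis chi_tree : forall e, vert Γ e \/ S e -> chi (principal e) = 1.
(* [K] is the free pro-C group on the edges outside of [S]. *)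
Hypothesis chi_gen : forall f : K -> bool, loc_const f ->
  (forall k e, f (k * chi (principal e)) = f k) -> forall k l, f k = f l.
Hypothesis chi_free : forall (R : finGroupType) (s : T -> R), C R ->
  (forall e, vert Γ e \/ S e -> s e = 1) ->
  exists rho : K -> R, [/\ loc_const rho, {morph rho : x y / x * y}
    & forall e, rho (chi (principal e)) = s e].

Local Notation Λ := (voltage_graph chi_vert).

(** The tree, having trivial voltage, lifts to every level k, so an invariant function depends only
    on k; the remaining edges make it invariant under right multiplication by the generators. *)
Lemma ultra_covering_connected : profinite_connected Λ.
Proof.
apply: profinite_connectedP => f lf fi.
have spanS := maximal_subtree_spanning connΓ maxS.
have [[[s0 Ss0] Sinc Sconn _] _] := maxS.
have fE i e k : f (principal (inc Γ i e), if i then k * chi (principal e) else k) =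
    f (principal e, k).
  by have := fi i (principal e, k); rewrite /= /voltage_inc /= ultra_map_principal.
have fS x y k : vert Γ x -> vert Γ y -> f (principal x, k) = f (principal y, k).
  move=> Vx Vy; have [p] := Sconn x y (spanS _ Vx) Vx (spanS _ Vy) Vy.
  elim: p x {Vx} => [|[e b] p IHp] x /=; first by move=> ->.
  move=> [Se Ve <- /IHp <-].
  have ce : chi (principal e) = 1 by apply: chi_tree; right.
  have E i : f (principal (inc Γ i e), k) = f (principal e, k).
    by rewrite -(fE i e k) ce mulg1; case: i.
  by rewrite !E.
pose v := inc Γ false s0; have Vv : vert Γ v by exact: inc_vert.
have fV e k : f (principal e, k) = f (principal v, k).
  by rewrite -(fE false); apply: fS => //; exact: inc_vert.
have lv : loc_const (fun k => f (principal v, k)).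
  exact: (loc_const_comp (@continuous_pairl _ _ (principal v)) lf).
have fv := chi_gen lv _.
have fvk k l : f (principal v, k) = f (principal v, l).
  apply: fv => k' e; rewrite -(fV e k') -(fE true e k').
  by apply: fS => //; exact: inc_vert.
have fp p k : f (p, k) = f (principal v, 1).
  suff /(congr1 (fun g => g p)) : (fun p => f (p, k)) = (fun=> f (principal v, 1)) by [].
  apply: (dense_loc_const (@principal_dense T)).
  - exact: (loc_const_comp (@continuous_pairr _ _ k) lf).
  - exact: loc_const_cst.
  - by move=> _ [e _ <-]; rewrite fV; exact: fvk.
by move=> [p k] [p' k']; rewrite !fp.
Qed.

(* The [Q]-valued voltage [c] factors through a finite quotient [R] of [K]; then
   it becomes trivial since, [K] being free, the induced voltage of [Γ] in the
   wreath product of [Q] by [R] lifts to [K]. *)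
Lemma ultra_voltage_trivial (Q : finGroupType) (c : ultra T * K -> Q) :
  C Q -> loc_const c -> (forall z, vert Λ z -> c z = 1) ->
  exists u : ultra T * K -> Q, loc_const u /\
    forall z, u (inc Λ false z) = c z * u (inc Λ true z).
Proof.
move=> CQ lc c1; have [I [le [R [f [p [CR limK]]]]]] := pK.
have [cT _ _] := ultra_profinite T.
have [i ci] := loc_const_uniform limK cT lc.
have pM : {morph p i : x y / x * y} by exact: limM limK i.
pose s r := xget 1 [set k | p i k = r].
have sP k : p i (s (p i k)) = p i k.
  by apply: (@xgetPex _ 1 [set l | p i l = p i k]); exists k.
pose W := wreath Q (R i).
(* The values of [c] over e on all sheets at once, together with the displacement of the sheets
   along e. *)
pose volt e : W := ([ffun r => c (principal e, s r)], p i (chi (principal e))).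
have [treeS _] := maxS.
have [d [d0 dS]] := subtree_potential volt treeS.
have voltV e : vert Γ e -> volt e = 1.
  move=> Ve; congr pair; last first.
    by rewrite (chi_vert (p := principal e)) ?(gmorph1 pM) //; apply/principalE.
  by apply/ffunP => r; rewrite !ffunE c1 //; apply/principalE.
(* Normalised by a potential along the tree, the voltage becomes 1 on [S], which is what [chi_free]
   demands. *)
pose sg e : W := (d (inc Γ false e))^-1 * volt e * d (inc Γ true e).
have [|rho [lrho rhoM rhoE]] := chi_free (s := sg) (C_wreath hC CQ (CR i)).
  move=> e; rewrite /sg; have [Ve _|Ve [//|Se]] := pselect (vert Γ e).
    by rewrite voltV // mulg1 !inc_id // mulVg.
  by rewrite dS // invMg mulgVK mulVg.
have [db [ldb dbP]] := ultra_ext_finite d.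
have dbE e : db (principal e) = d e by exact: ultra_ext_principal dbP.
(* [w] splits [volt] over the covering. Along an edge its R-component and [p i k] are multiplied by
   the same factor, so that the position at which [u] evaluates the function component is the same
   at both ends; the value there changes by [c]. *)
pose w z : W := rho z.2 * (db z.1)^-1.
pose u z : Q := ((w z).1 (p i z.2 * (w z).2^-1))^-1.
have lfst (D : Type) (g : ultra T -> D) : loc_const g ->
    loc_const (fun z : ultra T * K => g z.1).
  by move=> lg; apply: (loc_const_comp (g := fst)) => // z; exact: cvg_fst.
have lsnd (D : Type) (g : K -> D) : loc_const g ->
    loc_const (fun z : ultra T * K => g z.2).
  by move=> lg; apply: (loc_const_comp (g := snd)) => // z; exact: cvg_snd.
have lw : loc_const w.
  by apply: (loc_const2 (fun a b => a * b^-1)); [exact: lsnd | exact: lfst].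
have lu : loc_const u.
  apply: (loc_const2 (fun (x : W) r => (x.1 (r * x.2^-1))^-1)) => //.
  exact/lsnd/(lim_loc_const limK).
exists u; split=> // -[q k].
have [_ _ cinc] := gc_graph (voltage_galois chi_vert (ultra_graph_profinite Γ) pK chi_cont).
have linc b : loc_const (fun q => u (inc Λ b (q, k))).
  apply: loc_const_comp lu; move=> q'.
  by apply: continuous_comp; [exact: continuous_pairr | exact: cinc].
suff /(congr1 (fun g => g q)) : (fun q => u (inc Λ false (q, k))) =
    (fun q => c (q, k) * u (inc Λ true (q, k))) by [].
apply: (dense_loc_const (@principal_dense T)) => //.
  apply: (loc_const2 (fun a b => a * b)) => //.
  exact: (loc_const_comp (@continuous_pairr _ _ k) lc).
move=> _ [e _ <-].
have wE : w (inc Λ true (principal e, k)) = w (inc Λ false (principal e, k)) * volt e.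
  rewrite /w /= !ultra_map_principal !dbE rhoM rhoE /sg -!mulgA mulgV mulg1.
  by [].
have uE : (u (inc Λ true (principal e, k)))^-1 =
    (u (inc Λ false (principal e, k)))^-1 * c (principal e, k).
  rewrite /u wE !invgK; set x := w _.
  have -> : p i (inc Λ true (principal e, k)).2 * (x * volt e).2^-1 =
      p i k * x.2^-1.
    by rewrite pM -[(x * volt e).2]/(x.2 * p i (chi (principal e))) invgM mulgA mulgK.
  rewrite -[x * volt e]/(wreath_mul x (volt e)) /wreath_mul /= !ffunE mulgVK.
  by congr (_ * _); exact: ci.
by rewrite -[in RHS](invgK (u (inc Λ true _))) uE invMg invgK mulKVg.
Qed.

(** In each finite quotient of [B], an equivariant [tau] has an invariant coboundary, which descends
    to a voltage [c]. A trivialisation of [c] corrects [tau] to an invariant function [phi],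
    constant by connectedness but still multiplied by the image of b under translation by b. *)
Lemma ultra_covering_simply_connected (L : topologicalType) (Λ' : graph L)
    (B : topGroupType) (act : B -> L -> L) (zeta : L -> ultra T * K) :
  galois_covering C Λ Λ' act zeta -> profinite_connected Λ' ->
  forall b : B, b = 1.
Proof.
move=> gal conn b; have pB := gc_group gal.
have [I [le [Q [f [p [CQ limB]]]]]] := pB.
have pM i : {morph p i : x y / x * y} by exact: limM limB i.
apply: (lim_inj limB) => i; rewrite (gmorph1 (pM i)).
have [profL _ cinc] := gc_graph gal.
have [tau [ltau tauE]] := equivariant_map (pro_C_profinite pB) profL
  (gc_act1 gal) (@gc_actM _ _ _ _ _ _ _ _ gal)
  (@gc_act_continuous _ _ _ _ _ _ _ _ gal) (@gc_free _ _ _ _ _ _ _ _ gal)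
  (lim_loc_const limB i) (pM i).
have ltau_inc j : loc_const (fun x => tau (inc Λ' j x)).
  by apply: loc_const_comp ltau; exact: cinc.
pose c x := (tau (inc Λ' false x))^-1 * tau (inc Λ' true x).
have cinv a x : c (act a x) = c x.
  by rewrite /c !(gc_act_inc gal) !tauE invMg -mulgA mulKg.
have /choice[s sP] := gc_surjective gal.
have czE x : c (s (zeta x)) = c x.
  by have [a <-] := iffLR (gc_orbits gal x (s (zeta x))) (esym (sP _)).
have zetaI j x : zeta (inc Λ' j x) = inc Λ j (zeta x) by rewrite (gc_morphism gal).
have [cL _ _] := profL.
have hTK : hausdorff_space (ultra T * K)%type.
  by have [_ ? _] := profinite_prod (ultra_profinite T) (pro_C_profinite pK).
have [||u [lu uE]] := @ultra_voltage_trivial (Q i) (c \o s) (CQ i).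
- apply: (loc_const_descent cL hTK (gc_continuous gal) (gc_surjective gal)).
  have -> : (c \o s) \o zeta = c by apply/funext => x; exact: czE.
  exact: (loc_const2 (fun a b => a^-1 * b)).
- move=> z Vz /=; have zE : zeta (inc Λ' false (s z)) = z.
    by rewrite zetaI sP inc_id.
  by rewrite -zE czE /c !inc_inc mulVg.
pose phi x := tau (inc Λ' false x) * u (zeta (inc Λ' false x)).
have lphi : loc_const phi.
  apply: (loc_const2 (fun a b => a * b)) => //.
  apply: (loc_const_comp (g := fun x => zeta (inc Λ' false x))) lu => x.
  by apply: continuous_comp; [exact: cinc | exact: gc_continuous gal _].
have phiI j x : phi (inc Λ' j x) = phi x.
  rewrite /phi inc_inc; case: j => //.
  by rewrite [in RHS]zetaI uE /= czE zetaI /c !mulgA mulgV mul1g.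
have [x _] := vert_nonempty Λ'.
have := profinite_connected_const conn lphi phiI (act b x) x.
rewrite /phi (gc_act_inc gal) tauE.
have <- : zeta (inc Λ' false x) = zeta (act b (inc Λ' false x)).
  by apply/(gc_orbits gal); exists b.
by rewrite -mulgA -{2}[tau _ * u _]mul1g => /mulIg.
Qed.

Definition ultra_covering : universal_covering C (ultra_graph Γ) :=
  UniversalCovering
    (voltage_galois chi_vert (ultra_graph_profinite Γ) pK chi_cont)
    ultra_covering_connected ultra_covering_simply_connected.

Lemma ultra_section_inc p :
  (inc (ultra_graph Γ) false p, 1) = inc (uc_graph ultra_covering) false (p, 1).
Proof. by []. Qed.

Lemma ultra_section_chi p :
  @uc_act C _ _ ultra_covering (chi p) (inc (ultra_graph Γ) true p, 1) =
  inc (uc_graph ultra_covering) true (p, 1).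
Proof. by rewrite /= /voltage_act /voltage_inc /= mulg1 mul1g. Qed.

Definition ultra_section : zero_section ultra_covering :=
  @ZeroSection C _ _ ultra_covering (fun p => (p, 1)) chi
    (@continuous_pairr _ _ 1) (fun p => erefl) ultra_section_inc ultra_section_chi.

End UltraCovering.

(** * Coset spaces *)

Section Cosets.
Variables (T : Type) (P : groupType) (N : T -> set P).

Lemma coset_space_eq (s s' : coset_space N) :
  coset_base s = coset_base s' -> coset_set s = coset_set s' -> s = s'.
Proof.
case: s s' => [m A mA] [m' A' mA'] /= e eA.
by subst m' A'; congr CosetSpace; exact: Prop_irrelevance.
Qed.

Lemma coset_pi_eq m g g' : subgroup_set (N m) ->
  coset_pi N (m, g) = coset_pi N (m, g') <-> N m (g^-1 * g').
Proof.
move=> [N1 NM NV]; split=> [/(congr1 (@coset_set _ _ _)) /= e | Ng].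
  have [a Na <-] : left_coset g (N m) g' by rewrite e; exists 1; rewrite ?mulg1.
  by rewrite mulKg.
apply: coset_space_eq => //=; apply/seteqP; split=> _ [a Na <-].
  exists (g'^-1 * g * a); last by rewrite !mulgA mulgV mul1g.
  by apply: NM => //; have := NV _ Ng; rewrite invgM invgK.
exists (g^-1 * g' * a); last by rewrite !mulgA mulgV mul1g.
exact: NM.
Qed.

Lemma coset_act_pi h m g : coset_act h (coset_pi N (m, g)) = coset_pi N (m, h * g).
Proof.
apply: coset_space_eq => //=; rewrite /left_coset image_comp.
by apply: eq_imagel => a _ /=; rewrite mulgA.
Qed.

End Cosets.

Lemma coset_pi_continuous (T : topologicalType) (P : topGroupType) (N : T -> set P) :
  continuous (coset_pi N : T * P -> quotient_topology (coset_space N)).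
Proof.
have -> : coset_pi N = \pi_(quotient_topology (coset_space N))%qT :> (T * P -> _).
  by apply/funext => p; rewrite unlock.
exact: pi_continuous.
Qed.

(** * The free factor of the completion *)

Section Completed.
Variable C : finGroupType -> Prop.
Hypothesis hC : extension_closed_variety C.
Variables (T X : choiceType) (Γ : graph T) (GG : graph_of_groups X Γ).
Variable S : set T.
Hypotheses (connΓ : connected_graph Γ) (maxS : maximal_subtree Γ S).
Local Notation G := (pi1 GG S).
Local Notation elt := (pi1_elt GG S).
Local Notation t := (pi1_t GG S).
Variables (K : topGroupType) (iota : G -> K) (hK : pro_C_completion C iota).
Variable tb : ultra T -> K.
Hypothesis tb_cont : continuous tb.
Hypothesis tbE : forall e, tb (principal e) = iota (t e).

Let pK : pro_C C K := completion_pro_C hC hK.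
Let profK : profinite_space K := pro_C_profinite pK.
Let iotaM : {morph iota : x y / x * y} := completionM hK.
Let iota_dense : dense (range iota) := completion_dense hK.

Local Notation GGb := (cgog iotaM profK tb_cont tbE).
Local Notation Γb := (ultra_graph Γ).

(* The free factor is the image of the continuous extension of the retraction
   of [G] onto the subgroup generated by the stable letters. *)
Lemma free_factor : exists (F : topGroupType) (val : F -> K) (chi : ultra T -> F),
  [/\ pro_C C F, [/\ continuous val, injective val & {morph val : x y / x * y}],
      continuous chi /\ (forall p, val (chi p) = tb p),
      (forall f : F -> bool, loc_const f ->
        (forall k e, f (k * chi (principal e)) = f k) -> forall k l, f k = f l)
    & (forall (H : topGroupType) (f g : F -> H), hausdorff_space H ->
        continuous f -> continuous g ->
        {morph f : x y / x * y} -> {morph g : x y / x * y} ->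
        (forall e, f (chi (principal e)) = g (chi (principal e))) -> f = g)].
Proof.
have [r [rM r_elt r_t]] := pi1_retraction GG S.
have [|rh [crh rhM rhE]] := completion_ext hC hK (phi := iota \o r) pK.
  by move=> x y; rewrite /= rM iotaM.
have [_ hausK _] := profK.
have rr : r \o r = r.
  apply: pi1_hom_eq => // [x y|x|e] /=; first by rewrite !rM.
    by rewrite r_elt (gmorph1 rM).
  by rewrite !r_t.
have rhK k : rh (rh k) = rh k.
  suff /(congr1 (fun f => f k)) : rh \o rh = rh by [].
  apply: (dense_hausdorff hausK iota_dense) => //.
    by move=> x; apply: continuous_comp; exact: crh.
  by move=> _ [g _ <-] /=; rewrite !rhE /= -[in RHS]rr.
(* The image of the idempotent [rh], written as its set of fixed points, which is visibly a closed
   subgroup. *)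
pose A := [set k | rh k = k].
have hA : subgroup_set A.
  split=> [|x y|x] /=; first exact: gmorph1.
    by rewrite /A /= rhM => -> ->.
  by rewrite /A /= (gmorphV rhM) => ->.
have cA : closed A.
  move=> k kA; apply: hausK => U V rkU kV.
  have rU : nbhs k (rh @^-1` U) by exact: crh.
  have [x [rx [Ux Vx]]] := kA _ (filterI rU kV).
  by exists x; split=> //; rewrite -rx.
have rht p : rh (tb p) = tb p.
  suff /(congr1 (fun f => f p)) : rh \o tb = tb by [].
  apply: (dense_hausdorff hausK (@principal_dense T)) => //.
    by move=> q; apply: continuous_comp; [exact: tb_cont | exact: crh].
  by move=> _ [e _ <-] /=; rewrite !tbE rhE /= r_t.
pose F : topGroupType := csub hA.
pose mk k : F := csub_mk hA (rhK k : A (rh k)).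
pose chi p : F := csub_mk hA (rht p : A (tb p)).
have mkM : {morph mk : x y / x * y} by move=> x y; apply: csub_val_inj; exact: rhM.
have cmk : continuous mk by apply: csub_continuous; exact: crh.
have mk_surj a : exists k, mk k = a.
  by exists (csub_val a); apply: csub_val_inj; exact: csub_valP a.
have miM : {morph mk \o iota : x y / x * y} by move=> x y; rewrite /= iotaM mkM.
have mi_elt x : mk (iota (elt x)) = 1.
  by apply: csub_val_inj; rewrite -[LHS]/(rh _) rhE /= r_elt (gmorph1 iotaM).
have mi_t e : mk (iota (t e)) = chi (principal e).
  by apply: csub_val_inj; rewrite -[LHS]/(rh _) rhE /= r_t -tbE.
have mi_dense : dense (range (mk \o iota)).
  have := dense_image cmk mk_surj iota_dense.
  by rewrite image_comp.
exists F, (@csub_val _ _ hA), chi; split.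
- exact: csub_pro_C.
- by split; [exact: csub_val_continuous | exact: csub_val_inj | exact: csub_valM].
- by split=> //; apply: csub_continuous; exact: tb_cont.
- move=> f lf fchi; have fw w : forall k, f (k * mk (iota w)) = f k.
    elim/pi1_ind: w => [|x w IHw|e w IHw|e w IHw] k.
    + by rewrite [mk _](gmorph1 miM) mulg1.
    + by rewrite [mk _]miM /= mi_elt mul1g.
    + by rewrite [mk _]miM /= mulgA IHw mi_t.
    + rewrite [mk _]miM /= mulgA IHw -(fchi (k * _) e) -mi_t.
      by rewrite [X in k * X](gmorphV miM) mulgVK.
  suff E : f = fun=> f 1 by move=> k l; rewrite E.
  apply: (dense_loc_const mi_dense lf (loc_const_cst _)).
  by move=> _ [w _ <-]; have := fw w 1; rewrite mul1g.
move=> H f g hausH cf cg fM gM fg.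
apply: (dense_hausdorff hausH mi_dense cf cg) => _ [w _ <-].
have E : f \o (mk \o iota) = g \o (mk \o iota).
  apply: pi1_hom_eq => [x y|x y|x|e] /=.
  - by rewrite [mk _]miM fM.
  - by rewrite [mk _]miM gM.
  - by rewrite mi_elt (gmorph1 fM) (gmorph1 gM).
  - by rewrite mi_t fg.
exact: (congr1 (fun f => f w) E).
Qed.

(** * The fundamental group of the completed graph of groups *)

Lemma cembed_comp_eq (H : topGroupType) (f g : cspace iota -> H) :
  pro_C C H -> continuous f -> continuous g ->
  (forall x, f (cembed iota x) = g (cembed iota x)) -> f = g.
Proof.
move=> /pro_C_profinite[_ hausH _] cf cg fg.
apply: (dense_hausdorff hausH (@cembed_dense _ _ _ _ _ _ iota) cf cg).
by move=> _ [x _ <-]; exact: fg.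
Qed.

(** For the covering with group F, the universal specialisation consists of [ceta] and the inclusion
    of F in [K]. Any other one restricts to the generators of G, satisfies their relations and so
    extends to [K]. *)
Lemma completed_fundamental_group : exists (U : universal_covering C Γb)
  (J : zero_section U), inhabited (fundamental_group GGb J).
Proof.
have [F [val [chi [pF [cval val_inj valM] [cchi chiE] gen uniq]]]] := free_factor.
have chi_vert p : vert Γb p -> chi p = 1.
  move=> Vp; apply: val_inj; rewrite chiE (gmorph1 valM).
  exact: (tb1_vert iotaM profK tb_cont tbE).
have chi_tree e : vert Γ e \/ S e -> chi (principal e) = 1.
  move=> eS; apply: val_inj; rewrite chiE (gmorph1 valM) tbE pi1_t1 //.
  exact: gmorph1.
have chi_free (R : finGroupType) (s : T -> R) : C R ->
    (forall e, vert Γ e \/ S e -> s e = 1) ->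
    exists rho : F -> R, [/\ loc_const rho, {morph rho : x y / x * y}
      & forall e, rho (chi (principal e)) = s e].
  (* Freeness of F: [s] defines a homomorphism of G that kills the vertex groups; it extends to the
     completion and is then restricted to F. *)
  move=> CR s1; have [x y _|//|x|//|phi [phiM _ phit]] :=
      @pi1_hom _ _ _ GG S R (fun _ => 1) s.
  - by rewrite mul1g.
  - by rewrite mulg1 mulgV.
  have [h [lh hM hE]] := completion_finite hC hK CR phiM.
  exists (h \o val); split; first exact: loc_const_comp.
    by move=> x y; rewrite /= valM hM.
  by move=> e; rewrite /= chiE tbE hE.
pose U := ultra_covering hC connΓ maxS pF cchi chi_vert chi_tree gen chi_free.
pose J : zero_section U :=
  ultra_section hC connΓ maxS pF cchi chi_vert chi_tree gen chi_free.
exists U, J; constructor.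
have spec : specialisation GGb J (ceta (iota := iota)) (val : uc_group U -> K).
  split=> //; first exact: ceta_continuous.
    by move=> x y xy; exact: ceta_mul.
  move=> x; split=> //.
  rewrite -[zs_chi J _]/(chi (cbase x)) chiE.
  rewrite -[ceta (bd _ _ _)]/((tb (cbase x))^-1 * ceta x * tb (cbase x)).
  by rewrite !mulgA mulgV mul1g mulgK.
apply: (FundamentalGroup pK spec) => H beta beta' pH [cb bM cb' b'M bE].
have [_ hausH _] := pro_C_profinite pH.
have [||||phi [phiM phix phit]] := @pi1_hom _ _ _ GG S H
    (fun x => beta (cembed iota x)) (fun e => beta' (chi (principal e))).
- move=> x y xy; rewrite (cembedM iotaM) //; apply: bM.
  by rewrite /= /cbase /= xy.
- move=> x; rewrite (cembed_bd iotaM tb_cont tbE).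
  by have [<- _] := bE (cembed iota x).
- move=> x; rewrite (cembed_bd iotaM tb_cont tbE).
  by have [_ {1}->] := bE (cembed iota x).
- by move=> e /chi_tree ->; exact: gmorph1.
have [h [ch hM hE]] := completion_ext hC hK pH phiM.
exists h; split.
  split=> //.
    apply: (cembed_comp_eq pH cb).
      by move=> x; apply: continuous_comp; [exact: ceta_continuous | exact: ch].
    by move=> x; rewrite -phix -hE.
  apply: uniq => //.
  - by move=> x; apply: continuous_comp; [exact: cval | exact: ch].
  - by move=> x y; rewrite /= valM hM.
  - by move=> e; rewrite /= chiE tbE hE phit.
move=> h' [ch' h'M bh' b'h'].
apply: (dense_hausdorff hausH iota_dense ch ch') => _ [w _ <-].
suff E : h \o iota = h' \o iota by exact: (congr1 (fun f => f w) E).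
apply: pi1_hom_eq => [x y|x y|x|e] /=.
- by rewrite iotaM hM.
- by rewrite iotaM h'M.
- by rewrite hE phix bh'.
- by rewrite hE phit b'h' /= chiE tbE.
Qed.

(** * Arbitrary coverings and 0-sections *)

Section AnyCovering.
Variables (U : universal_covering C Γb) (J : zero_section U).
Variable Pi : fundamental_group GGb J.
Local Notation nu := (fg_nu Pi).
Local Notation nu' := (fg_nu' Pi).
Local Notation chi := (zs_chi J).
Let pPi : pro_C C Pi := fg_pro_C Pi.

Lemma fg_nu_continuous : continuous nu.
Proof. by have [] := fg_specialisation Pi. Qed.

Lemma fg_nu'_continuous : continuous nu'.
Proof. by have [] := fg_specialisation Pi. Qed.

Lemma fg_nuM x y : cbase x = cbase y -> nu (cmul iotaM x y) = nu x * nu y.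
Proof. by have [_ h _ _ _] := fg_specialisation Pi => xy; exact: h. Qed.

Lemma fg_nu'M : {morph nu' : a b / a * b}.
Proof. by have [] := fg_specialisation Pi. Qed.

Lemma fg_nu_bd0 x : nu (cbd iotaM tb_cont tbE false x) = nu x.
Proof. by have [_ _ _ _ /(_ x)[]] := fg_specialisation Pi. Qed.

Lemma fg_nu_bd1 x : nu x = nu' (chi (cbase x)) *
  nu (cbd iotaM tb_cont tbE true x) * (nu' (chi (cbase x)))^-1.
Proof. by have [_ _ _ _ /(_ x)[_ {1}->]] := fg_specialisation Pi. Qed.

Lemma fg_nu_subgroup p : subgroup_set (nu @` fibre GGb p).
Proof.
have e1 : nu (cone iotaM p) = 1.
  have := fg_nuM (x := cone iotaM p) (y := cone iotaM p) erefl.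
  have := cmul1 iotaM (cone iotaM p); rewrite -[cbase _]/p => -> e.
  by apply: (mulgI (nu (cone iotaM p))); rewrite -e mulg1.
split; first by exists (cone iotaM p).
- move=> _ _ [x xp <-] [y yp <-]; exists (cmul iotaM x y).
    by rewrite /fibre /= cbase_mul.
  by rewrite fg_nuM // [LHS]xp [RHS]yp.
- move=> _ [x xp <-]; exists (cinv iotaM x) => //.
  apply/esym/mulg1_eq; apply: (mulgI (nu (cinv iotaM x))).
  by rewrite mulgA -fg_nuM // cmulV -[cbase x]/(cbase _) [cbase x]xp e1 mul1g mulg1.
Qed.

Lemma fg_endo_id (d : Pi -> Pi) : continuous d -> {morph d : x y / x * y} ->
  (forall x, d (nu x) = nu x) -> (forall b, d (nu' b) = nu' b) -> forall k, d k = k.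
Proof.
move=> cd dM dnu dnu' k.
have [d0 [_ uniq]] := fg_universal Pi (fg_pro_C Pi) (fg_specialisation Pi).
have <- : d0 = d by apply: uniq; split=> //; apply/funext => x /=.
have -> : d0 = id by apply: uniq; split=> // x; exact: cvg_id.
by [].
Qed.

(* [delta] is the specialisation in [K] obtained from a splitting of [tb] over the
   universal covering, and [khat] extends [kappa]. By the uniqueness of splittings
   [khat \o delta] is inner, so that [khat] is an isomorphism. *)
Lemma any_covering_iso : exists (kappa : G -> Pi) (c : T -> Pi)
    (khat : K -> Pi) (delta : Pi -> K) (gamma : ultra T -> K),
  [/\ pro_C_completion C kappa,
      (forall m, c m = c (inc Γ false m)) /\
      ({morph kappa : x y / x * y}),
      (forall x, kappa (elt x) =
        c (gproj GG x) * nu (cembed iota x) * (c (gproj GG x))^-1),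
      (forall m, kappa (t m) = c (inc Γ false m) * nu' (chi (principal m)) *
        (c (inc Γ true m))^-1)
    & [/\ {morph delta : x y / x * y},
      (forall g, kappa g = khat (iota g)),
      (forall x, delta (nu x) = gamma (cbase x) * ceta x * (gamma (cbase x))^-1)
    & exists z, (forall k, delta (khat k) = z * k * z^-1) /\
        forall m, delta (c m) * gamma (principal m) = z]].
Proof.
have profΓb := ultra_graph_profinite Γ.
have tbV v : vert Γb v -> tb v = 1 := @tb1_vert _ _ _ _ _ _ _ _ iotaM profK tb_cont tbE v.
have [gamma [phi [cgamma gamma0 cphi phiM phiE]]] := uc_lift hC J pK tb_cont tbV.
(* [gamma] carries the voltage [tb] to that of [phi], so conjugating [ceta] by it turns the relation
   ∂_1 = conjugation by [tb] into the one required with [phi]. *)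
pose beta (x : cspace iota) := gamma (cbase x) * ceta x * (gamma (cbase x))^-1.
have cgb : continuous (fun x : cspace iota => gamma (cbase x)).
  by move=> x; apply: continuous_comp; [exact: cbase_continuous | exact: cgamma].
have spec : specialisation GGb J beta phi.
  split=> //.
  - apply: continuousM; last exact: continuousV.
    by apply: continuousM => //; exact: ceta_continuous.
  - move=> x y xy; rewrite /beta cbase_mul ceta_mul // -[cbase y]/(gproj GGb y) -xy.
    by rewrite !mulgA mulgVK.
  move=> x /=; rewrite phiE /beta.
  rewrite -[cbase (cbd _ _ _ false _)]/(inc Γb false (cbase x)) gamma0.
  split=> //; rewrite -[cbase (cbd _ _ _ true _)]/(inc Γb true (cbase x)).
  rewrite -[ceta (cbd _ _ _ true _)]/((tb (cbase x))^-1 * ceta x * tb (cbase x)).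
  by rewrite !invgM invgK !mulgA !(mulgVK, mulgK).
have [delta [[cdelta deltaM betaE phi_E] _]] := fg_universal Pi pK spec.
have deltanu x : delta (nu x) = beta x by rewrite betaE.
have deltanu' b : delta (nu' b) = phi b by rewrite phi_E.
have [treeS _] := maxS.
pose fe e : Pi := nu' (chi (principal e)).
have [g0 [g00 g0S]] := subtree_potential fe treeS.
(* The inverse of a potential of ν'χ along the tree: with it the image [s e] of t_e is 1 on the
   tree, as the relations of G require. *)
pose c m := (g0 m)^-1.
have c0 m : c (inc Γ false m) = c m by rewrite /c g00.
pose s e := c (inc Γ false e) * fe e * (c (inc Γ true e))^-1.
have s1 e : vert Γ e \/ S e -> s e = 1.
  rewrite /s; have [Ve _|Ve [//|Se]] := pselect (vert Γ e).
    rewrite /fe (chi1 J) ?(gmorph1 fg_nu'M) ?mulg1; last by apply/principalE.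
    by rewrite !inc_id // mulgV.
  have -> : fe e = g0 (inc Γ false e) * (g0 (inc Γ true e))^-1.
    by rewrite g0S // mulgK.
  by rewrite /c mulKg invgK mulVg.
have [||||kappa [kappaM kappax kappat]] := @pi1_hom _ _ _ GG S Pi
    (fun x => c (gproj GG x) * nu (cembed iota x) * (c (gproj GG x))^-1) s.
- move=> x y xy; rewrite (cembedM iotaM) // fg_nuM; last by rewrite /cbase /= xy.
  by rewrite gproj_smul // -xy !mulgA mulgVK.
- by move=> x; rewrite (cembed_bd iotaM tb_cont tbE) fg_nu_bd0 gproj_bd c0.
- move=> x; rewrite (cembed_bd iotaM tb_cont tbE) gproj_bd {1}fg_nu_bd1.
  rewrite /s c0 -[cbase (cembed _ _)]/(principal (gproj GG x)) -/(fe _).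
  by rewrite !invgM invgK !mulgA !(mulgVK, mulgK).
- exact: s1.
have [khat [ckhat khatM khatE]] := completion_ext hC hK pPi kappaM.
have [_ hausK _] := profK; have [_ hausPi _] := pro_C_profinite pPi.
(* [y] measures the failure of [delta \o kappa] to be [iota]. On the tree t_e and its image are both
   trivial, so y is constant there, and the tree spans. *)
pose y m := delta (c m) * gamma (principal m).
have gammaI i m : gamma (principal (inc Γ i m)) = gamma (inc Γb i (principal m)).
  by rewrite principal_morphism.
have y0 m : y (inc Γ false m) = y m by rewrite /y c0 gammaI gamma0.
have deltas e : delta (s e) = y e * iota (t e) * (y (inc Γ true e))^-1.
  rewrite /s c0 !deltaM (gmorphV deltaM) deltanu' phiE -tbE /y -!gammaI.
  by rewrite invgM !mulgA.
have yS e : S e -> y (inc Γ true e) = y e.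
  move=> Se; have := deltas e; rewrite s1; last by right.
  rewrite (gmorph1 deltaM) pi1_t1; last by right.
  by rewrite (gmorph1 iotaM) mulg1 => /esym/divg1_eq.
have yconst m m' : y m = y m'.
  rewrite -(y0 m) -(y0 m'); have spanS := maximal_subtree_spanning connΓ maxS.
  have [_ _ Sconn _] := treeS.
  have V b : vert Γ (inc Γ false b) by exact: inc_vert.
  have [p] := Sconn _ _ (spanS _ (V m)) (V m) (spanS _ (V m')) (V m').
  elim: p (inc Γ false m) => [|[e b] p IHp] x /=; first by move=> ->.
  move=> [Se Ve <- /IHp <-].
  have E i : y (inc Γ i e) = y e by case: i; [exact: yS | exact: y0].
  by rewrite !E.
have [v0 _] := vert_nonempty Γ.
have [z zE] : exists z, forall m, y m = z by exists (y v0).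
have dk : delta \o kappa = (fun k => z * k * z^-1) \o iota.
  apply: pi1_hom_eq => [a b|a b|x|e] /=.
  - by rewrite kappaM deltaM.
  - by rewrite iotaM !mulgA mulgVK.
  - rewrite kappax !deltaM (gmorphV deltaM) deltanu /beta.
    by rewrite -(zE (gproj GG x)) /y invgM !mulgA.
  - by rewrite kappat deltas !zE.
have czz : continuous (fun k : K => z * k * z^-1).
  apply: continuousM; last exact: cst_continuous.
  by apply: continuousM; [exact: cst_continuous | move=> k; exact: cvg_id].
have dkhat k : delta (khat k) = z * k * z^-1.
  suff /(congr1 (fun f => f k)) : delta \o khat = (fun k => z * k * z^-1) by [].
  apply: (dense_hausdorff hausK iota_dense) => //.
    by move=> l; apply: continuous_comp; [exact: ckhat | exact: cdelta].
  move=> _ [w _ <-] /=; rewrite khatE.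
  exact: (congr1 (fun f => f w) dk).
have [cb [ccb cbE]] := ultra_ext_pro_C c pPi.
have cinc i : continuous (inc Γb i) by exact: ultra_map_continuous.
have cb0 p : cb (inc Γb false p) = cb p.
  suff /(congr1 (fun f => f p)) : cb \o inc Γb false = cb by [].
  apply: (dense_hausdorff hausPi (@principal_dense T)) => //.
    by move=> q; apply: continuous_comp; [exact: cinc | exact: ccb].
  by move=> _ [m _ <-] /=; rewrite ultra_map_principal !cbE c0.
(* The analogue of [y] for the composite in the other order, on all of [ultra T]: it makes the
   voltages of [psi] and ν' cohomologous, so that [uc_unique] yields the constant [h]. *)
pose g p := khat (gamma p) * cb p.
have cg : continuous g.
  apply: continuousM => //.
  by move=> p; apply: continuous_comp; [exact: cgamma | exact: ckhat].
have cnc : continuous (fun p => nu' (chi p)).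
  move=> p; apply: continuous_comp; last exact: fg_nu'_continuous.
  exact: (chi_continuous profΓb).
pose psi b := khat (phi b).
have cpsi : continuous psi.
  by move=> b; apply: continuous_comp; [exact: cphi | exact: ckhat].
have psiM : {morph psi : a b / a * b} by move=> a b; rewrite /psi phiM khatM.
have g1 p : psi (chi p) * g (inc Γb true p) = g p * nu' (chi p).
  suff /(congr1 (fun f => f p)) : (fun p => psi (chi p) * g (inc Γb true p)) =
      (fun p => g p * nu' (chi p)) by [].
  apply: (dense_hausdorff hausPi (@principal_dense T)).
  - apply: continuousM.
      move=> q; apply: continuous_comp; last exact: cpsi.
      exact: (chi_continuous profΓb).
    by move=> q; apply: continuous_comp; [exact: cinc | exact: cg].
  - exact: continuousM.
  move=> _ [e _ <-]; rewrite /psi phiE !khatM (gmorphV khatM) tbE khatE kappat.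
  rewrite /g -principal_morphism !cbE /s c0 !mulgA mulgVK.
  by rewrite mulgVK.
have gI p : g (inc Γb false p) = g p by rewrite /g gamma0 cb0.
have [h [gh psih]] :=
  uc_unique profΓb pPi fg_nu'_continuous cpsi cg fg_nu'M psiM gI g1.
have kdnu x : khat (delta (nu x)) = h * nu x * h^-1.
  suff /(congr1 (fun f => f x)) : (fun x => khat (delta (nu x))) =
      (fun x => h * nu x * h^-1) by [].
  apply: (cembed_comp_eq pPi).
  - move=> x'; apply: continuous_comp; last exact: ckhat.
    by apply: continuous_comp; [exact: fg_nu_continuous | exact: cdelta].
  - apply: continuousM; last exact: cst_continuous.
    by apply: continuousM; [exact: cst_continuous | exact: fg_nu_continuous].
  move=> x'; rewrite deltanu /beta !khatM (gmorphV khatM).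
  rewrite -[ceta _]/(iota (elt x')) khatE kappax.
  rewrite -(gh (principal (gproj GG x'))) /g cbE invgM !mulgA.
  by [].
have kd k : khat (delta k) = h * k * h^-1.
  suff E : h^-1 * khat (delta k) * h = k by rewrite -[in RHS]E !mulgA mulgV mul1g mulgK.
  apply: (@fg_endo_id (fun k => h^-1 * khat (delta k) * h)).
  - apply: continuousM; last exact: cst_continuous.
    apply: continuousM; first exact: cst_continuous.
    by move=> l; apply: continuous_comp; [exact: cdelta | exact: ckhat].
  - by move=> a b; rewrite deltaM khatM !mulgA mulgK.
  - by move=> x; rewrite kdnu !mulgA mulVg mul1g mulgVK.
  - move=> b; rewrite deltanu' -/(psi b) psih.
    by rewrite !mulgA mulVg mul1g mulgVK.
pose kinv k := z^-1 * delta k * z.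
have khatK : cancel khat kinv.
  by move=> k; rewrite /kinv dkhat !mulgA mulVg mul1g mulgVK.
have kinvK : cancel kinv khat.
  move=> k; have <- : khat (delta (h^-1 * k * h)) = k.
    by rewrite kd !mulgA mulgV mul1g mulgK.
  by rewrite khatK.
have ckinv : continuous kinv.
  apply: continuousM; last exact: cst_continuous.
  by apply: continuousM => //; exact: cst_continuous.
exists kappa, c, khat, delta, gamma; split=> //.
- have -> : kappa = khat \o iota by apply/funext => w /=; rewrite khatE.
  exact (completion_iso hK ckhat ckinv khatM khatK kinvK).
- by split=> // m; rewrite c0.
by split=> //; exists z; split.
Qed.

(** Since [kappa] maps G(m) into c(m) Π(m) c(m)^-1, the assignment g G(m) |-> kappa(g) c(m) Π(m) is
    well defined. Injectivity of ν on fibres follows from [delta \o nu] being a conjugate of the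
    injective [ceta]. *)
Lemma standard_tree_embedding : exists (kappa : G -> Pi) (c : T -> Pi),
  [/\ pro_C_completion C kappa,
      (forall x, kappa (elt x) =
        c (gproj GG x) * nu (cembed iota x) * (c (gproj GG x))^-1),
      (forall m, c m = c (inc Γ false m)) /\
      (forall m, kappa (t m) = c (inc Γ false m) * nu' (chi (principal m)) *
        (c (inc Γ true m))^-1),
      (forall p, set_inj (fibre GGb p) nu)
    & (forall m, pro_C_closed C (elt @` fibre GG m)) ->
      exists sigma : abs_tree_space GG S -> pro_C_tree_space Pi,
        [/\ injective sigma,
            graph_morphism (abs_tree GG S) (pro_C_tree Pi) sigma,
            dense (range sigma)
          & forall g s, sigma (coset_act g s) = coset_act (kappa g) (sigma s)]].
Proof.
have [kappa [c [khat [delta [gamma]]]]] := any_covering_iso.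
case=> ckappa [c0 kappaM] kappax kappat [deltaM kappaE deltanu [z [dk zE]]].
exists kappa, c; split=> //.
  move=> p x y /set_mem xp /set_mem yp /(congr1 delta); rewrite !deltanu.
  have xy : cbase x = cbase y by rewrite [LHS]xp [RHS]yp.
  rewrite xy => /mulIg/mulgI; exact: cspace_eq.
move=> closedG.
have vsub m : subgroup_set (elt @` fibre GG m) by exact: vertex_subgroupP.
have nsub p : subgroup_set (nu @` fibre GGb p) := fg_nu_subgroup p.
pose N m := elt @` fibre GG m; pose M p := nu @` fibre GGb p.
have eqN m g g' : coset_pi N (m, g) = coset_pi N (m, g') <-> N m (g^-1 * g').
  exact: (@coset_pi_eq _ _ N m g g' (vsub m)).
have eqM p g g' : coset_pi M (p, g) = coset_pi M (p, g') <-> M p (g^-1 * g').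
  exact: (@coset_pi_eq _ _ M p g g' (nsub p)).
pose sigma (s : abs_tree_space GG S) : pro_C_tree_space Pi :=
  coset_pi M (principal (coset_repr s).1, kappa (coset_repr s).2 * c (coset_repr s).1).
have sigmaE m g : sigma (coset_pi N (m, g)) = coset_pi M (principal m, kappa g * c m).
  rewrite /sigma; have := coset_space_reprK (coset_pi N (m, g)).
  have : (coset_repr (coset_pi N (m, g))).1 = m by [].
  case: (coset_repr _) => _ h /= -> /eqN[x xm e].
  apply/eqM.
  exists (cembed iota x); first by rewrite /fibre /= -xm.
  have : kappa (elt x) = kappa (h^-1 * g) by rewrite e.
  rewrite kappaM (gmorphV kappaM) kappax xm => E.
  have -> : kappa g = kappa h * (c m * nu (cembed iota x) * (c m)^-1).
    by rewrite E mulgA mulgV mul1g.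
  by rewrite invgM !mulgA !mulgVK mulVg mul1g.
have reprE s : exists m g, s = coset_pi N (m, g).
  by rewrite -[s]coset_space_reprK; case: (coset_repr s) => m g; exists m, g.
exists sigma; split.
- move=> s s'; have [m [g ->]] := reprE s; have [m' [g' ->]] := reprE s'.
  rewrite !sigmaE => e.
  have mm' : m = m'.
    apply: principal_inj.
    by rewrite -[LHS]/(coset_base (coset_pi M (principal m, kappa g * c m))) e.
  subst m'.
  have [x xm xe] := iffLR (eqM _ _ _) e.
  (* Under [delta] the conjugations by [z] and [gamma] cancel, which places the image of g^-1 g' in
     the closure of G(m); closedness brings it back to G(m). *)
  apply/eqN; apply: (completion_closed hK (closedG m)).
  have [cl _ _] := ceta_bij iotaM m.
  suff <- : ceta x = iota (g^-1 * g') by exact: cl.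
  have := congr1 delta xe.
  rewrite deltanu (xm : cbase x = _) !(deltaM, gmorphV deltaM) !kappaE !dk.
  have -> : delta (c m) = z * (gamma (principal m))^-1 by rewrite -(zE m) mulgK.
  rewrite iotaM (gmorphV iotaM) !invgM !invgK !mulgA !mulgVK.
  by move=> /mulIg; rewrite -!mulgA => /mulgI.
- move=> i s; have [m [g ->]] := reprE s.
  have [Vm|Vm] := pselect (vert Γ m).
    rewrite sigmaE [in LHS]inc_id // [RHS]inc_id ?sigmaE //.
    by apply/principalE.
  rewrite /abs_tree coset_graph_incE //; last first.
    move=> _ [x xm <-]; exists (bd GG i x); first by rewrite /fibre /= gproj_bd xm.
    by case: (i); rewrite ?pi1_elt_bd0 // pi1_elt_bd1 xm.
  rewrite !sigmaE /pro_C_tree coset_graph_incE //; last 2 first.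
  + by move=> /principalE.
  + move=> _ [x xm <-]; exists (cbd iotaM tb_cont tbE i x).
      by rewrite /fibre /= -xm.
    case: (i); last by rewrite fg_nu_bd0.
    by rewrite (fg_nu_bd1 x) -xm !mulgA mulVg mul1g mulgVK.
  rewrite -principal_morphism; congr (coset_pi M (_, _)).
  case: (i); last by rewrite !mulg1 -c0.
  by rewrite kappaM kappat -c0 !mulgA mulgVK.
- move=> O [s Os] oO; rewrite -[s]coset_space_reprK in Os.
  case: (coset_repr s) Os => p h Oph.
  have : nbhs (p, h) (coset_pi M @^-1` O).
    by apply: (coset_pi_continuous (N := M)); exact: open_nbhs_nbhs.
  move=> [[A B] /= [pA hB] ABO].
  have [_ [[m _ <-] Am]] := dense_nbhs (@principal_dense T) pA.
  (* Once m is fixed, the dense image of [kappa] is translated by c(m), as [sigma] prescribes. *)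
  have cr : continuous (fun k : Pi => k * c m).
    by apply: continuousM; [move=> k; exact: cvg_id | exact: cst_continuous].
  have hB' : nbhs (h * (c m)^-1) ((fun k => k * c m) @^-1` B).
    by apply: cr; rewrite mulgVK.
  have [_ [[g _ <-] Bg]] := dense_nbhs (completion_dense ckappa) hB'.
  exists (sigma (coset_pi N (m, g))); split; last by eexists.
  by rewrite sigmaE; apply: (ABO (_, _)).
- move=> h s; have [m [g ->]] := reprE s.
  by rewrite coset_act_pi !sigmaE coset_act_pi kappaM mulgA.
Qed.

End AnyCovering.

End Completed.

Theorem theorem3 (C : finGroupType -> Prop)
    (hC : extension_closed_variety C)
    (T X : choiceType) (Γ : graph T) (GG : graph_of_groups X Γ)
    (hΓ : connected_graph Γ) (hred : reduced_gog GG)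
    (S : set T) (hS : maximal_subtree Γ S)
    (hres : residually C (pi1 GG S))
    (K : topGroupType) (iota : pi1 GG S -> K)
    (hK : pro_C_completion C iota) :
  exists (Tb Xb : topologicalType) (Γb : graph Tb)
    (GGb : graph_of_groups Xb Γb) (gamma : T -> Tb) (eta : Xb -> K),
  [/\ (* (a) *)
      [/\ pro_C_graph_of_groups C GGb, graph_morphism Γ Γb gamma,
          injective gamma & dense (range gamma)],
      (* (b) : [eta] identifies the group over [gamma m] with the closure of the
         group over [m], as topological groups (continuous bijections between
         compact Hausdorff spaces being homeomorphisms), and the boundary maps
         extend the given ones *)
      (forall m,
        [/\ set_bij (fibre GGb (gamma m))
              (closure (iota @` (pi1_elt GG S @` fibre GG m))) eta,
            (forall x y, fibre GGb (gamma m) x -> fibre GGb (gamma m) y ->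
              eta (smul GGb x y) = eta x * eta y),
            {within fibre GGb (gamma m), continuous eta}
          & (forall i x y, fibre GG m x -> fibre GGb (gamma m) y ->
              eta y = iota (pi1_elt GG S x) ->
              eta (bd GGb i y) = iota (pi1_elt GG S (bd GG i x)))]),
      (exists (U : universal_covering C Γb) (J : zero_section U),
        inhabited (fundamental_group GGb J))
    & forall (U : universal_covering C Γb) (J : zero_section U)
        (Pi : fundamental_group GGb J),
      exists (kappa : pi1 GG S -> Pi) (c : T -> Pi),
      [/\ (* (c) : the vertex groups in [Pi] are those of the completion, up to
             conjugation by elements [c m] that depend on [J] *)
          pro_C_completion C kappa,
          (forall x y, fibre GGb (gamma (gproj GG x)) y ->
            eta y = iota (pi1_elt GG S x) ->
            kappa (pi1_elt GG S x) =
              c (gproj GG x) * fg_nu Pi y * (c (gproj GG x))^-1),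
          (forall m, c m = c (inc Γ false m)) /\
          (forall m, kappa (pi1_t GG S m) =
            c (inc Γ false m) * fg_nu' Pi (zs_chi J (gamma m)) *
            (c (inc Γ true m))^-1),
          (forall m, set_inj (fibre GGb m) (fg_nu Pi))
        & (* (d) *)
          (forall m, pro_C_closed C (pi1_elt GG S @` fibre GG m)) ->
          exists sigma : abs_tree_space GG S -> pro_C_tree_space Pi,
            [/\ injective sigma,
                graph_morphism (abs_tree GG S) (pro_C_tree Pi) sigma,
                dense (range sigma)
              & forall g s,
                  sigma (coset_act g s) = coset_act (kappa g) (sigma s)]]].
Proof.
pose pK := completion_pro_C hC hK; pose profK := pro_C_profinite pK.
pose iotaM := completionM hK.
have [tb [tb_cont tbE]] := ultra_ext_pro_C (fun e => iota (pi1_t GG S e)) pK.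
exists (ultra T), (cspace iota), (ultra_graph Γ), (cgog iotaM profK tb_cont tbE).
exists (@principal T), (@ceta _ _ _ _ _ _ iota); split.
- split; first exact: cgog_pro_C.
  + exact: principal_morphism.
  + exact: principal_inj.
  + exact: principal_dense.
- move=> m; split; first exact: ceta_bij.
  + by move=> x y xm ym; apply: ceta_mul; rewrite [LHS]xm [RHS]ym.
  + exact/continuous_subspaceT/ceta_continuous.
  + move=> i x y xm; rewrite -(xm : gproj GG x = m) => xy /(cembed_eq xy) ->.
    by rewrite -[bd _ i _]/(cbd iotaM tb_cont tbE i _) -(cembed_bd iotaM tb_cont tbE).
- exact: completed_fundamental_group.
- move=> U J Pi.
  have [kappa [c [ckappa kappax ckappat nu_inj sigmaP]]] :=
    standard_tree_embedding hΓ hS Pi.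
  exists kappa, c; split=> //.
  by move=> x y xy yx; rewrite kappax (cembed_eq xy yx).
Qed.
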